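(* Let $\phi \colon A \to B$ be a quasi-finite map of Dirac rings, and let $B' \subset B$ be the integral closure of $A$ in $B$. Then the map of Dirac spectra $j \colon \operatorname{Spec}(B) \to \operatorname{Spec}(B')$ induced by the inclusion $B' \subset B$ is an open immersion.
   Context: A Dirac ring is a $\mathbb{Z}$-graded ring $A=\bigoplus_{d\in\mathbb{Z}}A_d$ such that $ab=(-1)^{\deg(a)\deg(b)}ba$ for all homogeneous $a,b$ (i.e. a commutative algebra in $\mathbb{Z}$-graded abelian groups with the Koszul sign rule); maps of Dirac rings are degree-preserving ring homomorphisms. All modules are graded modules, and generation/finiteness always refers to families of homogeneous elements. A graded ideal is a graded subgroup $I\subset A$ with $AI\subset I$; it is a graded prime ideal if it is proper and for homogeneous $f,g$, $fg\in I$ implies $f\in I$ or $g\in I$. For a multiplicative set $S$ of homogeneous elements, $S^{-1}A$ is the universal Dirac ring under $A$ in which elements of $S$ become units; $A_{\mathfrak p}$ is the localization at the homogeneous elements not in $\mathfrak p$, $A_f$ the localization at the powers of a homogeneous $f$, and the residue Dirac field is $k(\mathfrak p)=A_{\mathfrak p}/\mathfrak pA_{\mathfrak p}$. The Dirac–Zariski space $|\operatorname{Spec}(A)|$ is the set of graded prime ideals of $A$ with the topology whose basis consists of the sets $|X_f|=\{\mathfrak p : f\notin\mathfrak p\}$, $f$ homogeneous; the Dirac spectrum $\operatorname{Spec}(A)$ is this space with the (unique) sheaf of Dirac rings $\mathcal O$ satisfying $\mathcal O(|X_f|)=A_f$ compatibly with restrictions; a map $\phi\colon A\to B$ induces $\mathfrak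 q\mapsto\phi^{-1}(\mathfrak q)$ and a map of sheaves. A map $q\colon Y\to X$ of Dirac spectra is an open immersion if $|Y|\to|X|$ is an open embedding and $q^*\mathcal O_X\to\mathcal O_Y$ is an isomorphism. A Dirac $A$-algebra $B$ is finitely generated if a finite family of homogeneous elements generates it as an $A$-algebra, and finite if $B$ is finitely generated as a graded $A$-module. $\phi\colon A\to B$ is quasi-finite if it is finitely generated and for every graded prime $\mathfrak p\subset A$ the map $k(\mathfrak p)\to B\otimes_A k(\mathfrak p)$ is finite. A homogeneous $y\in B$ of degree $e$ is integral over $A$ if it is a root of a monic homogeneous polynomial $X^n+a_{n-1}X^{n-1}+\dots+a_0$ in the free Dirac $A$-algebra $A[X]$ on a generator of degree $e$; the integral closure of $A$ in $B$ is the sub-Dirac ring spanned by the integral homogeneous elements. *)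

(* Defs.v *)
From HB Require Import structures.
From mathcomp Require Import all_boot all_order all_algebra.
From mathcomp Require Import boolp classical_sets functions.
From mathcomp Require Import topology.
Set Implicit Arguments.
Unset Strict Implicit.
Unset Printing Implicit Defensive.
Import GRing.Theory.
Local Open Scope classical_set_scope.
Local Open Scope ring_scope.

(** * Dirac rings *)

(* The grading is internal: [gr d] is the subgroup of homogeneous elements of
   degree [d], so that [0] is homogeneous of every degree.  The underlying
   ring may be zero, hence [pzRingType]. *)
Record is_dirac (R : pzRingType) (gr : int -> set R) : Prop := IsDirac {
  gr_zmod : forall d, zmod_closed [in gr d];
  gr_one : gr 0 1;
  gr_mul : forall d e x y, gr d x -> gr e y -> gr (d + e) (x * y);
  gr_span : forall x, exists2 s : seq R,
    (forall y, y \in s -> exists d, gr d y) & x = \sum_(y <- s) y;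
  gr_direct : forall (s : seq int) (c : int -> R), uniq s ->
    (forall d, gr d (c d)) -> \sum_(d <- s) c d = 0 ->
    forall d, d \in s -> c d = 0;
  gr_koszul : forall d e x y, gr d x -> gr e y ->
    x * y = (-1) ^+ (`|d| * `|e|)%N * (y * x) }.

Record diracRing := DiracRing {
  dring :> pzRingType;
  dgr : int -> set dring;
  dringP : is_dirac dgr }.

Definition homog (A : diracRing) : set A := [set x | exists d, dgr d x].

Record diracHom (A B : diracRing) := DiracHom {
  dhom :> {rmorphism A -> B};
  dhomP : forall d x, dgr d x -> dgr d (dhom x) }.

Lemma dcomp_subproof (A B C : diracRing) (g : diracHom B C)
  (f : diracHom A B) d x : dgr d x -> dgr d ((g \o f) x).
Proof. by move=> dx; do 2 apply: dhomP. Qed.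

Definition dcomp (A B C : diracRing) (g : diracHom B C) (f : diracHom A B) :
  diracHom A C := DiracHom (@dcomp_subproof A B C g f).

Definition dunit (A : diracRing) : set A :=
  [set x | exists y, x * y = 1 /\ y * x = 1].

(** * Sub-Dirac rings *)

Section Subring.
Variables (A : diracRing) (G : set A).

(* The subring generated by [G]. *)
Definition subring_gen : set A :=
  [set x | forall P : set A, subring_closed [in P] -> G `<=` P -> P x].

Definition in_subring_gen : {pred A} := fun x => x \in subring_gen.

Lemma subring_gen_closed : subring_closed in_subring_gen.
Proof.
split=> [|x y|x y]; rewrite !inE.
- by move=> P [P1 _ _] _; apply/set_mem.
- move=> Px Py P cP GP; case: (cP) => _ PB _.
  by apply/set_mem/PB; apply/mem_set; [apply: Px|apply: Py].
- move=> Px Py P cP GP; case: (cP) => _ _ PM.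
  by apply/set_mem/PM; apply/mem_set; [apply: Px|apply: Py].
Qed.

Definition subring_type : Type := {x : A | in_subring_gen x}.
HB.instance Definition _ := SubType.on subring_type.
HB.instance Definition _ := Choice.on subring_type.
HB.instance Definition _ := GRing.SubChoice_isSubPzRing.Build A in_subring_gen
  subring_type subring_gen_closed.

Definition subring_gr (d : int) : set subring_type :=
  [set x | dgr d (val x)].

Hypothesis Ghomog : G `<=` @homog A.

Lemma subring_gen_span x : subring_gen x -> exists2 s : seq A,
  (forall y, y \in s -> homog y /\ subring_gen y) & x = \sum_(y <- s) y.
Proof.
case: (dringP A) => grZ gr1 grM _ _ _ Sx.
have [S1 SB SM] := subring_gen_closed.
pose P : set A := [set x | exists2 s : seq A,
  (forall y, y \in s -> homog y /\ subring_gen y) & x = \sum_(y <- s) y].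
apply: (Sx P) => [|y Gy]; last first.
  exists [:: y]; last by rewrite big_seq1.
  by move=> z; rewrite inE => /eqP->; split; [apply: Ghomog|move=> Q _; apply].
split=> [|y z|y z]; rewrite !inE.
- exists [:: 1]; last by rewrite big_seq1.
  by move=> z; rewrite inE => /eqP->; split; [exists 0|apply/set_mem].
- move=> [s sP ->] [t tP ->]; exists (s ++ [seq - w | w <- t]); last first.
    by rewrite big_cat big_map sumrN.
  move=> w; rewrite mem_cat => /orP[/sP //|/mapP[v /tP[[d dv] Sv] ->]].
  split.
    exists d; have [g0 gB] := grZ d; apply/set_mem.
    by rewrite -sub0r; apply: gB => //; apply/mem_set.
  apply/set_mem; rewrite -sub0r; apply: (SB _ _); last by apply/mem_set.
  by rewrite -(subrr 1); apply: (SB _ _).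
- move=> [s sP ->] [t tP ->]; exists [seq v * w | v <- s, w <- t].
    move=> _ /allpairsP[[v w] /= [/sP[[d dv] Sv] /tP[[e ew] Sw] ->]].
    split; first by exists (d + e); apply: grM.
    by apply/set_mem/SM; apply/mem_set.
  rewrite big_allpairs_dep mulr_suml; apply: eq_bigr => v _.
  by rewrite mulr_sumr.
Qed.

Lemma subring_dirac : is_dirac subring_gr.
Proof.
have grE d x : subring_gr d x = dgr d (val x) by [].
case: (dringP A) => grZ gr1 grM grS grD grK; split.
- move=> d; have [g0 gB] := grZ d.
  split=> [|x y]; rewrite !inE !grE.
    by rewrite raddf0; apply/set_mem.
  by rewrite raddfB => dx dy; apply/set_mem/gB; apply/mem_set.
- by rewrite grE rmorph1.
- by move=> d e x y; rewrite !grE rmorphM; apply: grM.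
- move=> x; have Sx : subring_gen (val x) by apply/set_mem/(valP x).
  have [s sP xE] := subring_gen_span Sx.
  have sS : all in_subring_gen s.
    by apply/allP => y /sP[_ Sy]; apply/mem_set.
  exists (pmap insub s) => [y|].
    by rewrite mem_pmap_sub => /sP[[d dy] _]; exists d.
  apply: val_inj; rewrite raddf_sum xE big_pmap big_seq [RHS]big_seq.
  apply: eq_bigr => y /(allP sS) Sy.
  by rewrite insubT.
- move=> s c us cP c0 d ds; apply: val_inj; rewrite raddf0.
  apply: (grD s (fun d => val (c d))) => //.
  by rewrite -raddf_sum c0 raddf0.
- move=> d e x y dx dy; apply: val_inj.
  by rewrite !rmorphM rmorphXn rmorphN1 /= (grK d e).
Qed.

Definition subDirac : diracRing := DiracRing subring_dirac.

Definition subDirac_incl : diracHom subDirac A :=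
  @DiracHom subDirac A (val : {rmorphism subring_type -> A})
    (fun _ _ dx => dx).

End Subring.

(** * Ideals, quotients, localizations and pushouts *)

Definition graded_ideal (A : diracRing) (I : set A) : Prop :=
  [/\ zmod_closed [in I],
      forall a x, I x -> I (a * x) &
      forall x, I x -> exists2 s : seq A,
        (forall y, y \in s -> homog y /\ I y) & x = \sum_(y <- s) y].

Definition ideal_gen (A : diracRing) (G : set A) : set A :=
  [set x | forall I : set A, graded_ideal I -> G `<=` I -> I x].

Definition graded_prime (A : diracRing) (I : set A) : Prop :=
  [/\ graded_ideal I, ~ I 1 &
      forall f g, homog f -> homog g -> I (f * g) -> I f \/ I g].

(* [q] exhibits [Q] as the quotient [A / I]. *)
Definition is_quotient (A Q : diracRing) (I : set A) (q : diracHom A Q) :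
  Prop := (forall y, exists x, q x = y) /\ (forall x, q x = 0 <-> I x).

(* [l] exhibits [L] as the localization of [A] at [S]. *)
Definition is_localization (A L : diracRing) (S : set A) (l : diracHom A L) :
  Prop :=
  (forall s, S s -> dunit (l s)) /\
  forall (C : diracRing) (f : diracHom A C), (forall s, S s -> dunit (f s)) ->
    exists g : diracHom L C, (forall x, g (l x) = f x) /\
      forall g' : diracHom L C, (forall x, g' (l x) = f x) -> g' =1 g.

Definition powers (A : diracRing) (f : A) : set A :=
  [set x | exists n : nat, x = f ^+ n].

(* [u] and [v] exhibit [T] as the pushout of [f] and [g] in Dirac rings, that
   is, as the tensor product of [B] and [C] over [A]. *)
Definition is_pushout (A B C T : diracRing) (f : diracHom A B)
    (g : diracHom A C) (u : diracHom B T) (v : diracHom C T) : Prop :=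
  (forall a, u (f a) = v (g a)) /\
  forall (D : diracRing) (b : diracHom B D) (c : diracHom C D),
    (forall a, b (f a) = c (g a)) ->
    exists h : diracHom T D,
      ((forall x, h (u x) = b x) /\ (forall x, h (v x) = c x)) /\
      forall h' : diracHom T D,
        (forall x, h' (u x) = b x) -> (forall x, h' (v x) = c x) -> h' =1 h.

(* [k] exhibits [K] as the residue Dirac field of [A] at [p]: the localization
   [L] at the homogeneous elements outside [p], modulo the extension of [p]. *)
Definition is_residue_field (A K : diracRing) (p : set A)
    (k : diracHom A K) : Prop :=
  exists (L : diracRing) (l : diracHom A L) (q : diracHom L K),
    [/\ is_localization [set s | homog s /\ ~ p s] l,
        is_quotient (ideal_gen (l @` p)) q &
        forall a, k a = q (l a)].

(** * Finiteness conditions and integral closure *)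

Definition dfinite (A B : diracRing) (phi : diracHom A B) : Prop :=
  exists2 s : seq B, (forall y, y \in s -> homog y) &
    forall b, exists a : nat -> A, b = \sum_(i < size s) phi (a i) * s`_i.

Definition finitely_generated (A B : diracRing) (phi : diracHom A B) : Prop :=
  exists2 s : seq B, (forall y, y \in s -> homog y) &
    forall b, subring_gen (range phi `|` [set y | y \in s]) b.

(* The residue field and the tensor product are determined up to unique
   isomorphism by their universal properties, and finiteness is required of
   every model of them. *)
Definition quasi_finite (A B : diracRing) (phi : diracHom A B) : Prop :=
  finitely_generated phi /\
  forall p : set A, graded_prime p ->
  forall (K : diracRing) (k : diracHom A K), is_residue_field p k ->
  forall (T : diracRing) (u : diracHom B T) (v : diracHom K T),
    is_pushout phi k u v -> dfinite v.

(* [y] of degree [e] is a root of a polynomial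
   X^n + a_(n-1) X^(n-1) + ... + a_0 which is homogeneous of degree [n * e] when
   X has degree [e]: the coefficient a_i has degree [(n - i) * e]. *)
Definition integral (A B : diracRing) (phi : diracHom A B) : set B :=
  [set y | exists e, dgr e y /\ exists (n : nat) (a : 'I_n -> A),
    (forall i : 'I_n, dgr (e *+ (n - i)) (a i)) /\
    y ^+ n + \sum_(i < n) phi (a i) * y ^+ i = 0].

Lemma integral_homog (A B : diracRing) (phi : diracHom A B) :
  integral phi `<=` @homog B.
Proof. by move=> y [e [ey _]]; exists e. Qed.

(* Generating a subring or an additive subgroup gives the same result here, as
   the homogeneous integral elements are closed under products, and under sums
   within a degree. *)
Definition integral_closure (A B : diracRing) (phi : diracHom A B) :
  diracRing := subDirac (@integral_homog A B phi).

Definition integral_closure_incl (A B : diracRing) (phi : diracHom A B) :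
  diracHom (integral_closure phi) B := subDirac_incl (@integral_homog A B phi).

(** * The Dirac-Zariski space *)

Record spec (A : diracRing) := Spec {
  spec_ideal : set A;
  specP : graded_prime spec_ideal }.

HB.instance Definition _ (A : diracRing) := gen_eqMixin (spec A).
HB.instance Definition _ (A : diracRing) := gen_choiceMixin (spec A).

(* The set |X_f|. *)
Definition nonvanishing (A : diracRing) (f : A) : set (spec A) :=
  [set p | ~ spec_ideal p f].

Definition zariski_open (A : diracRing) : set (set (spec A)) :=
  [set U | forall p, U p -> exists f,
    [/\ homog f, nonvanishing f p & nonvanishing f `<=` U]].
Arguments zariski_open : clear implicits.

Section SpecTopology.
Variable A : diracRing.

Lemma homog1 : homog (1 : A).
Proof. by exists 0; case: (dringP A). Qed.

Lemma homogM (x y : A) : homog x -> homog y -> homog (x * y).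
Proof.
by move=> [d dx] [e ey]; exists (d + e); case: (dringP A) => _ _ + _ _ _; apply.
Qed.

Lemma spec_idealMl (p : spec A) a x : spec_ideal p x ->
  spec_ideal p (a * x).
Proof. by case: p => I [[_ + _] _ _] /=; apply. Qed.

Lemma spec_idealMr (p : spec A) a x : homog a -> homog x ->
  spec_ideal p x -> spec_ideal p (x * a).
Proof.
move=> [d da] [e ex] px; case: (dringP A) => _ _ _ _ _ K.
by rewrite (K _ _ _ _ ex da) mulrA; apply: spec_idealMl.
Qed.

Lemma nonvanishingM (f g : A) : homog f -> homog g ->
  nonvanishing (f * g) = nonvanishing f `&` nonvanishing g.
Proof.
move=> hf hg; apply/seteqP; split=> p /=.
  move=> pfg; split=> ?; apply: pfg; first exact: spec_idealMr.
  exact: spec_idealMl.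
by move=> [pf pg]; case: (specP p) => _ _ IP /(IP _ _ hf hg)[].
Qed.

Lemma zariski_openT : zariski_open A setT.
Proof.
move=> p _; exists 1; split=> //; first exact: homog1.
by case: (specP p).
Qed.

Lemma zariski_openI U V : zariski_open A U -> zariski_open A V ->
  zariski_open A (U `&` V).
Proof.
move=> oU oV p [/oU[f [hf pf fU]] /oV[g [hg pg gV]]].
exists (f * g); split; [exact: homogM|by rewrite nonvanishingM|].
by rewrite nonvanishingM //; apply: setISS.
Qed.

Lemma zariski_open_bigU (I : Type) (F : I -> set (spec A)) :
  (forall i, zariski_open A (F i)) -> zariski_open A (\bigcup_i F i).
Proof.
move=> oF p [i _ /(oF i)[f [hf pf fF]]]; exists f; split=> //.
by move=> q /fF Fq; exists i.
Qed.

HB.instance Definition _ := isOpenTopological.Build (spec A)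
  zariski_openT zariski_openI zariski_open_bigU.

Lemma open_specE (U : set (spec A)) : open U = zariski_open A U.
Proof. by []. Qed.

Lemma open_nonvanishing (f : A) : homog f -> open (nonvanishing f).
Proof. by rewrite open_specE => hf p pf; exists f; split. Qed.

End SpecTopology.

Lemma mem_sum_closed (A : diracRing) (I : set A) (T : Type) (t : seq T)
    (P : pred T) (F : T -> A) :
  zmod_closed [in I] -> (forall y, P y -> I (F y)) ->
  I (\sum_(y <- t | P y) F y).
Proof.
move=> [/set_mem I0 IB] IF; apply: (big_ind (fun x => I x)) => // x y Ix Iy.
have IN : I (- y) by apply/set_mem; rewrite -sub0r; apply: IB; apply/mem_set.
by rewrite -[y]opprK; apply/set_mem; apply: IB; apply/mem_set.
Qed.

Lemma homog_decomposition (A : diracRing) (I : set A) (t : seq A) :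
  zmod_closed [in I] -> (forall y, y \in t -> homog y /\ I y) ->
  exists (u : seq int) (b : int -> A),
    [/\ uniq u, forall d, dgr d (b d) /\ I (b d),
        forall d, d \notin u -> b d = 0 &
        \sum_(y <- t) y = \sum_(d <- u) b d].
Proof.
move=> IZ tP.
have [|e eP] := @choice _ _ (fun y d => y \in t -> dgr d y).
  move=> y.
  have [/tP[[d dy] _]|] := boolP (y \in t); first by exists d.
  by exists 0.
exists (undup (map e t)), (fun d => \sum_(y <- t | (y \in t) && (e y == d)) y).
split; first exact: undup_uniq.
- move=> d; split; apply: mem_sum_closed => //; first by case: (dringP A).
    by move=> y /andP[yt /eqP<-]; apply: eP.
  by move=> y /andP[/tP[]].
- move=> d; rewrite mem_undup => dt.
  apply: big1_seq => y /andP[/andP[yt /eqP ed] _].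
  by case/mapP: dt; exists y.
- rewrite big_seq [RHS](exchange_big_dep [in t]) /= => [|d y _ /andP[]//].
  apply: eq_bigr => y yt; rewrite yt /= -big_filter.
  rewrite (_ : [seq d <- _ | _] = [:: e y]) ?big_seq1 //.
  apply: perm_small_eq => //; apply: uniq_perm => // [|d].
    by rewrite filter_uniq ?undup_uniq.
  rewrite mem_filter mem_undup inE.
  change ((e y == d) && (d \in map e t) = (d == e y)); rewrite eq_sym.
  by have [->|//] := eqVneq d (e y); rewrite map_f.
Qed.

Lemma homog_components (A : diracRing) (x : A) :
  exists (s : seq int) (c : int -> A),
    [/\ uniq s, forall d, dgr d (c d) & x = \sum_(d <- s) c d].
Proof.
have [s sP ->] := gr_span (dringP A) x.
have [] := @homog_decomposition A setT s; first by split=> [|y z _ _]; apply: in_setT.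
  by move=> y /sP[d dy]; split=> //; exists d.
move=> u [b [uu bP _ ->]]; exists u, b; split=> // d.
by case: (bP d).
Qed.

Lemma graded_ideal_component (A : diracRing) (I : set A) (s : seq int)
    (c : int -> A) :
  graded_ideal I -> uniq s -> (forall d, dgr d (c d)) ->
  I (\sum_(d <- s) c d) -> forall d, d \in s -> I (c d).
Proof.
move=> [IZ _ IG] us cP /IG[t tP tE] d ds.
have [u [b [uu bP b0 bE]]] := homog_decomposition IZ tP.
pose c' d := if d \in s then c d else 0.
have gZ := gr_zmod (dringP A).
have c'P e : dgr e (c' e - b e).
  apply/set_mem; have [g0 gB] := gZ e; apply: gB; apply/mem_set.
    by rewrite /c'; case: ifP => _ //; apply/set_mem.
  by case: (bP e).
have sub_sum (r : seq int) (F : int -> A) : uniq r -> {subset r <= s ++ u} ->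
    (forall e, e \notin r -> F e = 0) ->
    \sum_(e <- undup (s ++ u)) F e = \sum_(e <- r) F e.
  move=> ur rs F0; rewrite (bigID (mem r)) /= [X in _ + X]big1 ?addr0 //.
  rewrite -big_filter; apply: perm_big; apply: uniq_perm => //.
    by rewrite filter_uniq ?undup_uniq.
  move=> e; rewrite mem_filter mem_undup.
  by have [er|//] := boolP (e \in r); rewrite rs.
have := @gr_direct _ _ (dringP A) (undup (s ++ u)) (fun e => c' e - b e)
  (undup_uniq _) c'P.
rewrite sumrB (sub_sum s) ?(sub_sum u) //; last 3 first.
- by move=> e eu; rewrite mem_cat eu orbT.
- by move=> e es; rewrite mem_cat es.
- by move=> e; rewrite /c' => /negbTE->.
have -> : \sum_(e <- s) c' e = \sum_(e <- s) c e.
  by rewrite big_seq [RHS]big_seq; apply: eq_bigr => e es; rewrite /c' es.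
rewrite tE bE subrr => /(_ erefl d); rewrite mem_undup mem_cat ds => /(_ isT).
by rewrite /c' ds => /eqP; rewrite subr_eq0 => /eqP->; case: (bP d).
Qed.

Section SpecMap.
Variables (A B : diracRing) (phi : diracHom A B).

Lemma preimage_graded_prime (q : spec B) :
  graded_prime (phi @^-1` spec_ideal q).
Proof.
case: (specP q) => qI q1 qP; case: (qI) => [[q0 qB] qM _]; split.
- split=> [|a x|x].
  + split=> [|x y]; first by rewrite inE /= rmorph0; apply/set_mem.
    rewrite !inE /= rmorphB => qx qy.
    by apply/set_mem; apply: qB; apply/mem_set.
  + by rewrite /= rmorphM; apply: qM.
  + have [s [c [us cP ->]]] := homog_components x.
    rewrite /= rmorph_sum => qx.
    exists (map c s); last by rewrite big_map.
    move=> _ /mapP[d ds ->]; split; first by exists d.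
    apply: (graded_ideal_component (c := phi \o c) qI us _ qx ds) => e.
    exact: dhomP.
- by rewrite /= rmorph1.
- move=> f g [d df] [e eg]; rewrite /= rmorphM; apply: qP.
    by exists d; apply: dhomP.
  by exists e; apply: dhomP.
Qed.

Definition spec_map (q : spec B) : spec A := Spec (preimage_graded_prime q).

Lemma spec_map_continuous : continuous spec_map.
Proof.
apply/continuousP => U; rewrite !open_specE => oU q /= /oU[f [[d df] qf fU]].
exists (phi f); split=> //; first by exists d; apply: dhomP.
by move=> r rf; apply: fU.
Qed.

End SpecMap.

(** * Sheaves of Dirac rings *)

Record opens (X : topologicalType) := Opens {
  oset :> set X;
  osetP : open oset }.

Definition opensT (X : topologicalType) : opens X := Opens (@openT X).

Lemma opensT_sub (X : topologicalType) (U : opens X) : U `<=` opensT X.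
Proof. exact: subsetT. Qed.

Definition opens_preimage (X Y : topologicalType) (f : Y -> X)
  (fC : continuous f) (U : opens X) : opens Y :=
  Opens ((continuousP f).1 fC U (osetP U)).

Record presheaf (X : topologicalType) := Presheaf {
  sec :> opens X -> diracRing;
  res : forall U V : opens X, V `<=` U -> diracHom (sec U) (sec V);
  res_id : forall (U : opens X) (UU : U `<=` U), res UU =1 id;
  res_comp : forall (U V W : opens X) (VU : V `<=` U) (WV : W `<=` V)
    (WU : W `<=` U), res WV \o res VU =1 res WU }.

Arguments res {X} p {U V} _.

(* Limits of Dirac rings are computed degreewise, so compatible families are
   required to glue when they are homogeneous of a common degree. *)
Definition is_sheaf (X : topologicalType) (F : presheaf X) : Prop :=
  forall (I : Type) (U : opens X) (V : I -> opens X)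
    (VU : forall i, V i `<=` U), U `<=` \bigcup_i V i ->
  forall (d : int) (s : forall i, F (V i)),
    (forall i, dgr d (s i)) ->
    (forall i j (W : opens X) (Wi : W `<=` V i) (Wj : W `<=` V j),
       res F Wi (s i) = res F Wj (s j)) ->
  exists! t : F U, dgr d t /\ forall i, res F (VU i) t = s i.

Definition basic_open (A : diracRing) (f : A) (hf : homog f) :
  opens (spec A) := Opens (open_nonvanishing hf).

(* The structure sheaf of the Dirac spectrum: a sheaf of Dirac rings under [A]
   such that [A -> O(|X_f|)] exhibits [O(|X_f|)] as [A_f].  As the restriction
   maps are maps under [A], they are then the canonical maps between these
   localizations. *)
Record structureSheaf (A : diracRing) := StructureSheaf {
  ssheaf :> presheaf (spec A);
  ssheafP : is_sheaf ssheaf;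
  sglobal : diracHom A (ssheaf (opensT (spec A)));
  sglobal_loc : forall (f : A) (hf : homog f),
    is_localization (powers f)
      (dcomp (res ssheaf (@opensT_sub _ (basic_open hf))) sglobal) }.

(* The map of Dirac spectra induced by [phi]: the map of sheaves from [OX] to
   the direct image of [OY] which extends [phi]. *)
Record specMorphism (A B : diracRing) (phi : diracHom A B)
    (OX : structureSheaf A) (OY : structureSheaf B) := SpecMorphism {
  smap : forall U : opens (spec A),
    diracHom (OX U) (OY (opens_preimage (@spec_map_continuous A B phi) U));
  smap_natural : forall (U V : opens (spec A)) (VU : V `<=` U)
    (VU' : opens_preimage (@spec_map_continuous A B phi) V `<=`
           opens_preimage (@spec_map_continuous A B phi) U) (s : OX U),
    smap V (res OX VU s) = res OY VU' (smap U s);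
  smap_global : forall a : A,
    smap (opensT (spec A)) (sglobal OX a) =
    res OY (@opensT_sub _ _) (sglobal OY (phi a)) }.

Definition open_embedding (X Y : topologicalType) (f : Y -> X) : Prop :=
  [/\ continuous f, injective f & forall V, open V -> open (f @` V)].

(* For an open embedding [q] the inverse image sheaf is
   (q^* O_X)(V) = O_X(q(V)), and q^* O_X -> O_Y is the map of sheaves
   O_X(q(V)) -> O_Y(q^-1(q(V))) followed by the restriction to [V].  A map of
   Dirac rings is an isomorphism when it is bijective. *)
Definition open_immersion (A B : diracRing) (phi : diracHom A B)
    (OX : structureSheaf A) (OY : structureSheaf B)
    (q : specMorphism phi OX OY) : Prop :=
  open_embedding (spec_map phi) /\
  forall (V : opens (spec B)) (qV : opens (spec A)),
    qV = spec_map phi @` V :> set (spec A) ->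
  forall VqV : V `<=` opens_preimage (@spec_map_continuous A B phi) qV,
    bijective (fun s : OX qV => res OY VqV (smap q qV s)).

(* Main.v *)
Require Import Defs.
From HB Require Import structures.
From mathcomp Require Import all_boot all_order all_algebra.
From mathcomp Require Import qpoly generic_quotient.
From mathcomp Require Import boolp classical_sets functions topology.
From mathcomp Require Import ring zify.
Set Implicit Arguments.
Unset Strict Implicit.
Unset Printing Implicit Defensive.
Import GRing.Theory.
Local Open Scope classical_set_scope.
Local Open Scope ring_scope.

(* The even part of a Dirac ring is commutative, and [B] is integral over it.
   For commutative rings, the local algebraic form of Zariski's main theorem
   (Peskine) says: if [T] is integral over [A[x_1, ..., x_n]] and each
   [x_i] is algebraic in the fibre at a prime [q], then some [u] outside [q],
   integral over [A], satisfies [u^N t] integral over [A] for every [t] and some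
   [N].  It applies to the even part of [B] over the image of the even part of
   [A], with [x_i] the even generators and the squares of the odd ones: finiteness
   of the fibre makes the powers of a generator dependent over the residue field.
   Multiplying polynomials by a power of the variable homogenises the element
   [u], so for each graded prime of [B] there is an even [f] in [B'] outside it
   such that every element of [B] is moved into [B'] by a power of [f].  Hence
   [B'_f = B_f], these [f] give a basis of the topology of [Spec(B)], and the
   isomorphisms on the basis glue. *)

(** * Integral elements *)

(** Koszul signs only give 2y^2 = 0 for an odd y, so odd elements need not be nilpotent and their
    squares must be kept among the even generators. Passing to the even part then meets three
    mismatches. A graded prime is prime for homogeneous elements only; that its trace on the even
    part is an honest prime is an argument of Gauss's lemma type. The extension of [p] meets the
    even part in an ideal that agrees with the one generated by even elements only up to radical. A
    dependence relation in the fibre may have odd coefficients or an odd variable; it is made even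
    by multiplying with one of its coefficients, or by squaring, where the cross terms cancel in odd
    total degree. The one-variable case turns on the conductor of a finite algebra [D] over [A[x]].
    If it is not inside [q], then [x] satisfies an equation over [A] whose coefficients are not all
    in [q]. Otherwise [x] is transcendental modulo a prime minimal over the conductor and contained
    in [q], and a form of going down for normal rings rules this out. Homogenising preserves
    integrality because an integral polynomial has integral coefficients. *)

Section Subrings.
Variable R : comNzRingType.
Implicit Types (A B : set R) (p q : {poly R}) (x y : R).

(** Subrings, ideals and primes are predicates on one ambient ring: the induction on generators
    keeps changing the base ring, and elements then never move between types. *)
Definition is_subring A := [/\ A 1, forall x y, A x -> A y -> A (x - y) &
  forall x y, A x -> A y -> A (x * y)].

Definition coefs_in A p := forall i, A p`_i.

Definition adjoin A x : set R := [set y | exists2 p, coefs_in A p & y = p.[x]].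

Definition intg A y := exists p, [/\ p \is monic, coefs_in A p & root p y].

Section Closure.
Variables (A : set R) (hA : is_subring A).

Lemma subr_1 : A 1. Proof. by case: hA. Qed.
Lemma subr_B x y : A x -> A y -> A (x - y). Proof. by case: hA => _ + _; apply. Qed.
Lemma subr_M x y : A x -> A y -> A (x * y). Proof. by case: hA => _ _; apply. Qed.
Lemma subr_0 : A 0. Proof. by rewrite -(subrr 1); apply: subr_B; apply: subr_1. Qed.
Lemma subr_N x : A x -> A (- x).
Proof. by move=> Ax; rewrite -sub0r; apply: subr_B => //; apply: subr_0. Qed.
Lemma subr_D x y : A x -> A y -> A (x + y).
Proof. by move=> Ax Ay; rewrite -[y]opprK; apply/subr_B/subr_N. Qed.
Lemma subr_sum (I : Type) (r : seq I) (P : pred I) (F : I -> R) :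
  (forall i, P i -> A (F i)) -> A (\sum_(i <- r | P i) F i).
Proof. by move=> AF; apply: (big_ind A) => //; [exact: subr_0|exact: subr_D]. Qed.
Lemma subr_sum_seq (I : eqType) (r : seq I) (F : I -> R) :
  (forall i, i \in r -> A (F i)) -> A (\sum_(i <- r) F i).
Proof. by move=> AF; rewrite big_seq; apply: subr_sum. Qed.
Lemma subr_X x n : A x -> A (x ^+ n).
Proof.
move=> Ax; elim: n => [|n IH]; first by rewrite expr0; apply: subr_1.
by rewrite exprS; apply: subr_M.
Qed.

Lemma coefs_in0 : coefs_in A 0. Proof. by move=> i; rewrite coef0; apply: subr_0. Qed.
Lemma coefs_inC x : A x -> coefs_in A x%:P.
Proof. by move=> Ax i; rewrite coefC; case: eqP => // _; apply: subr_0. Qed.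
Lemma coefs_in1 : coefs_in A 1. Proof. by apply: coefs_inC; apply: subr_1. Qed.
Lemma coefs_inXn n : coefs_in A 'X^n.
Proof. by move=> i; rewrite coefXn; case: eqP => _; [apply: subr_1|apply: subr_0]. Qed.
Lemma coefs_inX : coefs_in A 'X.
Proof. by rewrite -['X]expr1; apply: coefs_inXn. Qed.
Lemma coefs_inB p q : coefs_in A p -> coefs_in A q -> coefs_in A (p - q).
Proof. by move=> Ap Aq i; rewrite coefB; apply: subr_B. Qed.
Lemma coefs_inD p q : coefs_in A p -> coefs_in A q -> coefs_in A (p + q).
Proof. by move=> Ap Aq i; rewrite coefD; apply: subr_D. Qed.
Lemma coefs_inM p q : coefs_in A p -> coefs_in A q -> coefs_in A (p * q).
Proof. by move=> Ap Aq i; rewrite coefM; apply: subr_sum => j _; apply: subr_M. Qed.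
Lemma coefs_inZ a p : A a -> coefs_in A p -> coefs_in A (a *: p).
Proof. by move=> Aa Ap i; rewrite coefZ; apply: subr_M. Qed.
Lemma coefs_in_exp p n : coefs_in A p -> coefs_in A (p ^+ n).
Proof.
move=> Ap; elim: n => [|n IH]; first by rewrite expr0; apply: coefs_in1.
by rewrite exprS; apply: coefs_inM.
Qed.
Lemma coefs_in_sum (I : Type) (r : seq I) (P : pred I) (F : I -> {poly R}) :
  (forall i, P i -> coefs_in A (F i)) -> coefs_in A (\sum_(i <- r | P i) F i).
Proof.
by move=> AF; apply: (big_ind (coefs_in A)) => //; [exact: coefs_in0|exact: coefs_inD].
Qed.
Lemma horner_in p x : coefs_in A p -> A x -> A p.[x].
Proof.
by move=> Ap Ax; rewrite horner_coef; apply: subr_sum => i _; apply/subr_M/subr_X.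
Qed.

Lemma adjoin_subring x : is_subring (adjoin A x).
Proof.
split=> [|_ _ [p Ap ->] [q Aq ->]|_ _ [p Ap ->] [q Aq ->]].
- by exists 1; [apply: coefs_in1|rewrite hornerC].
- by exists (p - q); [apply: coefs_inB|rewrite hornerD hornerN].
- by exists (p * q); [apply: coefs_inM|rewrite hornerM].
Qed.
Lemma adjoin_sub x : A `<=` adjoin A x.
Proof. by move=> a Aa; exists a%:P; [apply: coefs_inC|rewrite hornerC]. Qed.
Lemma adjoin_gen x : adjoin A x x.
Proof. by exists 'X; [apply: coefs_inX|rewrite hornerX]. Qed.
Lemma adjoin_min B x : is_subring B -> A `<=` B -> B x -> adjoin A x `<=` B.
Proof.
move=> [B1 BB BM] AB Bx _ [p Ap ->]; rewrite horner_coef.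
have B0 : B 0 by rewrite -(subrr 1); apply: BB.
have BN y : B y -> B (- y) by move=> By; rewrite -sub0r; apply: BB.
apply: (big_ind B) => // [u v Bu Bv|i _].
  by rewrite -[v]opprK; apply/BB/BN.
apply: (BM); first exact: AB.
by elim: (nat_of_ord i) => [|n IH]; rewrite ?expr0 // exprS; apply: (BM).
Qed.

(* The subring [A] as a type, to import the theory of [integralOver]. *)
Definition sring_pred of is_subring A : {pred R} := fun x => `[< A x >].
Definition sring (h : is_subring A) : Type := {x : R | sring_pred h x}.
HB.instance Definition _ h := SubType.on (sring h).
HB.instance Definition _ h := Choice.on (sring h).
Lemma sring_closed h : subring_closed (sring_pred h).
Proof.
split=> [|x y|x y]; rewrite !unfold_in; first by apply/asboolP; apply: subr_1.
  by move=> /asboolP Ax /asboolP Ay; apply/asboolP/subr_B.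
by move=> /asboolP Ax /asboolP Ay; apply/asboolP/subr_M.
Qed.
HB.instance Definition _ h := GRing.SubChoice_isSubComNzRing.Build R
  (sring_pred h) (sring h) (sring_closed h).

Definition sring_val (a : sring hA) : R := val a.
Arguments sring_val : simpl never.
HB.instance Definition _ := GRing.RMorphism.copy sring_val (val : sring hA -> R).

Lemma sring_valP (a : sring hA) : A (sring_val a).
Proof. exact/asboolP/(valP a). Qed.

Lemma sring_lift x : A x -> exists a : sring hA, sring_val a = x.
Proof.
by move=> /asboolP Ax; exists (exist (fun x => sring_pred hA x) x Ax).
Qed.

Lemma sring_val_inj : injective sring_val.
Proof. exact: val_inj. Qed.

Lemma sring_lift_poly p : coefs_in A p ->
  exists q : {poly sring hA}, map_poly sring_val q = p.
Proof.
move=> Ap; have [f fP] := choice (fun i => sring_lift (Ap i)).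
exists (\poly_(i < size p) f i); apply/polyP => i.
rewrite coef_map coef_poly; case: ltnP => [_|sp]; first exact: fP.
by rewrite nth_default //; apply: (rmorph0 sring_val).
Qed.

Lemma coefs_in_val (q : {poly sring hA}) : coefs_in A (map_poly sring_val q).
Proof. by move=> i; rewrite coef_map; apply: sring_valP. Qed.

Lemma monic_val (q : {poly sring hA}) :
  (map_poly sring_val q \is monic) = (q \is monic).
Proof.
by rewrite !monicE (lead_coef_map_inj sring_val_inj (rmorph0 _))
  -(rmorph1 sring_val) (inj_eq sring_val_inj).
Qed.

(** Division by a monic polynomial needs no inverses, so it can be done over the type [sring hA];
    this is what keeps quotient and remainder over [A]. *)
Lemma monic_division d p : d \is monic -> coefs_in A d -> coefs_in A p ->
  exists q r, [/\ coefs_in A q, coefs_in A r, p = q * d + r &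
    (size r < size d)%N].
Proof.
move=> md /sring_lift_poly[d' dE] /sring_lift_poly[p' pE].
have md' : d' \is monic by rewrite -monic_val dE.
exists (map_poly sring_val (Pdiv.Ring.rdivp p' d')).
exists (map_poly sring_val (Pdiv.Ring.rmodp p' d')); split.
- exact: coefs_in_val.
- exact: coefs_in_val.
- by rewrite -dE -rmorphM -rmorphD -Pdiv.RingMonic.rdivp_eq.
- rewrite -dE !(size_map_inj_poly sring_val_inj (rmorph0 _)).
  by rewrite Pdiv.Ring.ltn_rmodp monic_neq0.
Qed.

Lemma intgP y : intg A y <-> integralOver sring_val y.
Proof.
split=> [[p [mp /sring_lift_poly[q qp] py]]|[q mq qy]].
  by exists q; rewrite ?qp // -monic_val qp.
exists (map_poly sring_val q); split=> //; first by rewrite monic_val.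
exact: coefs_in_val.
Qed.

Lemma intg_id x : A x -> intg A x.
Proof. by move=> /sring_lift[a <-]; apply/intgP; apply: integral_id. Qed.

Lemma intgB x y : intg A x -> intg A y -> intg A (x - y).
Proof. by move=> /intgP ix /intgP iy; apply/intgP; apply: integral_sub. Qed.

Lemma intgM x y : intg A x -> intg A y -> intg A (x * y).
Proof. by move=> /intgP ix /intgP iy; apply/intgP; apply: integral_mul. Qed.

Lemma intg_subring : is_subring (intg A).
Proof.
by split; [apply: intg_id; apply: subr_1|exact: intgB|exact: intgM].
Qed.

Lemma intg_idem y : intg (intg A) y -> intg A y.
Proof.
move=> [p [mp Ap py]]; apply/intgP; apply: (integral_root_monic mp py).
by apply/integral_poly => i; apply/intgP.
Qed.

(* Cayley-Hamilton on a finite faithful module. *)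
Lemma intg_finite_module (n : nat) (m : 'cV[R]_n) (M : 'M[R]_n) (u : 'rV[R]_n)
    y : (forall i j, A (M i j)) -> y *: m = M *m m -> (u *m m) 0 0 = 1 ->
  intg A y.
Proof.
move=> AM ym um.
have [N NP] := choice (fun ij : 'I_n * 'I_n => sring_lift (AM ij.1 ij.2)).
pose M' := \matrix_(i, j) N (i, j).
have ME : map_mx sring_val M' = M by apply/matrixP => i j; rewrite !mxE NP.
apply/intgP; exists (char_poly M'); first exact: char_poly_monic.
have B0 : (y%:M - M) *m m = 0 by rewrite mulmxBl mul_scalar_mx ym subrr.
have dB : \det (y%:M - M) = 0.
  have : \det (y%:M - M) *: (u *m m) = 0.
    by rewrite scalemxAr -mul_scalar_mx -mul_adj_mx -mulmxA B0 !mulmx0.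
  by move/matrixP/(_ 0 0); rewrite mxE um mulr1 mxE.
rewrite rootE -horner_evalE -2!det_map_mx -dB.
apply/eqP; congr (\det _); apply/matrixP => i j.
rewrite !mxE -ME !mxE raddfB raddfMn /= map_polyX map_polyC /horner_eval !hornerE.
by rewrite hornerMn hornerX.
Qed.

End Closure.

Lemma coefs_in_sub A B p : A `<=` B -> coefs_in A p -> coefs_in B p.
Proof. by move=> AB Ap i; apply: AB. Qed.

Lemma intg_mono A B y : A `<=` B -> intg A y -> intg B y.
Proof. by move=> AB [p [mp Ap py]]; exists p; split=> //; apply: coefs_in_sub Ap. Qed.

Lemma intg_trans A B y : is_subring A -> (forall b, B b -> intg A b) ->
  intg B y -> intg A y.
Proof. by move=> hA BA By; apply: intg_idem => //; apply: intg_mono By. Qed.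

Lemma intg_of_exp A y n : is_subring A -> (0 < n)%N -> intg A (y ^+ n) -> intg A y.
Proof.
move=> hA n0 iy; apply: intg_idem => //.
have hI := intg_subring hA.
exists ('X^n - (y ^+ n)%:P); split; first exact: monicXnsubC.
  by apply: coefs_inB => //; [apply: coefs_inXn|apply: coefs_inC].
by rewrite rootE !hornerE subrr.
Qed.

End Subrings.

(** * Ideals of subrings *)

Section Ideals.
Variable R : comNzRingType.
Implicit Types (A D I J r : set R) (p q f g : {poly R}) (x y : R).

Definition ideal_of D I := [/\ I `<=` D, I 0, forall x y, I x -> I y -> I (x + y) &
  forall a x, D a -> I x -> I (a * x)].

Definition prime_of D r := [/\ ideal_of D r, ~ r 1 &
  forall x y, D x -> D y -> r (x * y) -> r x \/ r y].

Lemma ideal_sub D I x y : is_subring D -> ideal_of D I -> I x -> I y -> I (x - y).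
Proof.
move=> hD [_ _ ID IM] Ix Iy; apply: ID => //; rewrite -mulN1r; apply: IM => //.
by apply: (subr_N hD); apply: subr_1.
Qed.

Lemma ideal_sum D I (K : Type) (s : seq K) (P : pred K) (F : K -> R) :
  ideal_of D I -> (forall i, P i -> I (F i)) -> I (\sum_(i <- s | P i) F i).
Proof. by move=> [_ I0 ID _] IF; apply: (big_ind I). Qed.

(** Every term of the binomial expansion contains [x ^+ N] or [y ^+ M]. *)
Lemma radical_add D I x y N M :
  is_subring D -> ideal_of D I -> D x -> D y -> I (x ^+ N) -> I (y ^+ M) ->
  I ((x + y) ^+ (N + M)).
Proof.
move=> hD II Dx Dy Ix Iy; rewrite exprDn; apply: (ideal_sum _ II) => i _.
have [_ _ _ IM] := II; rewrite -mulr_natl; have Dn n : D n%:R.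
  by elim: n => [|n IH]; [apply: subr_0|rewrite -addn1 natrD; apply: subr_D => //; apply: subr_1].
have [Mi|iM] := leqP M i.
  have -> : y ^+ i = y ^+ (i - M) * y ^+ M by rewrite -exprD subnK.
  rewrite mulrA mulrA; apply: IM => //; apply: subr_M => //; last exact: subr_X.
  by apply: subr_M => //; apply: subr_X.
have Ni : (N <= N + M - i)%N by rewrite -addnBA ?leq_addr // ltnW.
have -> : x ^+ (N + M - i) = x ^+ (N + M - i - N) * x ^+ N by rewrite -exprD subnK.
rewrite -mulrA [x ^+ N * _]mulrC mulrA mulrA; apply: IM => //.
by apply: subr_M => //; [apply: subr_M => //; apply: subr_X|apply: subr_X].
Qed.

Lemma prime_exp D r x n : is_subring D -> prime_of D r -> D x -> r (x ^+ n) -> r x.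
Proof.
move=> hD [_ r1 rP] Dx; elim: n => [|n IH]; first by rewrite expr0.
rewrite exprS => /rP[] //; exact: subr_X.
Qed.

(** Gauss's lemma: look at the product of the lowest coefficients outside [r]. Primality is asked
    only for pairs of coefficients, so that the lemma also applies to graded primes and polynomials
    with homogeneous coefficients. *)
Lemma poly_prime D r f g : is_subring D -> ideal_of D r ->
  coefs_in D f -> coefs_in D g ->
  (forall i j, r (f`_i * g`_j) -> r f`_i \/ r g`_j) ->
  coefs_in r (f * g) -> coefs_in r f \/ coefs_in r g.
Proof.
move=> hD rI Df Dg fgP rfg; have [rD r0 radd rM] := rI.
apply: contrapT => /not_orP[/existsNP ef /existsNP eg].
have ex (h : {poly R}) : (exists i, ~ r h`_i) ->
    exists2 i, ~ r h`_i & forall k, (k < i)%N -> r h`_k.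
  move=> [i ri]; have ei : exists k, ~~ `[< r h`_k >] by exists i; apply/asboolPn.
  case: (ex_minnP ei) => m /asboolPn rm mP.
  exists m => // k km; apply: contrapT => rk.
  by have := mP k; rewrite leqNgt km => /(_ (introT (asboolPn _) rk)).
have [i ri ltri] := ex f ef; have [j rj ltrj] := ex g eg.
have [] := fgP i j; [|by []|by []].
have hi : (i < (i + j).+1)%N by rewrite ltnS leq_addr.
have := rfg (i + j)%N; rewrite coefM (bigD1 (Ordinal hi)) //= addKn => h.
rewrite -[f`_i * _](addrK (\sum_(k < (i + j).+1 | k != Ordinal hi) f`_k * g`_(i + j - k))).
apply: (ideal_sub hD rI h); apply: ideal_sum rI _ => k nk.
have nki : k != i :> nat by apply: contraNneq nk => ki; apply/eqP/val_inj.
case: (ltngtP k i) nki => // [ki|ik] _; first by rewrite mulrC; apply: rM; [|exact: ltri].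
apply: rM => //; apply: ltrj.
by rewrite ltn_subLR ?ltn_add2r // -ltnS.
Qed.

(* The complement of a multiplicative set that is maximal among those disjoint
   from [J] is a minimal prime over [J]. *)
Lemma exists_minimal_prime D J (S : set R) : is_subring D -> ideal_of D J ->
  S `<=` D -> S 1 -> (forall x y, S x -> S y -> S (x * y)) ->
  (forall x, S x -> ~ J x) ->
  exists r, [/\ prime_of D r, J `<=` r, forall x, S x -> ~ r x &
    forall x, r x -> exists w N, [/\ D w, ~ r w & J (w * x ^+ N)]].
Proof.
move=> hD JI SD S1 SM SJ; have [JD J0 Jadd JM] := JI.
(* The conditions bear on the union of [S] and [T], so that the union of the empty chain, the empty
   set, satisfies them. *)
pose P (T : set R) := [/\ S `|` T `<=` D,
  forall x y, (S `|` T) x -> (S `|` T) y -> (S `|` T) (x * y) &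
  forall x, (S `|` T) x -> ~ J x].
have [F FP Ftot|T [[TD TM TJ] Tmax]] := @Zorn_bigcup R P.
  split.
  - move=> x [/SD //|[X FX Xx]]; have [+ _ _] := FP X FX; apply; by right.
  - move=> x y [Sx|[X FX Xx]] [Sy|[Y FY Yy]].
    + by left; apply: SM.
    + have [_ M _] := FP Y FY; have [h|h] := M x y (or_introl Sx) (or_intror Yy); first by left.
      by right; exists Y.
    + have [_ M _] := FP X FX; have [h|h] := M x y (or_intror Xx) (or_introl Sy); first by left.
      by right; exists X.
    + have [Z [FZ Zx Zy]] : exists Z, [/\ F Z, Z x & Z y].
        by case: (Ftot X Y FX FY) => h; [exists Y|exists X]; split=> //; apply: h.
      have [_ M _] := FP Z FZ; have [h|h] := M x y (or_intror Zx) (or_intror Zy); first by left.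
      by right; exists Z.
  - move=> x [/SJ //|[X FX Xx]]; have [_ _] := FP X FX; apply; by right.
pose W := S `|` T; pose r := [set x | D x /\ ~ W x].
have W1 : W 1 by left.
have WX x n : W x -> W (x ^+ n).
  by move=> Wx; elim: n => [|n IH]; rewrite ?expr0 // exprS; apply: (TM).
have key (g : R) : r g -> exists w N, [/\ D w, W w & J (w * g ^+ N)].
  move=> [Dg nWg]; apply: contrapT => nJ.
  (* The multiplicative set generated by [W] and [g] is strictly larger, so by maximality it meets
     [J]. *)
  pose T' := [set x | exists w N, W w /\ x = w * g ^+ N].
  have WT' : W `<=` T' by move=> w Ww; exists w, 0%N; rewrite expr0 mulr1.
  have ST' : S `|` T' = T'.
    by apply/setUidPr => x Sx; apply: WT'; left.
  have T'T : T `<` T'.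
    split=> [x Tx|/(_ g)]; first by apply: WT'; right.
    have T'g : T' g by exists 1, 1%N; rewrite expr1 mul1r.
    by move=> /(_ T'g) Tg; apply: nWg; right.
  case: (Tmax T' T'T); split; rewrite ST'.
  - move=> _ [w [N [Ww ->]]]; apply: subr_M => //; [exact: TD|exact: subr_X].
  - move=> _ _ [w [N [Ww ->]]] [v [M [Wv ->]]]; exists (w * v), (N + M)%N.
    by split; [apply: (TM)|rewrite exprD; ring].
  - move=> _ [w [N [Ww ->]]] Jw; apply: nJ; exists w, N; split=> //; exact: TD.
have keyr (g : R) : r g -> exists w N, [/\ D w, ~ r w & J (w * g ^+ N)].
  by move=> /key[w [N [Dw Ww Jw]]]; exists w, N; split=> // -[].
exists r; split=> //; last first.
- by move=> x Sx [_]; apply; left.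
- by move=> x Jx; split; [apply: JD|move/TJ].
split; last first.
- move=> x y Dx Dy [_ nW]; have [Wx|nx] := pselect (W x); last by left.
  have [Wy|ny] := pselect (W y); last by right.
  by case: nW; apply: (TM).
- by move=> [].
split; first by move=> x [].
- by split; [apply: subr_0|move/TJ].
- move=> x y rx ry; split; first by apply: subr_D => //; [case: rx|case: ry].
  move=> Wxy; have [w [N [Dw Ww Jw]]] := key x rx; have [v [M [Dv Wv Jv]]] := key y ry.
  have : W (w * v * (x + y) ^+ (N + M)) by apply: (TM); [apply: (TM)|apply: WX].
  (* The ideal quotient of [J] by [w * v] contains [x ^+ N] and [y ^+ M], hence a power of [x + y];
     so an element of [W] would lie in [J]. *)
  pose Jwv := [set z | D z /\ J (w * v * z)].
  have JwvI : ideal_of D Jwv.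
    split=> [z []|||] //; first by rewrite /Jwv /= mulr0; split=> //; apply: subr_0.
      by move=> z z' [Dz Jz] [Dz' Jz']; rewrite /Jwv /= mulrDr; split; [apply: subr_D|apply: Jadd].
    by move=> c z Dc [Dz Jz]; rewrite /Jwv /= mulrCA; split; [apply: subr_M|apply: JM].
  have [Dx Dy] : D x /\ D y by case: rx => ? _; case: ry.
  have Jx : Jwv (x ^+ N).
    by split; [apply: subr_X|rewrite mulrAC mulrC; apply: JM].
  have Jy : Jwv (y ^+ M) by split; [apply: subr_X|rewrite -mulrA; apply: JM].
  by have [_ Jxy] := radical_add hD JwvI Dx Dy Jx Jy; move/TJ; apply.
- move=> a x Da [Dx nWx]; split; first exact: subr_M.
  move=> Wax; have [w [N [Dw Ww Jw]]] := key x (conj Dx nWx).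
  have /TJ : W (w * (a * x) ^+ N) by apply: (TM) => //; apply: WX.
  by apply; rewrite exprMn mulrCA; apply: JM => //; apply: subr_X.
Qed.

(** This serves twice: as the extended ideal [a D] when [a] lies in the ring [D], and as the module
    spanned by the set [D] over a subring [a]. *)
Definition extension a D : set R := [set y | exists s : seq (R * R),
  (forall c, c \in s -> a c.1 /\ D c.2) /\ y = \sum_(c <- s) c.1 * c.2].

Lemma extension_ideal a D : is_subring D -> a `<=` D -> ideal_of D (extension a D).
Proof.
move=> hD aD; split.
- move=> _ [s [sP ->]]; apply: subr_sum_seq => // c /sP[/aD ? ?]; exact: subr_M.
- by exists [::]; rewrite big_nil.
- move=> _ _ [s [sP ->]] [t [tP ->]]; exists (s ++ t); rewrite big_cat; split=> // c.
  by rewrite mem_cat => /orP[/sP|/tP].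
- move=> b _ Db [s [sP ->]]; exists [seq (c.1, b * c.2) | c <- s]; split.
    by move=> _ /mapP[c /sP[ac Dc] ->] /=; split=> //; apply: subr_M.
  rewrite big_map mulr_sumr; apply: eq_bigr => c _ /=; ring.
Qed.

Lemma extension_mono a a' D D' : a `<=` a' -> D `<=` D' ->
  extension a D `<=` extension a' D'.
Proof. by move=> aa DD _ [s [sP ->]]; exists s; split=> // c /sP[/aa ? /DD]. Qed.

Lemma extension_min a D I : ideal_of D I -> a `<=` I -> extension a D `<=` I.
Proof.
move=> II aI _ [s [sP ->]]; have [_ _ _ IM] := II.
rewrite big_seq; apply: ideal_sum II _ => c /sP[/aI ? ?].
by rewrite mulrC; apply: IM.
Qed.

End Ideals.

Section Images.
Variables (R S : comNzRingType) (h : {rmorphism R -> S}).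
Implicit Types (A : set R).

Lemma image_subring A : is_subring A -> is_subring (h @` A).
Proof.
move=> hA; split=> [|_ _ [x Ax <-] [y Ay <-]|_ _ [x Ax <-] [y Ay <-]].
- by exists 1; [apply: subr_1|rewrite rmorph1].
- by exists (x - y); [apply: subr_B|rewrite rmorphB].
- by exists (x * y); [apply: subr_M|rewrite rmorphM].
Qed.

Lemma coefs_in_map A p : coefs_in A p -> coefs_in (h @` A) (map_poly h p).
Proof. by move=> Ap i; rewrite coef_map; exists p`_i. Qed.

Lemma intg_image A y : intg A y -> intg (h @` A) (h y).
Proof.
move=> [p [mp Ap py]]; exists (map_poly h p); split.
- exact: monic_map.
- exact: coefs_in_map.
- by rewrite rootE horner_map (rootP py) rmorph0.
Qed.

Lemma lift_coefs_in_image A q : is_subring A -> coefs_in (h @` A) q ->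
  exists2 p, coefs_in A p & map_poly h p = q.
Proof.
move=> hA Aq; have /choice[f fP] i : exists a, A a /\ h a = q`_i.
  by have [a] := Aq i; exists a.
exists (\poly_(i < size q) f i); first move=> i.
  by rewrite coef_poly; case: ifP => _; [case: (fP i)|apply: subr_0].
apply/polyP => i; rewrite coef_map coef_poly; case: ltnP => [_|sq].
  by case: (fP i).
by rewrite nth_default //; apply: rmorph0.
Qed.

(** Since [h] is injective on [B], an arbitrary lift of the equation of [h y] has the same size,
    leading coefficient 1, and vanishes at [y]. *)
Lemma intg_image_inj A B y : is_subring A -> is_subring B -> A `<=` B ->
  (forall b, B b -> h b = 0 -> b = 0) -> B y ->
  intg (h @` A) (h y) -> intg A y.
Proof.
move=> hA hB AB hI By [q [mq /lift_coefs_in_image-/(_ hA)[p Ap pE] qy]].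
have pi i : q`_i = 0 -> p`_i = 0.
  by rewrite -pE coef_map; apply: hI; apply: AB.
have sp : size p = size q.
  apply/eqP; rewrite eqn_leq -{2}pE size_poly andbT.
  apply/leq_sizeP => j jq; apply: pi; exact: nth_default.
exists p; split=> //.
  rewrite monicE lead_coefE sp; apply/eqP/subr0_eq/hI.
    by apply: subr_B => //; [apply: AB|apply: subr_1].
  move/monicP: mq; rewrite lead_coefE rmorphB rmorph1 -coef_map pE => ->.
  by rewrite subrr.
apply/eqP/hI; first by apply: horner_in => //; apply: coefs_in_sub Ap.
by move: qy; rewrite -pE rootE horner_map => /eqP.
Qed.

End Images.

(** * Extended ideals in integral extensions and lying over *)

Section IntegralIdeals.
Variable R : comNzRingType.
Implicit Types (A D G a : set R) (x y : R).

(* Apply transitivity of integrality to [y X] over the Rees-like subring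
   [G + a X + a X^2 + ...] of [R[X]]. *)
Lemma intg_extension G a D y : is_subring G -> ideal_of G a ->
  (forall d, D d -> intg G d) -> extension a D y ->
  exists p, [/\ p \is monic, root p y & forall i, (i < (size p).-1)%N -> a p`_i].
Proof.
move=> hG aI DG [s [sP ->]]; have [aG a0 aD aM] := aI.
pose Gt : set {poly R} := [set f | G f`_0 /\ forall i, a f`_i.+1].
have hGt : is_subring Gt.
  split.
  - by apply: conj => [|i]; rewrite coef1 //=; apply: subr_1.
  - move=> f g [f0 fa] [g0 ga]; apply: conj => [|i]; rewrite coefB; first exact: subr_B.
    by apply: (ideal_sub hG aI).
  - move=> f g [f0 fa] [g0 ga]; apply: conj => [|i]; rewrite coefM.
      by rewrite big_ord1; apply: subr_M.
    apply: ideal_sum aI _ => -[[|j] ji] _ /=; rewrite ?subn0; first exact: aM.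
    rewrite mulrC; apply: aM => //; case: (_ - _)%N => [|k] //; exact: aG.
have Dt d : D d -> intg Gt d%:P.
  move=> /DG/(intg_image polyC); apply: intg_mono => _ [g Gg <-].
  by apply: conj => [|i]; rewrite coefC.
have [P [mP GP]] : intg Gt ((\sum_(c <- s) c.1 * c.2)%:P * 'X).
  rewrite rmorph_sum mulr_suml; apply: (subr_sum_seq (intg_subring hGt)) => c /sP[ac Dc].
  rewrite rmorphM /= mulrAC; apply: intgM => //; last exact: Dt.
  apply: intg_id => //; apply: conj => [|[|i]]; rewrite coefMX coefC //=; exact: subr_0.
set z := \sum_(c <- s) _; set n := (size P).-1.
have sP1 : size P = n.+1 by rewrite /n prednK // size_poly_gt0 monic_neq0.
(* The coefficient of X^n in P(zX) = 0 is a monic equation for [z] with coefficients (P_i)_(n-i).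
   For i < n the index n - i is positive, so these lie in [a]. *)
move=> /rootP/(congr1 (fun q : {poly R} => q`_n)).
rewrite horner_coef sP1 coef_sum coef0 => E.
have PnE : P`_n = 1 by move/monicP: mP; rewrite lead_coefE.
exists (\poly_(i < n.+1) (P`_i)`_(n - i)).
have lE : ((P`_n)`_(n - n)) = 1 by rewrite subnn PnE coefC.
have sE : size (\poly_(i < n.+1) (P`_i)`_(n - i)) = n.+1.
  by apply: size_poly_eq; rewrite lE oner_neq0.
split.
- by rewrite monicE lead_coefE sE coef_poly ltnSn lE.
- rewrite rootE horner_coef sE -[X in _ == X]E; apply/eqP; apply: eq_bigr => i _.
  rewrite coef_poly ltn_ord exprMn -rmorphXn mulrA coefMXn coefMC.
  by rewrite ltnNge -ltnS ltn_ord.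
- rewrite sE /= => i lin; rewrite coef_poly ltnS ltnW //.
  by have [_ /(_ (n - i).-1)] := GP i; rewrite prednK ?subn_gt0.
Qed.

(** The monic equation of [x] has its lower coefficients in [q], so a power of [x] lies in [q]. This
    says that the extension of [q] contracts back to [q]. *)
Lemma extension_prime D D' q x : is_subring D -> prime_of D q ->
  (forall d, D' d -> intg D d) -> D x -> extension q D' x -> q x.
Proof.
move=> hD qP D'D Dx /(intg_extension hD (let: And3 h _ _ := qP in h) D'D)[p [mp px pq]].
have [qI _ _] := qP; have [qD q0 qadd qM] := qI.
apply: (prime_exp (n := (size p).-1) hD qP Dx).
have sp : size p = (size p).-1.+1 by rewrite prednK // size_poly_gt0 monic_neq0.
move/rootP: px; rewrite horner_coef sp big_ord_recr /= -lead_coefE (monicP mp) mul1r.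
move/eqP; rewrite addrC addr_eq0 => /eqP ->; rewrite -sub0r.
apply: (ideal_sub hD qI q0); apply: (ideal_sum _ qI) => i _.
by rewrite mulrC; apply: qM; [apply: subr_X|apply: pq].
Qed.

(** A prime that contains [q D'] and avoids the complement of [q] in [D] lies over [q]; the two
    requirements are compatible by [extension_prime]. *)
Lemma lying_over D D' q : is_subring D -> is_subring D' -> D `<=` D' ->
  (forall d, D' d -> intg D d) -> prime_of D q ->
  exists2 q', prime_of D' q' & forall x, D x -> (q' x <-> q x).
Proof.
move=> hD hD' DD' D'D qP; have [qI q1 qM] := qP; have [qD _ _ _] := qI.
have qD' : q `<=` D' by move=> x /qD/DD'.
have [|x [Dx _]|||x [Dx nqx]|q' [q'P Jq' q'S _]] :=
  @exists_minimal_prime _ D' (extension q D') (D `\` q) hD'.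
- exact: extension_ideal.
- exact: DD'.
- by split=> //; apply: subr_1.
- move=> x y [Dx nx] [Dy ny]; split; first exact: subr_M.
  by case/(qM _ _ Dx Dy).
- by move/(extension_prime hD qP D'D Dx).
exists q' => // x Dx; split=> [q'x|qx].
  by apply: contrapT => nqx; apply: (q'S x).
apply: Jq'; exists [:: (x, 1)]; split; last by rewrite big_seq1 mulr1.
by move=> c; rewrite inE => /eqP-> /=; split=> //; apply: subr_1.
Qed.

End IntegralIdeals.

(** The ring R[X]/(f) contains [R] because [f] is monic of positive degree, and the class of X is a
    root; split off the linear factor and repeat. *)
Lemma splitting_ring n (R : comNzRingType) (f : {poly R}) :
  f \is monic -> size f = n.+1 ->
  exists (S : comNzRingType) (h : {rmorphism R -> S}) (rs : seq S),
    injective h /\ map_poly h f = \prod_(r <- rs) ('X - r%:P).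
Proof.
elim: n R f => [|n IH] R f mf sf.
  exists R, idfun, [::]; split; first exact: inj_id.
  rewrite big_nil map_poly_id // (@size1_polyC _ f) ?sf //.
  by move/monicP: mf; rewrite lead_coefE sf => ->.
pose h1 : R -> {poly %/ f} := qpolyC f.
(* Evaluating at the class of X is reduction modulo [f]; for p = f this gives the root. *)
have h1E (p : {poly R}) : (map_poly (qpolyC f) p).['qX] = in_qpoly f p.
  elim/poly_ind: p => [|p c IHp]; first by rewrite rmorph0 horner0 in_qpoly0.
  rewrite rmorphD rmorphM /= map_polyX map_polyC hornerMXaddC IHp in_qpolyD in_qpolyM.
  congr (_ + _); apply: val_inj => /=; rewrite Pdiv.Ring.rmodp_small //.
  by apply: leq_ltn_trans (size_polyC_leq1 _) (size_mk_monic_gt1 _).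
have fX : root (map_poly (qpolyC f) f) ('qX : {poly %/ f}).
  rewrite rootE h1E; apply/eqP/val_inj => /=.
  by rewrite /mk_monic sf mf Pdiv.RingMonic.rmodpp.
have h1I : injective (qpolyC f).
  by move=> x y /(congr1 (fun z : {poly %/ f} => (z : {poly R})`_0)); rewrite !qpolyCE !coefC.
have /factor_theorem[g gE] := fX.
have mg : g \is monic.
  by rewrite -(monicMr _ (monicXsubC 'qX)) -gE monic_map.
have sg : size g = n.+1.
  have : size (map_poly (qpolyC f) f) = n.+2.
    by rewrite (size_map_inj_poly h1I) ?sf // qpolyC0.
  by rewrite gE size_Mmonic ?monicXsubC ?monic_neq0 // size_XsubC addn2 => -[].
have [S [h [rs [hI hE]]]] := IH _ g mg sg.
exists S, (h \o qpolyC f), (rcons rs (h 'qX)); split; first exact: inj_comp.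
rewrite map_poly_comp gE rmorphM /= hE map_polyXsubC big_rcons.
by [].
Qed.

Section PolynomialIntegrality.
Variable R : comNzRingType.
Implicit Types (A : set R) (f g : {poly R}).

(** In a ring where [f] splits, its roots are roots of [f * g], hence integral, and the coefficients
    of [f] are polynomials in them. *)
Lemma intg_monic_factor A f g : is_subring A -> f \is monic -> g \is monic ->
  coefs_in A (f * g) -> coefs_in (intg A) f.
Proof.
move=> hA mf mg Afg.
have sf : size f = (size f).-1.+1 by rewrite prednK // size_poly_gt0 monic_neq0.
have [S [h [rs [hI fE]]]] := splitting_ring mf sf.
have hAS := image_subring h hA; have hI' := intg_subring hAS.
have rsI r : r \in rs -> intg (h @` A) r.
  move=> rrs; exists (map_poly h (f * g)); split.
  - by rewrite monic_map // monicMl.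
  - exact: coefs_in_map.
  - rewrite rmorphM /= fE (big_rem r rrs) /= rootE !hornerM hornerXsubC subrr.
    by rewrite !mul0r.
suff : coefs_in (intg (h @` A)) (map_poly h f).
  by move=> Hf i; apply: (@intg_image_inj _ _ h A setT) => //;
    [move=> b _; rewrite -(rmorph0 h); apply: hI|rewrite -coef_map].
rewrite fE big_seq; apply: (big_ind (coefs_in _)) => [|p q|r rrs].
- exact: coefs_in1.
- exact: coefs_inM.
- by apply: coefs_inB => //; [apply: coefs_inX|apply: coefs_inC => //; apply: rsI].
Qed.

Lemma horner_diff (S : comNzRingType) (p : {poly S}) (x y : S) :
  exists k, p.[x] - p.[y] = (x - y) * k.
Proof.
have /factor_theorem[q qE] : root (p - (p.[y])%:P) y.
  by rewrite rootE !hornerE subrr.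
exists q.[x]; have := congr1 (fun r => r.[x]) qE.
by rewrite /= !hornerE => ->; rewrite mulrC.
Qed.

(* If [Q(g) = 0] then, for [N] large, the monic polynomial [X^N + g] divides
   [Q(- X^N)], which is monic up to sign and has coefficients in [A]. *)
Lemma intg_poly_coefs A g : is_subring A ->
  intg (coefs_in A : set {poly R}) g -> coefs_in (intg A) g.
Proof.
move=> hA [Q [mQ AQ Qg]].
pose n := (size Q).-1; have sQ : size Q = n.+1.
  by rewrite prednK // size_poly_gt0 monic_neq0.
(* [N] exceeds the degrees of [g] and of all lower coefficients of [Q]: then X^N + g is monic, the
   power (-X^N)^n dominates Q(-X^N), and the coefficients of [g] sit unchanged below X^N. *)
pose N := (size g + \max_(i < n) size (Q`_i)%R).+1.
have gN : (size g < N)%N by rewrite ltnS leq_addr.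
have QN (i : 'I_n) : (size (Q`_i)%R < N)%N.
  rewrite ltnS; apply: leq_trans (leq_addl _ _).
  exact: (leq_bigmax (F := fun i : 'I_n => size Q`_i)).
have [k kE] := horner_diff Q (- 'X^N) g.
pose h := 'X^N + g; pose c := (-1) ^+ n * Q.[- 'X^N].
have mh : h \is monic by rewrite monicE lead_coefDl ?size_polyXn ?lead_coefXn // ltnW.
have cE : c = h * ((-1) ^+ n.+1 * k).
  rewrite /c -[Q.[_]]subr0 -(rootP Qg) kE -opprD -/h exprS; ring.
have cE2 : c = 'X^(N * n) + \sum_(i < n) (-1) ^+ n * (Q`_i * (- 'X^N) ^+ i).
  rewrite /c horner_coef sQ big_ord_recr /= -lead_coefE (monicP mQ) mul1r mulrDr.
  rewrite addrC -mulr_sumr; congr (_ + _).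
  by rewrite -[- 'X^N]mulN1r exprMn mulrA -exprMn mulrNN mulr1 expr1n mul1r exprM.
have mc : c \is monic.
  rewrite monicE cE2 lead_coefDl ?lead_coefXn // size_polyXn ltnS.
  apply: (leq_trans (size_sum _ _ _)); apply/bigmax_leqP => i _.
  have -> : (-1) ^+ n * (Q`_i * (- 'X^N) ^+ i) =
      ((-1) ^+ (n + i) *: Q`_i) * 'X^(N * i) :> {poly R}.
    rewrite -['X^N in LHS]mul1r -mulNr exprMn -exprM -mul_polyC exprD rmorphM.
    by rewrite !rmorphXn rmorphN rmorph1 /=; ring.
  apply: (leq_trans (size_polyMleq _ _)).
  rewrite size_polyXn addnS /=.
  have iN : (N + N * i <= N * n)%N by rewrite -mulnS leq_mul2l ltn_ord orbT.
  apply: leq_trans iN; rewrite leq_add2r.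
  exact: leq_trans (size_scale_leq _ _) (ltnW (QN i)).
have mk : (-1) ^+ n.+1 * k \is monic by rewrite -(monicMr _ mh) mulrC -cE.
have Ah : coefs_in A (h * ((-1) ^+ n.+1 * k)).
  rewrite -cE cE2; apply: coefs_inD => //; first exact: coefs_inXn.
  apply: coefs_in_sum => // i _; have AN1 : coefs_in A (-1).
    by rewrite -[-1]sub0r; apply: coefs_inB => //; [apply: coefs_in0|apply: coefs_in1].
  apply: coefs_inM => //; first exact: coefs_in_exp.
  apply: coefs_inM => //; apply: coefs_in_exp => //.
  by rewrite -mulN1r; apply: coefs_inM => //; apply: coefs_inXn.
have := intg_monic_factor hA mh mk Ah => Ih i.
have [iN|Ni] := ltnP i N; last first.
  by rewrite nth_default ?(leq_trans (ltnW gN)) //; apply: (subr_0 (intg_subring hA)).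
by have := Ih i; rewrite coefD coefXn ltn_eqF // add0r.
Qed.

End PolynomialIntegrality.

Lemma coefs_in_subring (R : comNzRingType) (A : set R) :
  is_subring A -> is_subring (coefs_in A : set {poly R}).
Proof.
by move=> hA; split; [exact: coefs_in1|exact: coefs_inB|exact: coefs_inM].
Qed.

Lemma coefs_in_ideal (R : comNzRingType) (A I : set R) : is_subring A ->
  ideal_of A I -> ideal_of (coefs_in A : set {poly R}) (coefs_in I).
Proof.
move=> hA II; have [IA I0 ID IM] := II; split.
- by move=> f If i; apply: IA.
- by move=> i; rewrite coef0.
- by move=> f g If Ig i; rewrite coefD; apply: ID.
- by move=> f g Af Ig i; rewrite coefM; apply: (ideal_sum _ II) => j _; apply: IM.
Qed.

Lemma coefs_in_prime (R : comNzRingType) (A r : set R) : is_subring A ->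
  prime_of A r -> prime_of (coefs_in A : set {poly R}) (coefs_in r).
Proof.
move=> hA [rI r1 rP]; split; first exact: coefs_in_ideal.
  by move=> /(_ 0%N); rewrite coef1.
move=> f g Af Ag; apply: (poly_prime hA) => // i j; exact: rP.
Qed.

(* Compare the lowest and the highest coefficients of [g] outside [r]. *)
Lemma monic_dvd_monomial (R : comNzRingType) (D r : set R) (f g : {poly R}) n :
  is_subring D -> prime_of D r -> coefs_in D f -> coefs_in D g -> f \is monic ->
  ~ r (f * g)`_n -> (forall k, k != n -> r (f * g)`_k) ->
  forall i, (i < (size f).-1)%N -> r f`_i.
Proof.
move=> hD rP Df Dg mf rn rk; have [rI r1 rM] := rP; have [rD r0 radd rmul] := rI.
set d := (size f).-1.
have fd : f`_d = 1 by move/monicP: mf; rewrite lead_coefE.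
have rX x : ~ r x -> ~~ `[< r x >] by move/asboolPn.
have ef : exists i, ~~ `[< r f`_i >] by exists d; apply: rX; rewrite fd.
have eg : exists j, ~~ `[< r g`_j >].
  apply: contrapT => h; apply: rn; rewrite coefM; apply: (ideal_sum _ rI) => j _.
  apply: rmul => //; apply: contrapT => ng; apply: h; exists (n - j)%N; exact: rX.
have bg j : ~~ `[< r g`_j >] -> (j <= size g)%N.
  move=> /asboolPn ng; rewrite leqNgt; apply/negP => sj; apply: ng.
  by rewrite nth_default // ltnW.
case: (ex_minnP ef) => i /asboolPn ri imin.
case: (ex_minnP eg) => j /asboolPn rj jmin.
case: (ex_maxnP eg bg) => j' /asboolPn rj' jmax.
have lti k : (k < i)%N -> r f`_k.
  by move=> ki; apply: contrapT => /rX/imin; rewrite leqNgt ki.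
have ltj k : (k < j)%N -> r g`_k.
  by move=> ki; apply: contrapT => /rX/jmin; rewrite leqNgt ki.
have gtj k : (j' < k)%N -> r g`_k.
  by move=> ki; apply: contrapT => /rX/jmax; rewrite leqNgt ki.
(* For two extremal indices, the coefficient of index a + b of the product is the single product f_a
   g_b modulo [r], hence outside [r]; only the index [n] allows this. *)
have key a b : ~ r f`_a -> ~ r g`_b ->
    (forall k, (k < (a + b).+1)%N -> k != a -> r (f`_k * g`_(a + b - k))) -> (a + b = n)%N.
  move=> ra rb rab; apply/eqP; apply: contrapT => /negP/rk.
  have hi : (a < (a + b).+1)%N by rewrite ltnS leq_addr.
  rewrite coefM (bigD1 (Ordinal hi)) //= addKn => h.
  have [] : r f`_a \/ r g`_b; [apply: rM => //|by []|by []].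
  rewrite -[f`_a * _](addrK (\sum_(k < (a + b).+1 | k != Ordinal hi) f`_k * g`_(a + b - k))).
  apply: (ideal_sub hD rI h); apply: (ideal_sum _ rI) => k nk.
  by apply: rab => //; apply: contraNneq nk => ki; apply/eqP/val_inj.
have ijn : (i + j = n)%N.
  apply: key => // k kij; case: (ltngtP k i) => // [ki|ik] _.
    by rewrite mulrC; apply: rmul => //; apply: lti.
  by apply: rmul => //; apply: ltj; rewrite ltn_subLR // ltn_add2r.
have djn : (d + j' = n)%N.
  apply: key => // [|k kij]; first by rewrite fd.
  case: (ltngtP k d) => // [kd|dk] _.
    by apply: rmul => //; apply: gtj; rewrite ltn_subRL ltn_add2r.
  by rewrite [f`_k]nth_default ?mul0r // (leq_trans _ dk) // /d leqSpred.
have ji : (d <= i)%N.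
  by rewrite -(leq_add2r j) ijn -djn leq_add2l; apply: jmax; apply: rX.
by move=> k kd; apply: lti; apply: leq_trans kd ji.
Qed.

(** * The transcendental fibre *)

Section Fractions.
Variable L : fieldType.
Implicit Types (A D E K : set L) (x y : L) (f g p : {poly L}).

Definition transcendental A x := forall p, coefs_in A p -> p.[x] = 0 -> p = 0.

Definition fractions D : set L :=
  [set y | exists a b, [/\ D a, D b, b != 0 & y = a / b]].

Lemma fractions_subring D : is_subring D -> is_subring (fractions D).
Proof.
move=> hD; split.
- by exists 1, 1; rewrite divr1 oner_neq0; split=> //; apply: subr_1.
- move=> _ _ [a [b [Da Db b0 ->]]] [a' [b' [Da' Db' b0' ->]]].
  exists (a * b' - a' * b), (b * b'); split; last by field; apply/andP.
  + by apply: subr_B => //; apply: subr_M.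
  + exact: subr_M.
  + exact: mulf_neq0.
- move=> _ _ [a [b [Da Db b0 ->]]] [a' [b' [Da' Db' b0' ->]]].
  exists (a * a'), (b * b'); split; last by field; apply/andP.
  + exact: subr_M.
  + exact: subr_M.
  + exact: mulf_neq0.
Qed.

Lemma fractions_inv D y : is_subring D -> fractions D y -> fractions D y^-1.
Proof.
move=> hD [a [b [Da Db b0 ->]]]; have [->|a0] := eqVneq a 0.
  by rewrite mul0r invr0; apply: subr_0; apply: fractions_subring.
by exists b, a; split=> //; rewrite invf_div.
Qed.

Lemma sub_fractions D : is_subring D -> D `<=` fractions D.
Proof.
by move=> hD y Dy; exists y, 1; rewrite divr1 oner_neq0; split=> //; apply: subr_1.
Qed.

Lemma common_denominator D p : is_subring D -> coefs_in (fractions D) p ->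
  exists e, [/\ D e, e != 0 & coefs_in D (e *: p)].
Proof.
move=> hD Dp; suff /(_ (size p))[e [De e0 eP]] n :
    exists e, [/\ D e, e != 0 & forall i, (i < n)%N -> D (e * p`_i)].
  exists e; split=> // i; rewrite coefZ; have [/eP //|sp] := ltnP i (size p).
  by rewrite nth_default // mulr0; apply: subr_0.
elim: n => [|n [e [De e0 eP]]].
  by exists 1; rewrite oner_neq0; split=> //; apply: subr_1.
have [a [b [Da Db b0 pn]]] := Dp n; exists (e * b); split.
- exact: subr_M.
- exact: mulf_neq0.
- move=> i; rewrite ltnS leq_eqVlt => /predU1P[->|/eP ei].
    by rewrite pn -mulrA [b * _]mulrC divfK //; apply: subr_M.
  by rewrite mulrAC; apply: subr_M.
Qed.

Lemma transcendental_fractions E x : is_subring E ->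
  transcendental E x -> transcendental (fractions E) x.
Proof.
move=> hE tx p /common_denominator-/(_ hE)[e [Ee e0 Ep]] px.
have := tx _ Ep; rewrite hornerZ px mulr0 => /(_ erefl)/eqP.
by rewrite scaler_eq0 (negPf e0) => /eqP.
Qed.

Definition inv_closed K := forall y, K y -> K y^-1.

Lemma minimal_polynomial K s : is_subring K -> inv_closed K -> intg K s ->
  exists p, [/\ p \is monic, coefs_in K p, root p s &
    forall f, coefs_in K f -> root f s -> (size f < size p)%N -> f = 0].
Proof.
move=> hK KV [p0 [mp0 Kp0 p0s]].
pose P n := `[< exists p, [/\ p \is monic, coefs_in K p, root p s & size p = n] >].
have eP : exists n, P n by exists (size p0); apply/asboolP; exists p0.
case: (ex_minnP eP) => n /asboolP[p [mp Kp ps sp]] nmin.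
exists p; split=> // f Kf fs fp; apply: contrapT => /eqP f0.
have : P (size f).
  apply/asboolP; exists ((lead_coef f)^-1 *: f); split.
  - by rewrite monicE lead_coefZ mulVf // lead_coef_eq0.
  - by apply: coefs_inZ => //; apply: KV; rewrite lead_coefE.
  - by rewrite rootE hornerZ (rootP fs) mulr0.
  - by rewrite size_scale // invr_eq0 lead_coef_eq0.
by move/nmin; rewrite leqNgt -sp fp.
Qed.

(** K[X] is principal: a nonzero combination of [f] and [g] of least size divides both. The Bezout
    coefficients are kept since they are used to show that a denominator is a unit. *)
Lemma ideal_generator K f g : is_subring K -> inv_closed K ->
  coefs_in K f -> coefs_in K g -> g != 0 ->
  exists a b f' g', let d := a * f + b * g in
  [/\ coefs_in K a, coefs_in K b, coefs_in K f', coefs_in K g' &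
   f = f' * d /\ g = g' * d].
Proof.
move=> hK KV Kf Kg g0.
pose C d := exists a b, [/\ coefs_in K a, coefs_in K b & d = a * f + b * g].
pose P n := `[< exists d, [/\ C d, d != 0 & size d = n] >].
have CK d : C d -> coefs_in K d.
  by move=> [a [b [Ka Kb ->]]]; apply: coefs_inD => //; apply: coefs_inM.
have Cf : C f by exists 1, 0; rewrite mul1r mul0r addr0; split=> //; [apply: coefs_in1|apply: coefs_in0].
have Cg : C g by exists 0, 1; rewrite mul1r mul0r add0r; split=> //; [apply: coefs_in0|apply: coefs_in1].
have eP : exists n, P n by exists (size g); apply/asboolP; exists g.
case: (ex_minnP eP) => n /asboolP[d [Cd d0 sd]] nmin.
have cd0 : lead_coef d != 0 by rewrite lead_coef_eq0.
have div h : C h -> exists2 h', coefs_in K h' & h = h' * d.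
  move=> Ch; have md : (lead_coef d)^-1 *: d \is monic.
    by rewrite monicE lead_coefZ mulVf.
  have Kd := CK _ Cd; have KVd : K (lead_coef d)^-1 by apply: KV; rewrite lead_coefE.
  have [q [r [Kq Kr hE sr]]] := monic_division hK md (coefs_inZ hK KVd Kd) (CK _ Ch).
  have r0 : r = 0.
    apply: contrapT => /eqP r0; have : P (size r).
      apply/asboolP; exists r; split=> //.
      have [a [b [Ka Kb dE]]] := Cd; have [a' [b' [Ka' Kb' hE']]] := Ch.
      exists (a' - q * ((lead_coef d)^-1 *: a)), (b' - q * ((lead_coef d)^-1 *: b)).
      split; try by [apply: coefs_inB => //; apply: coefs_inM => //; apply: coefs_inZ].
      rewrite -[r](addKr (q * ((lead_coef d)^-1 *: d))) -hE {2}dE hE' -!mul_polyC.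
      ring.
    by move/nmin; rewrite leqNgt -sd; move: sr; rewrite size_scale ?invr_eq0 // => ->.
  exists (q * ((lead_coef d)^-1)%:P); first by apply: coefs_inM => //; apply: coefs_inC.
  by rewrite {1}hE r0 addr0 -mul_polyC mulrA.
have [a [b [Ka Kb dE]]] := Cd.
have [f' Kf' fE] := div f Cf; have [g' Kg' gE] := div g Cg.
by exists a, b, f', g'; rewrite -dE.
Qed.

(* The polynomial ring [K[x]] is normal. *)
Lemma intg_fraction_adjoin K x y : is_subring K -> inv_closed K ->
  transcendental K x -> fractions (adjoin K x) y -> intg (adjoin K x) y ->
  adjoin K x y.
Proof.
move=> hK KV tx [_ [_ [[f Kf ->] [g Kg ->] gx0 yE]]] [p [mp Kp py]].
have g0 : g != 0 by apply: contraNneq gx0 => ->; rewrite horner0.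
have hKx := adjoin_subring hK x.
have [a [b [f' [g' /= [Ka Kb Kf' Kg' [fE gE]]]]]] := ideal_generator hK KV Kf Kg g0.
set d := a * f + b * g in fE gE.
have dx0 : d.[x] != 0 by apply: contraNneq gx0; rewrite gE hornerM => ->; rewrite mulr0.
have gx0' : g'.[x] != 0 by apply: contraNneq gx0; rewrite gE hornerM => ->; rewrite mul0r.
have yE' : y = f'.[x] / g'.[x].
  by rewrite yE fE gE !hornerM -mulf_div divff // mulr1.
have one : a.[x] * f'.[x] + b.[x] * g'.[x] = 1.
  apply: (mulIf dx0); rewrite mul1r mulrDl -!mulrA -!hornerM -fE -gE.
  by rewrite -hornerD.
pose n := (size p).-1; have sp : size p = n.+1 by rewrite prednK // size_poly_gt0 monic_neq0.
(* Clear the denominators g'^n in the integral equation of y = f'/g'; all terms but the leading one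
   are multiples of g'. *)
have [h Kh fh] : exists2 h, adjoin K x h & f'.[x] ^+ n = g'.[x] * h.
  exists (- \sum_(i < n) p`_i * f'.[x] ^+ i * g'.[x] ^+ (n - i).-1).
    apply: subr_N => //; apply: subr_sum => // i _.
    have [Af Ag] : adjoin K x f'.[x] /\ adjoin K x g'.[x].
      by split; [exists f'|exists g'].
    apply: (subr_M hKx); last exact: subr_X.
    by apply: (subr_M hKx); [apply: Kp|apply: subr_X].
  rewrite mulrN mulr_sumr; apply/eqP; rewrite -addr_eq0; apply/eqP.
  transitivity (g'.[x] ^+ n * p.[y]); last by rewrite (rootP py) mulr0.
  rewrite [p.[y]]horner_coef sp big_ord_recr /= -lead_coefE (monicP mp) mul1r mulrDr addrC.
  congr (_ + _); last by rewrite yE' expr_div_n mulrC divfK // expf_neq0.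
  rewrite mulr_sumr; apply: eq_bigr => i _.
  have -> : g'.[x] ^+ n = g'.[x] * g'.[x] ^+ (n - i).-1 * g'.[x] ^+ i.
    by rewrite -exprS prednK ?subn_gt0 // -exprD subnK // ltnW.
  rewrite yE' expr_div_n; field; exact: expf_neq0.
(* With af' + bg' = 1, the difference 1 - (af')^n is a multiple of bg', and (af')^n is a multiple of
   g'; so g' is a unit of K[x]. *)
have [k Kk gk] : exists2 k, adjoin K x k & g'.[x] * k = 1.
  exists (a.[x] ^+ n * h + b.[x] * \sum_(i < n) (a.[x] * f'.[x]) ^+ i).
    have [Aa Ab Af] : [/\ adjoin K x a.[x], adjoin K x b.[x] & adjoin K x f'.[x]].
      by split; [exists a|exists b|exists f'].
    apply: subr_D => //; first by apply: subr_M => //; apply: subr_X.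
    apply: subr_M => //; apply: subr_sum => // i _; apply: subr_X => //; exact: subr_M.
  rewrite mulrDr mulrCA -fh -exprMn mulrA [g'.[x] * _]mulrC.
  have -> : b.[x] * g'.[x] = - (a.[x] * f'.[x] - 1) by rewrite -one; ring.
  by rewrite mulNr -subrX1; ring.
have -> : y = f'.[x] * k.
  by rewrite yE'; apply: (mulfI gx0'); rewrite [RHS]mulrCA gk mulr1 mulrC divfK.
by apply: subr_M => //; exists f'.
Qed.

End Fractions.

Section TranscendentalFibre.
Variables (L : fieldType) (E D : set L) (x : L).
Hypotheses (hE : is_subring E) (hD : is_subring D) (ED : E `<=` D) (Dx : D x).
Hypothesis tx : transcendental E x.
Hypothesis Dint : forall d, D d -> intg (adjoin E x) d.

Let K := fractions E.
Let hK : is_subring K := fractions_subring hE.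
Let KV : inv_closed K. Proof. by move=> y; apply: fractions_inv. Qed.
Let EK : E `<=` K := sub_fractions hE.
Let tK : transcendental K x := transcendental_fractions hE tx.
Let h : {rmorphism {poly L} -> L} := horner_eval x.
Let hE' (p : {poly L}) : h p = p.[x]. Proof. by []. Qed.

Lemma image_horner_eval (A : set L) :
  [set horner_eval x p | p in (coefs_in A : set {poly L})] = adjoin A x.
Proof.
apply/seteqP; split=> [_ [p Ap <-]|_ [p Ap ->]]; first by exists p.
by exists p.
Qed.

Let E' : set L := K `&` intg E.

Let hE1 : is_subring E'.
Proof.
have hI := intg_subring hE; split=> [|y z [Ky Iy] [Kz Iz]|y z [Ky Iy] [Kz Iz]].
- by split; [apply: subr_1|apply: subr_1 hI].
- by split; [apply: subr_B|apply: intgB].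
- by split; [apply: subr_M|apply: intgM].
Qed.

(** Normality of K[x] writes [y] as g(x) over [K]. As [x] is transcendental, the integral equation
    of [y] lifts to one of the polynomial [g] over E[X], so the coefficients of [g] are integral
    over [E]. *)
Lemma intg_adjoin_fraction y :
  fractions (adjoin E x) y -> intg (adjoin E x) y -> adjoin E' x y.
Proof.
move=> Fy Iy.
have sub : adjoin E x `<=` adjoin K x.
  by move=> _ [p Ep ->]; exists p => //; apply: coefs_in_sub Ep.
have [||g Kg yE] := intg_fraction_adjoin hK KV tK (y := y).
- by have [a [b [Aa Ab b0 ->]]] := Fy; exists a, b; split=> //; apply: sub.
- exact: intg_mono Iy.
exists g => // i; split=> //.
suff : coefs_in (intg E) g by [].
apply: intg_poly_coefs => //.
apply: (@intg_image_inj _ _ (horner_eval x) _ (coefs_in K)) => //.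
- exact: coefs_in_subring.
- exact: coefs_in_subring.
- by move=> p; apply: coefs_in_sub.
- by rewrite image_horner_eval /= /horner_eval -yE.
Qed.

(* Every element of [D] is integral over [E[x]] with minimal polynomial over
   [E'[x]], [E'] being the integral closure of [E] in its fraction field.  *)
Lemma exists_lifted_minimal_polynomial s : D s ->
  exists P : {poly {poly L}}, [/\ P \is monic, coefs_in (coefs_in E') P,
    (map_poly (horner_eval x) P).[s] = 0 &
    forall f, coefs_in (adjoin E' x) f -> root f s -> (size f < size P)%N -> f = 0].
Proof.
move=> Ds; have [M [mM EM Ms]] := Dint Ds.
have hEx := adjoin_subring hE x.
have hF := fractions_subring hEx.
have FV : inv_closed (fractions (adjoin E x)) by move=> y; apply: fractions_inv.
have EF := sub_fractions hEx.
have [|P [mP FP Ps Pmin]] := minimal_polynomial hF FV (s := s).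
  by exists M; split=> //; apply: coefs_in_sub EM.
(* The minimal polynomial [P] divides the integral equation [M], so its coefficients are integral
   over E[x]; lying in the fraction field, they are in E'[x]. *)
have [Z [r [FZ Fr ME sr]]] := monic_division hF mP FP (coefs_in_sub EF EM).
have r0 : r = 0.
  apply: Pmin => //; rewrite rootE -[r](addKr (Z * P)) -ME hornerD hornerN hornerM.
  by rewrite (rootP Ps) (rootP Ms) mulr0 oppr0 addr0.
have mZ : Z \is monic by rewrite -(monicMr _ mP) -[Z * P]addr0 -r0 -ME.
have IP : coefs_in (intg (adjoin E x)) P.
  by apply: (intg_monic_factor hEx mP mZ); rewrite mulrC -[Z * P]addr0 -r0 -ME.
have EP : coefs_in (adjoin E' x) P by move=> i; apply: intg_adjoin_fraction.
have E'F : adjoin E' x `<=` fractions (adjoin E x).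
  apply: adjoin_min => //; last by apply: EF; apply: adjoin_gen.
  move=> _ [[a [b [Ea Eb b0 ->]]] _]; exists a, b; split=> //; exact: adjoin_sub.
have [||Q E'Q QE] := @lift_coefs_in_image _ _ (horner_eval x) (coefs_in E') P.
- exact: coefs_in_subring.
- by rewrite image_horner_eval.
have inj (p : {poly L}) : coefs_in E' p -> horner_eval x p = 0 -> p = 0.
  by move=> E'p; apply: tK => i; case: (E'p i).
have Qi i : P`_i = 0 -> Q`_i = 0 by rewrite -QE coef_map; apply: inj.
have sQ : size Q = size P.
  apply/eqP; rewrite eqn_leq -{2}QE size_poly andbT.
  by apply/leq_sizeP => j jP; apply: Qi; rewrite nth_default.
exists Q; split=> //.
- rewrite monicE lead_coefE sQ; apply/eqP/subr0_eq/inj.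
    apply: coefs_inB => //; exact: coefs_in1.
  move/monicP: mP; rewrite lead_coefE rmorphB rmorph1 -coef_map QE => ->.
  by rewrite subrr.
- by rewrite QE (rootP Ps).
- by move=> f E'f fs; rewrite sQ; apply: Pmin => //; exact: (coefs_in_sub E'F E'f).
Qed.

(* Going down for [E'[x]] inside [D], in the only form that is needed: a prime
   of [D] containing [F(x)] with [F] nonzero modulo [q] is not minimal in its
   fibre over [E]. *)
Lemma transcendental_fibre (q : set L) (F : {poly L}) (s : L) :
  prime_of D q -> coefs_in E F -> (exists i, ~ q F`_i) -> D s ->
  extension (q `&` E) D (F.[x] * s) -> q s.
Proof.
move=> qP EF [i0 Fi0] Ds sF; have [qI q1 qM] := qP; have [qD q0 qadd qmul] := qI.
have hD' := intg_subring hD.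
have D'D' : D `<=` intg D by move=> d; apply: intg_id.
(* [E'] need not lie in [D], but it lies in the integral closure of [D]; so [q] is replaced by a
   prime [q'] over it. *)
have [//|q' q'P q'q] := lying_over hD hD' D'D' _ qP.
have [q'I q'1 q'M] := q'P; have [q'D q'0 q'add q'mul] := q'I.
have E'D : E' `<=` intg D by move=> e [_]; apply: intg_mono.
pose p' := q' `&` E'.
have p'P : prime_of E' p'.
  split; last first.
  - move=> a b E'a E'b [] /q'M ab _.
    by have [] := ab (E'D _ E'a) (E'D _ E'b); [left|right].
  - by move=> [].
  split; first by move=> e [].
  - by split=> //; apply: subr_0.
  - by move=> a b [qa Ea] [qb Eb]; split; [apply: q'add|apply: subr_D].
  - by move=> a b Ea [qb Eb]; split; [apply: q'mul => //; apply: E'D|apply: subr_M].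
have E_E' : E `<=` E' by move=> e Ee; split; [apply: EK|apply: intg_id].
have p_p' : q `&` E `<=` p'.
  by move=> e [qe Ee]; split; [apply/q'q => //; apply: ED|apply: E_E'].
have [P [mP E'P Ps Pmin]] := exists_lifted_minimal_polynomial Ds.
have hEx := adjoin_subring hE x.
pose a := [set y | exists2 f, coefs_in (q `&` E) f & y = f.[x]].
have pI : ideal_of E (q `&` E).
  split; first by move=> e [].
  - by split=> //; apply: subr_0.
  - by move=> b c [qb Eb] [qc Ec]; split; [apply: qadd|apply: subr_D].
  - by move=> b c Eb [qc Ec]; split; [apply: qmul => //; apply: ED|apply: subr_M].
have aI : ideal_of (adjoin E x) a.
  have [fE f0 fadd fmul] := coefs_in_ideal hE pI; split.
  - by move=> _ [f /fE Ef ->]; exists f.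
  - by exists 0; rewrite ?horner0.
  - by move=> _ _ [f pf ->] [g pg ->]; exists (f + g); [apply: fadd|rewrite hornerD].
  - by move=> _ _ [f pf ->] [g pg ->]; exists (f * g); [apply: fmul|rewrite hornerM].
have pa : q `&` E `<=` a.
  move=> e pe; exists e%:P; last by rewrite hornerC.
  by move=> i; rewrite coefC; case: eqP => // _; have [] := pI.
have aF := extension_mono pa (@subset_refl _ D) sF.
have [W [mW Wx Wa]] := intg_extension hEx aI Dint aF.
pose n := (size W).-1; have sW : size W = n.+1.
  by rewrite prednK // size_poly_gt0 monic_neq0.
have /choice[c cP] i : exists f : {poly L}, (i < n)%N -> coefs_in (q `&` E) f /\ W`_i = f.[x].
  by case: (ltnP i n) => [/Wa[f pf fE]|_]; [exists f|exists 0].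
(* This is W(FY) as a polynomial in Y, its coefficients lifted from E[x] to E[X]. It vanishes at
   [s], and modulo [q] only the term F^n Y^n remains. *)
pose V := \poly_(i < n.+1) (if i == n then F ^+ n else c i * F ^+ i).
have hE'X := coefs_in_subring hE1.
have FE' : coefs_in E' F by apply: coefs_in_sub EF.
have cE' i : (i < n)%N -> coefs_in p' (c i).
  by move=> /cP[pc _]; apply: coefs_in_sub pc.
have rP := coefs_in_prime hE1 p'P.
have [rI _ _] := rP; have [rE r0 radd rmul] := rI.
have VE' : coefs_in (coefs_in E') V.
  move=> i; rewrite coef_poly; case: ifP => [|_]; last exact: coefs_in0.
  case: eqP => [_ _|/eqP ni lin]; first exact: coefs_in_exp.
  apply: coefs_inM => //; last exact: coefs_in_exp.
  by apply/rE/cE'; move: lin; rewrite ltnS leq_eqVlt (negPf ni).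
have [Z [T [E'Z E'T VE sT]]] := monic_division hE'X mP E'P VE'.
have Vs : (map_poly (horner_eval x) V).[s] = 0.
  rewrite -(rootP Wx) (@horner_coef_wide _ n.+1); last by rewrite (leq_trans (size_poly _ _)) ?size_poly.
  rewrite (horner_coef W) sW; apply: eq_bigr => i _.
  rewrite coef_map coef_poly ltn_ord exprMn mulrA; congr (_ * _).
  have [->|ni] := eqVneq (i : nat) n.
    by rewrite -lead_coefE (monicP mW) mul1r /= /horner_eval horner_exp.
  have lin : (i < n)%N by have := ltn_ord i; rewrite ltnS leq_eqVlt (negPf ni).
  by rewrite /= /horner_eval hornerM horner_exp (cP _ lin).2.
have T0 : T = 0.
  have hT : map_poly (horner_eval x) T = 0.
    apply: Pmin.
    - by rewrite -image_horner_eval; apply: coefs_in_map.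
    - rewrite rootE -[T](addKr (Z * P)) -VE rmorphD rmorphN rmorphM /=.
      by rewrite hornerD hornerN hornerM Ps Vs mulr0 oppr0 addr0.
    - exact: leq_ltn_trans (size_poly _ _) sT.
  apply/polyP => i; rewrite coef0; apply: tK => [j|]; first by case: (E'T i j).
  by have := congr1 (fun f : {poly L} => f`_i) hT; rewrite coef_map coef0.
(* [P] is monic and divides [V], a monomial modulo [p']; so [P] is a power of Y modulo [p'], which
   puts a power of [s] in [q']. *)
have PV : forall i, (i < (size P).-1)%N -> coefs_in p' P`_i.
  have VPZ : P * Z = V by rewrite VE T0 addr0 mulrC.
  apply: (monic_dvd_monomial (n := n) (g := Z) hE'X rP E'P E'Z mP).
    rewrite VPZ coef_poly ltnSn eqxx => /(prime_exp hE'X rP FE') Fp.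
    by apply: Fi0; have [/q'q-/(_ (ED (EF i0)))] := Fp i0.
  move=> k kn; rewrite VPZ coef_poly ltnS (negPf kn); case: ifP => // kln.
  rewrite mulrC; apply: rmul; first exact: coefs_in_exp.
  by apply: cE'; rewrite ltn_neqAle kn.
have sP : size P = (size P).-1.+1 by rewrite prednK // size_poly_gt0 monic_neq0.
have D's := D'D' _ Ds.
have D'x := D'D' _ Dx.
apply/q'q => //; apply: (prime_exp (n := (size P).-1) hD' q'P) => //.
have Plc : (map_poly (horner_eval x) P)`_(size P).-1 = 1.
  by rewrite coef_map /= -lead_coefE (monicP mP) /horner_eval hornerC.
have := Ps; rewrite (@horner_coef_wide _ (size P)) ?size_poly // sP big_ord_recr /=.
rewrite Plc mul1r addrC => /eqP.
rewrite addr_eq0 => /eqP ->; rewrite -sub0r; apply: (ideal_sub hD' q'I q'0).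
apply: (ideal_sum _ q'I) => i _; rewrite mulrC; apply: (q'mul); first exact: subr_X.
rewrite coef_map /= /horner_eval horner_coef; apply: (ideal_sum _ q'I) => j _.
rewrite mulrC; apply: (q'mul); first exact: subr_X.
by have [] := PV i (ltn_ord i) j.
Qed.

End TranscendentalFibre.

(** * Reduction modulo a prime to subrings of a field *)

Section ClassicalDomain.
Variable R : comNzRingType.
Hypothesis RP : forall x y : R, x * y = 0 -> (x == 0) || (y == 0).

(** The domain hypothesis is an argument of the type, so that instances can refer to it. Inverses
    are chosen classically, giving the integral domain over which [{fraction _}] is formed. *)
Definition classical_domain of (forall x y : R, x * y = 0 -> (x == 0) || (y == 0)) : Type := R.
Local Notation D := (classical_domain RP).
HB.instance Definition _ := GRing.ComNzRing.copy D R.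

Definition classical_unit : pred D := fun x => `[< exists y : D, y * x = 1 >].
Definition classical_inv (x : D) : D :=
  if pselect (exists y : D, y * x = 1) is left h then sval (cid h) else x.

Lemma classical_mulVr : {in classical_unit, left_inverse 1 classical_inv *%R}.
Proof.
move=> x; rewrite unfold_in => /asboolP h; rewrite /classical_inv.
by case: pselect => // h'; case: cid.
Qed.

Lemma classical_unitP (x y : D) : y * x = 1 -> classical_unit x.
Proof. by move=> yx; apply/asboolP; exists y. Qed.

Lemma classical_inv_out : {in [predC classical_unit], classical_inv =1 id}.
Proof.
move=> x; rewrite inE => /asboolPn h; rewrite /classical_inv.
by case: pselect.
Qed.

HB.instance Definition _ := GRing.ComNzRing_hasMulInverse.Build D
  classical_mulVr classical_unitP classical_inv_out.
HB.instance Definition _ := GRing.ComUnitRing_isIntegral.Build D RP.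

End ClassicalDomain.

Section PrimeQuotient.
Variables (R : comNzRingType) (r : set R).
Hypothesis rP : prime_of setT r.

Definition prime_pred of prime_of setT r : pred R := fun x => `[< r x >].
Local Notation I := (prime_pred rP).

Lemma prime_pred_idealr : idealr_closed I.
Proof.
have [[_ r0 radd rmul] r1 _] := rP; split; rewrite ?unfold_in; first exact/asboolP.
  exact/asboolPn.
move=> a u v; rewrite !unfold_in => /asboolP ru /asboolP rv.
by apply/asboolP/radd => //; apply: rmul.
Qed.
HB.instance Definition _ := isIdealr.Build R I prime_pred_idealr.

Lemma prime_pred_prime : prime_idealr_closed I.
Proof.
have [_ _ rM] := rP; move=> u v; rewrite !unfold_in => /asboolP/rM[]// h.
  by apply/orP; left; apply/asboolP.
by apply/orP; right; apply/asboolP.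
Qed.
HB.instance Definition _ := isPrimeIdealrClosed.Build R I prime_pred_prime.

(** The field is the fraction field of the quotient of [R] by [r]. *)
Lemma exists_residue_field :
  exists (L : fieldType) (f : {rmorphism R -> L}), forall x, f x = 0 <-> r x.
Proof.
pose J : prime_idealr R := PrimeIdealr.clone R I _.
pose Q := {ideal_quot J}.
pose D := classical_domain (@Quotient.rquot_IdomainAxiom R J).
pose pi : {rmorphism R -> Q} := \pi_Q%qT.
pose t : {rmorphism D -> {fraction D}} := @tofrac D.
have piE x : pi x = 0 <-> r x.
  have E : (x - 0 \in J) = (pi x == pi 0) by exact: Quotient.idealrBE.
  rewrite subr0 rmorph0 in E; split=> [/eqP|rx].
    by rewrite -E unfold_in => /asboolP.
  by apply/eqP; rewrite -E unfold_in; apply/asboolP.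
exists {fraction D}, (t \o (pi : R -> D)) => x; rewrite -piE.
have tE : (t (pi x) == 0) = ((pi x : D) == 0) := tofrac_eq0 (pi x : D).
by split=> /eqP h; apply/eqP; [rewrite tE in h|rewrite /= tE].
Qed.

End PrimeQuotient.

Lemma image_adjoin (R S : comNzRingType) (h : {rmorphism R -> S}) (A : set R) x :
  is_subring A -> h @` adjoin A x = adjoin (h @` A) (h x).
Proof.
move=> hA; apply/seteqP; split=> [_ [_ [p Ap ->] <-]|_ [q Aq ->]].
  by exists (map_poly h p); [apply: coefs_in_map|rewrite horner_map].
have [p Ap <-] := lift_coefs_in_image hA Aq.
by exists p.[x]; [exists p|rewrite horner_map].
Qed.

Lemma exists_subring_type (R : comNzRingType) (A : set R) : is_subring A ->
  exists (T : comNzRingType) (v : {rmorphism T -> R}),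
    [/\ injective v, forall a, A (v a) & forall x, A x -> exists a, v a = x].
Proof.
move=> hA; exists (sring hA), (@sring_val _ _ hA); split.
- exact: sring_val_inj.
- exact: sring_valP.
- exact: sring_lift.
Qed.

(** Map [D] to the residue field of [r]: the assumption on polynomials with value in [r] says
    exactly that the image of [x] is transcendental over the image of [A], and
    [transcendental_fibre] applies there. *)
Lemma transcendental_fibre_mod (R : comNzRingType) (A D r q : set R) x F s :
  is_subring A -> is_subring D -> A `<=` D -> D x ->
  (forall d, D d -> intg (adjoin A x) d) ->
  prime_of D r -> prime_of D q -> r `<=` q ->
  (forall f, coefs_in A f -> r f.[x] -> coefs_in r f) ->
  coefs_in A F -> (exists i, ~ q F`_i) -> D s ->
  extension (q `&` A) D (F.[x] * s) -> q s.
Proof.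
move=> hA hD AD Dx Dint rP qP rq tx AF [i0 Fi0] Ds sF.
have [rI r1 rM] := rP; have [rD r0 radd rmul] := rI.
have [qI q1 qM] := qP; have [qD q0 qadd qmul] := qI.
have [T [v [vI vD vlift]]] := exists_subring_type hD.
pose r' := [set a : T | r (v a)].
have rP' : prime_of setT r'.
  split; [split=> //| |].
  - by rewrite /r' /= rmorph0.
  - by move=> a b; rewrite /r' /= rmorphD; apply: radd.
  - by move=> a b _; rewrite /r' /= rmorphM; apply: rmul.
  - by rewrite /r' /= rmorph1.
  - by move=> a b _ _; rewrite /r' /= rmorphM; apply: rM.
have [L [f fr]] := exists_residue_field rP'.
(* As [r] lies in [q], membership in [q] depends only on the class modulo [r], so nothing is lost by
   taking images. *)
have fq a : q (v a) <-> (f @` [set a | q (v a)]) (f a).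
  split=> [qa|[b qb fb]]; first by exists a.
  have rab : r (v (a - b)) by apply/fr; rewrite rmorphB fb subrr.
  rewrite -[a](subrK b) rmorphD; apply: qadd => //; exact: rq.
pose A' := [set a : T | A (v a)].
have hA' : is_subring A'.
  split; rewrite /A' /=; first by rewrite rmorph1; apply: subr_1.
    by move=> a b; rewrite rmorphB; apply: subr_B.
  by move=> a b; rewrite rmorphM; apply: subr_M.
have vA' : v @` A' = A.
  apply/seteqP; split=> [_ [a Aa <-]//|a Aa].
  by have [b bE] := vlift _ (AD _ Aa); exists b; rewrite // /A' /= bE.
have [x' vx] := vlift _ Dx; have [s' vs] := vlift _ Ds.
have hT : is_subring [set: T] by split.
have hfA := image_subring f hA'; have hfT := image_subring f hT.
have lift_poly p : coefs_in A p -> exists2 p', coefs_in A' p' & map_poly v p' = p.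
  by rewrite -vA' => /lift_coefs_in_image; apply.
have [F' AF' FE] := lift_poly F AF.
suff : (f @` [set a | q (v a)]) (f s') by move/fq; rewrite vs.
have AT : f @` A' `<=` range f by move=> _ [a _ <-]; exists a.
apply: (@transcendental_fibre L (f @` A') (range f) (f x') hfA hfT AT _ _ _ _
  (map_poly f F')).
- by exists x'.
- move=> p /(lift_coefs_in_image hA')[g Ag <-]; rewrite horner_map => /fr.
  rewrite /r' /= -horner_map vx => rg.
  have /tx-/(_ rg) rvg : coefs_in A (map_poly v g) by rewrite -vA'; apply: coefs_in_map.
  apply/polyP => i; rewrite coef_map coef0; apply/fr.
  by have := rvg i; rewrite coef_map.
- move=> _ [a _ <-]; rewrite -image_adjoin //; apply: intg_image.
  apply: (@intg_image_inj _ _ v (adjoin A' x') setT) => //.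
  + exact: adjoin_subring.
  + by move=> b _; rewrite -(rmorph0 v); apply: vI.
  + by rewrite image_adjoin // vA' vx; apply: Dint.
- split.
  + split.
    * by move=> _ [a _ <-]; exists a.
    * by exists 0; rewrite ?rmorph0 //= rmorph0.
    * move=> _ _ [a qa <-] [b qb <-]; exists (a + b); rewrite ?rmorphD //.
      by rewrite /= rmorphD; apply: qadd.
    * move=> _ _ [a _ <-] [b qb <-]; exists (a * b); rewrite ?rmorphM //.
      by rewrite /= rmorphM; apply: qmul.
  + by rewrite -(rmorph1 f) => /fq; rewrite rmorph1.
  + move=> _ _ [a _ <-] [b _ <-]; rewrite -rmorphM => /fq; rewrite rmorphM.
    by move=> /(qM _ _ (vD a) (vD b))[h|h]; [left|right]; apply/fq.
- exact: coefs_in_map.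
- by exists i0; rewrite coef_map => /fq; rewrite -coef_map FE.
- by exists s'.
- have [c [cP cE]] := sF.
  have /choice[g gP] (z : R * R) : exists a : T * T, z \in c ->
      v a.1 = z.1 /\ v a.2 = z.2.
    have [/cP[[qz Az] Dz]|_] := boolP (z \in c); last by exists (0, 0).
    have [a aE] := vlift _ (AD _ Az); have [b bE] := vlift _ Dz.
    by exists (a, b).
  exists [seq (f (g z).1, f (g z).2) | z <- c]; split.
    move=> _ /mapP[z zc ->] /=; have [/cP[[qz Az] Dz] [E1 E2]] := (zc, gP z zc).
    split; last by exists (g z).2.
    by split; exists (g z).1; rewrite // /A' /= E1.
  rewrite horner_map -rmorphM; apply/eqP; rewrite big_map /= -subr_eq0.
  under eq_bigr do rewrite -rmorphM.
  rewrite -rmorph_sum -rmorphB; apply/eqP/fr; rewrite /r' /=.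
  rewrite rmorphB rmorphM -horner_map FE vx vs cE rmorph_sum.
  rewrite big_seq [X in _ - X]big_seq (_ : _ - _ = 0) //.
  apply/eqP; rewrite subr_eq0; apply/eqP; apply: eq_bigr => z /gP[E1 E2].
  by rewrite rmorphM E1 E2.
Qed.

(** * Zariski's main theorem for commutative rings *)

Section OneVariable.
Variable R : comNzRingType.
Implicit Types (A D I J r q : set R) (f g p : {poly R}) (x y : R) (ms ns : seq R).

Lemma extension_mem a D y : is_subring a -> D y -> extension a D y.
Proof.
move=> ha Dy; exists [:: (1, y)]; rewrite big_seq1 mul1r; split=> // c.
by rewrite inE => /eqP -> /=; split=> //; apply: subr_1.
Qed.

Lemma extension_add a D y z : extension a D y -> extension a D z ->
  extension a D (y + z).
Proof.
move=> [s [sP ->]] [t [tP ->]]; exists (s ++ t); rewrite big_cat; split=> // c.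
by rewrite mem_cat => /orP[/sP|/tP].
Qed.

Lemma extension_sum a D (K : Type) (u : seq K) (P : pred K) (F : K -> R) :
  (forall i, P i -> extension a D (F i)) -> extension a D (\sum_(i <- u | P i) F i).
Proof.
move=> H; apply: (big_ind (extension a D)) => //; last exact: extension_add.
by exists [::]; rewrite big_nil.
Qed.

Lemma extension_scale a D b y : is_subring a -> a b -> extension a D y ->
  extension a D (b * y).
Proof.
move=> ha ab [s [sP ->]]; exists [seq (b * c.1, c.2) | c <- s]; split.
  by move=> _ /mapP[c /sP[ac Dc] ->] /=; split=> //; apply: subr_M.
by rewrite big_map mulr_sumr; apply: eq_bigr => c _ /=; rewrite mulrA.
Qed.

Lemma extension_coord A ms y : is_subring A -> extension A [set m | m \in ms] y ->
  exists a : nat -> R, (forall i, A (a i)) /\ y = \sum_(i < size ms) a i * ms`_i.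
Proof.
move=> hA [s [sP ->]]; elim: s sP => [|c s IH] sP.
  exists (fun=> 0); split=> [i|]; first exact: subr_0.
  by rewrite big_nil big1 // => i _; rewrite mul0r.
have [|a [Aa aE]] := IH; first by move=> d ds; apply: sP; rewrite inE ds orbT.
have [Ac cm] := sP c (mem_head _ _).
exists (fun i => a i + (if i == index c.2 ms then c.1 else 0)); split=> [i|].
  by apply: subr_D => //; case: ifP => // _; apply: subr_0.
rewrite big_cons aE addrC; under [RHS]eq_bigr do rewrite mulrDl.
rewrite big_split /=; congr (_ + _).
have ims : (index c.2 ms < size ms)%N by rewrite index_mem.
rewrite (bigD1 (Ordinal ims)) //= eqxx nth_index // big1 ?addr0 // => i ni.
rewrite ifN ?mul0r //; apply: contraNneq ni => ie; exact/eqP/val_inj.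
Qed.

Lemma intg_finite_extension A ms y : is_subring A ->
  extension A [set m | m \in ms] 1 ->
  (forall m, m \in ms -> extension A [set m | m \in ms] (y * m)) -> intg A y.
Proof.
move=> hA /extension_coord-/(_ hA)[u [Au uE]] ym.
have /choice[M MP] (i : 'I_(size ms)) : exists a : nat -> R,
    (forall j, A (a j)) /\ y * ms`_i = \sum_(j < size ms) a j * ms`_j.
  by apply: extension_coord => //; apply/ym/mem_nth.
apply: (@intg_finite_module _ A hA _ (\col_i ms`_i) (\matrix_(i, j) M i j)
  (\row_i u i)).
- by move=> i j; rewrite mxE; have [] := MP i.
- apply/colP => i; rewrite !mxE (MP i).2.
  by apply: eq_bigr => j _; rewrite !mxE.
- by rewrite mxE uE; apply: eq_bigr => j _; rewrite !mxE.
Qed.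

(** The elements are adjoined one by one, and their high powers are reduced by the monic equations.
    Finiteness over [A] lets one power of a denominator serve for all of [D]; the minimality clause
    places [D] inside a given larger ring. *)
Lemma finite_subalgebra A (ds : seq R) : is_subring A ->
  (forall d, d \in ds -> intg A d) ->
  exists D ns, [/\ is_subring D, A `<=` D /\ (forall d, d \in ds -> D d),
    forall y, D y -> intg A y,
    forall B : set R, is_subring B -> A `<=` B -> (forall d, d \in ds -> B d) -> D `<=` B &
    (forall n, n \in ns -> D n) /\ D `<=` extension A [set n | n \in ns]].
Proof.
move=> hA; elim: ds => [|d ds IH] dsI.
  exists A, [:: 1]; split=> //; [by split|by move=> y; apply: intg_id|].
  split=> [n|y Ay]; first by rewrite inE => /eqP ->; apply: subr_1.
  exists [:: (y, 1)]; rewrite big_seq1 mulr1; split=> // c.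
  by rewrite inE => /eqP -> /=; split=> //; rewrite inE.
have [|D [ns [hD [AD dsD] DI Dmin [nsD Dns]]]] := IH.
  by move=> e eds; apply: dsI; rewrite inE eds orbT.
have [p [mp Ap pd]] := dsI d (mem_head _ _).
exists (adjoin D d), [seq m * d ^+ i | m <- ns, i <- iota 0 (size p)].
have hDd := adjoin_subring hD d.
split=> //.
- split; first by move=> a /AD; apply: adjoin_sub.
  move=> e; rewrite inE => /predU1P[->|/dsD]; [exact: adjoin_gen|exact: adjoin_sub].
- move=> _ [f Df ->]; apply: horner_in; first exact: intg_subring.
    by move=> i; apply: DI.
  exact: dsI (mem_head _ _).
- move=> B hB AB dsB; apply: adjoin_min => //; last exact: dsB (mem_head _ _).
  by apply: Dmin => // e eds; apply: dsB; rewrite inE eds orbT.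
split=> [_ /allpairsP[[m i] /= [mns _ ->]]|_ [f Df ->]].
  apply: subr_M => //; first exact/adjoin_sub/nsD.
  by apply: subr_X => //; apply: adjoin_gen.
have [g [h [Dg Dh -> sh]]] := monic_division hD mp (coefs_in_sub AD Ap) Df.
rewrite hornerD hornerM (rootP pd) mulr0 add0r horner_coef.
apply: extension_sum => i _; have [s [sP ->]] := Dns _ (Dh i).
exists [seq (c.1, c.2 * d ^+ i) | c <- s]; split.
  move=> _ /mapP[c /sP[Ac cns] ->] /=; split=> //.
  apply/allpairsP; exists (c.2, i : nat); split=> //=.
  by rewrite mem_iota /= add0n (ltn_trans (ltn_ord i)).
by rewrite big_map mulr_suml; apply: eq_bigr => c _ /=; rewrite mulrA.
Qed.

(** For [a] the leading coefficient, a^m f is a monic polynomial in aX; hence [a] times a root of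
    [f] is integral. *)
Lemma monicize A f m : is_subring A -> coefs_in A f -> size f = m.+2 ->
  exists g, [/\ g \is monic, coefs_in A g, size g = m.+2 &
    forall x, g.[lead_coef f * x] = lead_coef f ^+ m * f.[x]].
Proof.
move=> hA Af sf; set a := lead_coef f.
have Aa : A a by rewrite /a lead_coefE.
pose e := \poly_(i < m.+1) (f`_i * a ^+ (m - i)).
have se : (size e < size ('X^(m.+1) : {poly R})%R)%N.
  by rewrite size_polyXn ltnS size_poly.
exists ('X^(m.+1) + e); split.
- by rewrite monicE lead_coefDl // lead_coefXn.
- apply: coefs_inD => //; first exact: coefs_inXn.
  move=> i; rewrite coef_poly; case: ifP => _; last exact: subr_0.
  by apply: subr_M => //; apply: subr_X.
- by rewrite size_polyDl // size_polyXn.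
move=> x; rewrite hornerD hornerXn horner_poly horner_coef sf [in RHS]big_ord_recr /=.
have <- : a = f`_m.+1 by rewrite /a lead_coefE sf.
rewrite addrC mulrDr exprMn.
rewrite mulr_sumr; congr (_ + _); first by rewrite [in LHS]exprSr mulrA.
apply: eq_bigr => i _; rewrite exprMn.
have -> : a ^+ m = a ^+ (m - i) * a ^+ i by rewrite -exprD subnK // -ltnS.
ring.
Qed.

(** By [monicize], the leading coefficient [a] times [x] is integral, hence in [A]. If [a] is
    outside [q] it is the required element; otherwise the degree of the relation is lowered. *)
Lemma relation_unit A T q p x : is_subring A -> is_subring T -> A `<=` T ->
  T x -> (forall y, T y -> intg A y -> A y) ->
  prime_of T q -> coefs_in A p -> p.[x] = 0 -> (exists i, ~ q p`_i) ->
  exists u, [/\ A u, ~ q u & A (u * x)].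
Proof.
move=> hA hT AT Tx AI qP; have [qI q1 _] := qP; have [_ q0 qadd qmul] := qI.
have [n sp] := ubnP (size p); elim: n => // n IH in p sp *; move=> Ap px [i0 pi0].
move: sp; case sE : (size p) => [|[|m]] sp.
- by case: pi0; rewrite nth_default ?sE.
- case: pi0; rewrite (size1_polyC (eq_leq sE)) in px *; rewrite hornerC in px.
  by rewrite px polyC0 coef0.
set a := lead_coef p; have Aa : A a by rewrite /a lead_coefE.
have Aax : A (a * x).
  have [g [mg Ag _ gE]] := monicize hA Ap sE.
  apply: AI; first by apply: subr_M => //; apply: AT.
  by exists g; split=> //; rewrite rootE gE px mulr0.
have [qa|nqa] := pselect (q a); last by exists a.
(* Replace the leading term a X^(m+1) by (ax) X^m, which has the same value at [x]. If all new
   coefficients were in [q], so would be the old ones, because [a] is in [q]. *)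
pose p' := p - a *: 'X^(m.+1) + (a * x) *: 'X^m.
have sp' : (size p' <= m.+1)%N.
  apply/leq_sizeP => j mj; rewrite !(coefD, coefN, coefZ, coefXn).
  rewrite [j == m]gtn_eqF // mulr0 addr0; case: (ltngtP j m.+1) mj => // [jm _|-> _].
    by rewrite nth_default ?sE // mulr0 subr0.
  by rewrite mulr1 /a lead_coefE sE subrr.
have := IH p' _ _ _ _; apply.
- exact: leq_ltn_trans sp' _.
- apply: coefs_inD => //; first apply: coefs_inB => //.
    by apply: coefs_inZ => //; apply: coefs_inXn.
  by apply: coefs_inZ => //; apply: coefs_inXn.
- by rewrite !hornerE px exprS; ring.
apply: contrapT => /forallNP np'; apply: pi0.
have q' j : q p'`_j by apply: contrapT; apply: np'.
have -> : p`_i0 = p'`_i0 + ('X^(m.+1))`_i0 * a - ('X^m)`_i0 * x * a.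
  by rewrite !(coefD, coefN, coefZ); ring.
have TX l j : T (('X^l)`_j) by apply: coefs_inXn.
apply: (ideal_sub hT qI); first by apply: (qadd) => //; apply: (qmul).
by apply: (qmul) => //; apply: subr_M.
Qed.

End OneVariable.

(** * From a denominator f(x) to its leading coefficient *)

Section Conductor.
Variable R : comNzRingType.
Implicit Types (A D I J r q T : set R) (f g p : {poly R}) (x y z : R) (ms ns : seq R).

(* The products [z^i y^j] with [i < n] and [j] bounded span an [A]-module stable
   under [y]: the relation [y z^n = r(z) - y (g - X^n)(z)] lowers the exponent
   of [z] at the cost of at most one power of [y]. *)
Lemma intg_of_monic_relation A g h z y : is_subring A -> g \is monic ->
  coefs_in A g -> coefs_in A h -> (size h < size g)%N ->
  y * g.[z] = h.[z] -> intg (adjoin A z) y -> intg A y.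
Proof.
move=> hA mg Ag Ah shg yg [p [mp Ap py]].
pose n := (size g).-1; have sg : size g = n.+1.
  by rewrite prednK // size_poly_gt0 monic_neq0.
pose k := (size p).-1; have sp : size p = k.+1.
  by rewrite prednK // size_poly_gt0 monic_neq0.
have /choice[c cP] i : exists f, coefs_in A f /\ p`_i = f.[z].
  by have [f] := Ap i; exists f.
have [->|n0] := eqVneq y 0; first by apply: intg_id => //; apply: subr_0.
have {}n0 : (0 < n)%N.
  rewrite lt0n; apply: contraNneq n0 => nz; move: yg.
  have h0 : h = 0 by apply/eqP; rewrite -size_poly_leq0 -ltnS -nz -sg.
  have g1 : g = 1.
    rewrite (@size1_polyC _ g) ?sg ?nz //.
    by move/monicP: mg; rewrite lead_coefE sg nz /= => ->.
  by rewrite h0 g1 hornerC mulr1 horner0 => ->.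
pose C := \max_(i < k) size (c i).
(* When y^N is rewritten by the equation of [y], there arise monomials in which [z] has exponent
   below n + C and [y] at least N - k = C + n, so [red] applies to them. *)
pose N := (k + C + n)%N.
pose ms := [seq z ^+ i * y ^+ j | i <- iota 0 n, j <- iota 0 N].
pose S := extension A [set m | m \in ms].
have gen i j : (i < n)%N -> (j < N)%N -> S (z ^+ i * y ^+ j).
  move=> ilt jlt; apply: extension_mem => //=; apply/allpairsP; exists (i, j).
  by rewrite /= !mem_iota.
have zn : y * z ^+ n = h.[z] - \sum_(i < n) g`_i * (y * z ^+ i).
  rewrite -yg horner_coef sg big_ord_recr /= -lead_coefE (monicP mg) mul1r.
  rewrite mulrDr mulr_sumr [X in X - _]addrC -addrA -sumrB big1 ?addr0 // => i _.
  by rewrite mulrCA subrr.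
(* The bound e <= j survives a reduction: when a factor [y] is lost, the exponent of [z] has dropped
   by at least one. *)
have red e j : (e <= j)%N -> (j < N)%N -> S (z ^+ e * y ^+ j).
  elim/ltn_ind: e j => e IH j ej jN; have [en|ne] := ltnP e n; first exact: gen.
  have j0 : (0 < j)%N by rewrite (leq_trans n0) // (leq_trans ne).
  have -> : z ^+ e * y ^+ j = z ^+ (e - n) * y ^+ j.-1 * (y * z ^+ n).
    rewrite -{1}(subnK ne) exprD -{1}(prednK j0) exprS; ring.
  rewrite zn mulrBr -mulrN -sumrN mulr_sumr; apply: extension_add.
    rewrite horner_coef mulr_sumr; apply: extension_sum => i _.
    have -> : z ^+ (e - n) * y ^+ j.-1 * (h`_i * z ^+ i) =
      h`_i * (z ^+ (e - n + i) * y ^+ j.-1) by rewrite exprD; ring.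
    have ilt : (i < n)%N by rewrite -ltnS -sg (leq_ltn_trans _ shg).
    apply: extension_scale => //; apply: IH; lia.
  apply: extension_sum => i _.
  have -> : z ^+ (e - n) * y ^+ j.-1 * - (g`_i * (y * z ^+ i)) =
      - g`_i * (z ^+ (e - n + i) * y ^+ j).
    by rewrite exprD -{2}(prednK j0) exprS; ring.
  apply: extension_scale => //; first exact: subr_N.
  by apply: IH; have := ltn_ord i; lia.
apply: (@intg_finite_extension _ A ms) => //.
  have := gen 0%N 0%N n0; rewrite !expr0 mulr1; apply; lia.
move=> _ /allpairsP[[i j] /= [+ + ->]]; rewrite !mem_iota /= !add0n => ilt jlt.
have -> : y * (z ^+ i * y ^+ j) = z ^+ i * y ^+ j.+1 by rewrite exprS; ring.
have [jN|Nj] := ltnP j.+1 N; first exact: gen.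
have {}jlt : j.+1 = N by lia.
have yk : y ^+ k = - \sum_(l < k) (c l).[z] * y ^+ l.
  move/rootP: py; rewrite horner_coef sp big_ord_recr /= -lead_coefE (monicP mp).
  rewrite mul1r addrC => /eqP; rewrite addr_eq0 => /eqP ->; congr (- _).
  by apply: eq_bigr => l _; rewrite (cP l).2.
have -> : y ^+ j.+1 = y ^+ (N - k) * y ^+ k by rewrite -exprD jlt subnK //; lia.
rewrite yk -sumrN !mulr_sumr; apply: extension_sum => l _.
rewrite horner_coef mulr_suml -sumrN !mulr_sumr; apply: extension_sum => e _.
have -> : z ^+ i * (y ^+ (N - k) * - ((c l)`_e * z ^+ e * y ^+ l)) =
    - (c l)`_e * (z ^+ (i + e) * y ^+ (N - k + l)) by rewrite !exprD; ring.
apply: extension_scale => //; first by apply: subr_N => //; case: (cP l).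
have eC : (e < C)%N.
  apply: leq_trans (ltn_ord e) _.
  exact: (leq_bigmax (F := fun l : 'I_k => size (c l))).
by apply: red; have := ltn_ord l; lia.
Qed.

Lemma adjoin_scaled A a f x k : is_subring A -> A a -> coefs_in A f ->
  (size f <= k)%N -> adjoin A (a * x) (a ^+ k * f.[x]).
Proof.
move=> hA Aa Af fk; exists (\poly_(i < size f) (f`_i * a ^+ (k - i))).
  move=> i; rewrite coef_poly; case: ifP => _; last exact: subr_0.
  by apply: subr_M => //; apply: subr_X.
rewrite horner_poly horner_coef mulr_sumr; apply: eq_bigr => i _.
have -> : a ^+ k = a ^+ (k - i) * a ^+ i.
  by rewrite -exprD subnK // (leq_trans _ fk) // ltnW.
by rewrite exprMn; ring.
Qed.

(** Scaling [y] by a^K multiplies the coefficient of index i of its equation by a^(K(k-i)), and [K]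
    bounds the degrees in [x] of all the coefficients; so they become polynomials in [a * x]. *)
Lemma intg_adjoin_scaled A a x y : is_subring A -> A a ->
  intg (adjoin A x) y -> exists K, intg (adjoin A (a * x)) (a ^+ K * y).
Proof.
move=> hA Aa [p [mp Ap py]].
have /choice[c cP] i : exists f, coefs_in A f /\ p`_i = f.[x].
  by have [f] := Ap i; exists f.
pose k := (size p).-1; have sp : size p = k.+1.
  by rewrite prednK // size_poly_gt0 monic_neq0.
pose K := \max_(i < k) size (c i); exists K.
have hB := adjoin_subring hA (a * x).
pose e := \poly_(i < k) (a ^+ (K * (k - i)) * p`_i).
have ps : (size e <
    size ('X^k : {poly R})%R)%N by rewrite size_polyXn ltnS size_poly.
exists ('X^k + e); split.
- by rewrite monicE lead_coefDl // lead_coefXn.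
- apply: coefs_inD => //; first exact: coefs_inXn.
  move=> i; rewrite coef_poly; case: ifP => ik; last exact: subr_0.
  rewrite (cP i).2; apply: adjoin_scaled => //; first by case: (cP i).
  rewrite (leq_trans (leq_bigmax (F := fun l : 'I_k => size (c l)) (Ordinal ik))) //.
  by rewrite leq_pmulr ?subn_gt0.
- rewrite rootE hornerD hornerXn horner_poly; apply/eqP.
  transitivity (a ^+ (K * k) * p.[y]); last by rewrite (rootP py) mulr0.
  rewrite horner_coef sp big_ord_recr /= -lead_coefE (monicP mp) mul1r mulrDr addrC.
  congr (_ + _); last by rewrite exprMn exprM.
  rewrite mulr_sumr; apply: eq_bigr => i _.
  have -> : a ^+ (K * k) = a ^+ (K * (k - i)) * a ^+ (K * i).
    by rewrite -exprD -mulnDr subnK // ltnW.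
  by rewrite exprMn -exprM; ring.
Qed.

(** In terms of z = ax the relation has a monic denominator. Dividing its right-hand side by this
    denominator leaves a remainder of smaller degree, the situation of [intg_of_monic_relation]. *)
Lemma adjoin_of_relation A T f g x y : is_subring A -> is_subring T ->
  A `<=` T -> (forall t, T t -> intg A t -> A t) -> T x -> T y ->
  f != 0 -> coefs_in A f -> coefs_in A g -> y * f.[x] = g.[x] ->
  intg (adjoin A x) y -> exists M, adjoin A x (lead_coef f ^+ M * y).
Proof.
move=> hA hT AT TA Tx Ty f0 Af Ag yf Iy.
set a := lead_coef f; have Aa : A a by rewrite /a lead_coefE.
case sf : (size f) => [|[|m]].
- by move: f0; rewrite -size_poly_eq0 sf.
- exists 1%N; exists g => //; rewrite -yf expr1 mulrC /a lead_coefE sf.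
  by rewrite {2}(size1_polyC (eq_leq sf)) hornerC.
have [h [mh Ah sh hE]] := monicize hA Af sf; rewrite -/a in hE.
set z := a * x in hE; have hz := adjoin_subring hA z.
have Tz : T z by apply: subr_M => //; apply: AT.
have zx : adjoin A z `<=` adjoin A x.
  apply: adjoin_min; [exact: adjoin_subring|exact: adjoin_sub|].
  apply: subr_M; [exact: adjoin_subring|exact: adjoin_sub|exact: adjoin_gen].
have azin M : adjoin A z (a ^+ M) by apply: subr_X => //; apply: adjoin_sub.
have [g1 Ag1 g1E] := adjoin_scaled x hA Aa Ag (leqnn _).
have [Q [r [AQ Ar QE sr]]] := monic_division hA mh Ah
  (coefs_inZ hA (subr_X hA m Aa) Ag1).
have [K IK] := intg_adjoin_scaled hA Aa Iy.
set k := size g in g1E.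
(* The polynomial part Q(z) is removed; what is left, scaled by a^K, is integral over [A] and so
   lies in [A]. *)
pose y1 := a ^+ k * y - Q.[z].
have y1r : y1 * h.[z] = r.[z].
  rewrite /y1 mulrBl -hornerM hE.
  have -> : a ^+ k * y * (a ^+ m * f.[x]) = (a ^+ m *: g1).[z].
    by rewrite hornerZ -g1E -yf; ring.
  by rewrite QE hornerD addrAC subrr add0r.
have Ay1 : A (a ^+ K * y1).
  apply: TA.
    apply: subr_M => //; first by apply: subr_X => //; apply: AT.
    apply: subr_B => //; first by apply: subr_M => //; apply: subr_X => //; apply: AT.
    by apply: horner_in => //; apply: coefs_in_sub AQ.
  apply: (@intg_of_monic_relation _ h (a ^+ K *: r) z) => //.
  - by apply: coefs_inZ => //; apply: subr_X.
  - exact: leq_ltn_trans (size_scale_leq _ _) sr.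
  - by rewrite hornerZ -y1r mulrA.
  have -> : a ^+ K * y1 = a ^+ k * (a ^+ K * y) - a ^+ K * Q.[z].
    by rewrite /y1; ring.
  apply: intgB => //; first by apply: intgM => //; apply: intg_id.
  by apply: intg_id => //; apply: subr_M => //; exists Q.
exists (K + k)%N; have -> : a ^+ (K + k) * y = a ^+ K * y1 + a ^+ K * Q.[z].
  by rewrite /y1 exprD; ring.
apply: zx; apply: subr_D => //; first exact: adjoin_sub.
by apply: subr_M => //; exists Q.
Qed.

End Conductor.

(** * Peskine's argument and the induction on the number of generators *)

Section ZariskiMainTheorem.
Variable R : comNzRingType.
Implicit Types (A D I J r q T : set R) (f p : {poly R}) (g x y z : R) (ms ns : seq R).

(* [x] is algebraic over the residue field of [q] in its fibre, locally at [q]. *)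
Definition quasi_finite_at A T q x := exists s f,
  [/\ T s, ~ q s, coefs_in A f, exists i, ~ q f`_i &
   extension (q `&` A) T (f.[x] * s)].

Lemma ideal_restrict A T q : is_subring A -> A `<=` T -> ideal_of T q ->
  ideal_of A (q `&` A).
Proof.
move=> hA AT [_ q0 qadd qmul]; split; first by move=> x [].
- by split=> //; apply: subr_0.
- by move=> x y [qx Ax] [qy Ay]; split; [apply: qadd|apply: subr_D].
- by move=> a x Aa [qx Ax]; split; [apply: qmul => //; apply: AT|apply: subr_M].
Qed.

Lemma prime_restrict A T q : is_subring A -> A `<=` T -> prime_of T q ->
  prime_of A (q `&` A).
Proof.
move=> hA AT [qI q1 qM]; split; first exact: ideal_restrict qI.
  by move=> [].
by move=> x y Ax Ay [/(qM _ _ (AT _ Ax) (AT _ Ay))[qx|qy] _]; [left|right].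
Qed.

Lemma extension_adjoin A I x y : is_subring A -> ideal_of A I ->
  extension I (adjoin A x) y -> exists2 f, coefs_in I f & y = f.[x].
Proof.
move=> hA II; have [fA f0 fadd fmul] := coefs_in_ideal hA II.
pose a := [set y | exists2 f, coefs_in I f & y = f.[x]].
apply: (@extension_min _ I (adjoin A x) a).
  split.
  - by move=> _ [f /fA Af ->]; exists f.
  - by exists 0; rewrite ?horner0.
  - by move=> _ _ [f If ->] [g Ig ->]; exists (f + g); [apply: fadd|rewrite hornerD].
  - by move=> _ _ [f If ->] [g Ig ->]; exists (f * g); [apply: fmul|rewrite hornerM].
move=> e Ie; exists e%:P; last by rewrite hornerC.
by move=> i; rewrite coefC; case: eqP => // _; have [] := II.
Qed.

(** Multiplying [s] and f(x)s by [g] gives values h(x) and k(x), with [k] over [q] and [A]. Then hf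
    - k vanishes at [x], and by Gauss's lemma its coefficients are not all in [q]: not those of [f]
    by assumption, nor those of [h], since gs is outside [q]. *)
Lemma one_variable_denominator A T D q x g s f : is_subring A -> is_subring T ->
  A `<=` T -> T x -> (forall t, T t -> intg A t -> A t) -> prime_of T q ->
  T s -> ~ q s -> coefs_in A f -> (exists i, ~ q f`_i) ->
  extension (q `&` A) D (f.[x] * s) -> D s -> T g -> ~ q g ->
  (forall b, D b -> adjoin A x (g * b)) ->
  exists u, [/\ A u, ~ q u & A (u * x)].
Proof.
move=> hA hT AT Tx TA qP Ts qs Af [i0 fi0] sf Ds Tg qg gD.
have [qI q1 qM] := qP; have pP := prime_restrict hA AT qP; have [pI _ _] := pP.
have [h Ah hE] := gD _ Ds.
have [k pk kE] : exists2 k, coefs_in (q `&` A) k & g * (f.[x] * s) = k.[x].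
  apply: (@extension_adjoin A) => //.
  have [c [cP ->]] := sf; exists [seq (d.1, g * d.2) | d <- c]; split.
    by move=> _ /mapP[d /cP[qd Dd] ->] /=; split=> //; apply: gD.
  by rewrite big_map mulr_sumr; apply: eq_bigr => d _ /=; rewrite mulrCA.
have Ak : coefs_in A k by move=> i; have [] := pk i.
apply: (@relation_unit _ A T q (h * f - k) x) => //.
- by apply: coefs_inB => //; apply: coefs_inM.
- by rewrite hornerD hornerN hornerM -hE -kE; ring.
apply: contrapT => /forallNP nq.
have [||ph|pf] := @poly_prime _ A (q `&` A) h f hA pI Ah Af.
- by move=> i j; have [_ _] := pP; apply.
- move=> i; have Ahf : A (h * f)`_i by apply: coefs_inM.
  split=> //; rewrite -[_`_i](subrK k`_i); have [_ _ qadd _] := qI.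
  by apply: qadd; [rewrite -coefB; apply: contrapT; apply: nq|case: (pk i)].
- case: (qM _ _ Tg Ts) => //; rewrite hE horner_coef; apply: (ideal_sum _ qI) => i _.
  have [_ _ _ qmul] := qI; rewrite mulrC; apply: qmul; first exact: subr_X.
  by case: (ph i).
- by case: (pf i0).
Qed.

(** If the conductor is not inside [q], [one_variable_denominator] concludes. Otherwise take a prime
    [r] minimal over it and inside [q]; [x] is transcendental modulo [r], which contradicts
    quasi-finiteness at [q]. *)
Lemma one_variable A T q x : is_subring A -> is_subring T -> A `<=` T -> T x ->
  (forall t, T t -> intg A t -> A t) -> (forall t, T t -> intg (adjoin A x) t) ->
  prime_of T q -> quasi_finite_at A T q x ->
  exists u, [/\ A u, ~ q u & A (u * x)].
Proof.
move=> hA hT AT Tx TA TI qP [s [f [Ts qs Af nf [c [cP cE]]]]].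
have [qI q1 qM] := qP; have [qT q0 qadd qmul] := qI.
(* [T] need not be finite over A[x]. The finitely many elements that witness the fibre relation
   generate a finite subalgebra in which the relation still holds. *)
have hG := adjoin_subring hA x; pose ds := s :: map snd c.
have dsT d : d \in ds -> T d.
  by rewrite inE => /predU1P[->//|/mapP[e /cP[_ Te] ->]].
have GT : adjoin A x `<=` T by apply: adjoin_min.
have [|D [ns [hD [GD dsD] DI Dmin [nsD Dns]]]] := @finite_subalgebra _ (adjoin A x) ds hG.
  by move=> d /dsT/TI.
have {Dmin} DT : D `<=` T by apply: Dmin.
have AD : A `<=` D by move=> a Aa; apply/GD/adjoin_sub.
have Ds : D s by apply/dsD/mem_head.
have Dx : D x by apply/GD/adjoin_gen.
have sD : extension (q `&` A) D (f.[x] * s).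
  exists c; split=> // d dc; have [] := cP d dc; split=> //.
  by apply: dsD; rewrite inE map_f ?orbT.
(* The conductor of [D] into A[x]. *)
pose J := [set g | D g /\ forall b, D b -> adjoin A x (g * b)].
have JI : ideal_of D J.
  split; first by move=> g [].
  - by split=> [|b _]; rewrite ?mul0r; apply: subr_0.
  - move=> g h [Dg gJ] [Dh hJ]; split=> [|b Db]; first exact: subr_D.
    by rewrite mulrDl; apply: subr_D => //; [apply: gJ|apply: hJ].
  - move=> a g Da [Dg gJ]; split=> [|b Db]; first exact: subr_M.
    by rewrite mulrAC mulrC; apply: gJ; apply: subr_M.
have [[g [[Dg gJ] qg]]|nJ] := pselect (exists g, J g /\ ~ q g).
  exact: (one_variable_denominator hA hT AT Tx TA qP Ts qs Af nf sD Ds (DT _ Dg) qg).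
have qDP := prime_restrict hD DT qP.
have [||||r [rP Jr rS rmin]] := @exists_minimal_prime _ D J (D `\` q) hD JI.
- by move=> y [].
- by split=> //; apply: subr_1.
- move=> y z [Dy qy] [Dz qz]; split; first exact: subr_M.
  by case/(qM _ _ (DT _ Dy) (DT _ Dz)).
- by move=> y [Dy qy] Jy; apply: nJ; exists y.
have [rI r1 rM] := rP; have [rD r0 radd rmul] := rI.
have rq : r `<=` q `&` D.
  move=> y ry; have Dy := rD _ ry; split=> //.
  by apply: contrapT => qy; apply: (rS y).
suff tx h : coefs_in A h -> r h.[x] -> coefs_in r h.
  have [] // : (q `&` D) s.
  apply: (@transcendental_fibre_mod _ A D r (q `&` D) x f s hA hD AD Dx DI rP qDP rq tx Af) => //.
    by have [i fi] := nf; exists i => -[/fi].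
  by apply: extension_mono sD => // y [qy Ay]; split=> //; split=> //; exact: AD.
move=> Ah rhx; apply: contrapT => /existsNP[i rhi].
have nz j : ~ r h`_j -> (j <= size h)%N.
  by move=> rj; rewrite leqNgt; apply/negP => sj; apply: rj; rewrite nth_default // ltnW.
have ei : exists j, ~~ `[< r h`_j >] by exists i; apply/asboolPn.
have bi j : ~~ `[< r h`_j >] -> (j <= size h)%N by move/asboolPn/nz.
case: (ex_maxnP ei bi) => n /asboolPn rn nmax.
(* Drop the terms above the last coefficient outside [r]: they have values in [r], and the leading
   coefficient [a] is now outside [r]. *)
pose k := \poly_(j < n.+1) h`_j; set a := h`_n in rn.
have Aa : A a by apply: Ah.
have kn : k`_n = a by rewrite coef_poly ltnSn.
have a0 : a != 0 by apply: contra_notN rn => /eqP ->.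
have sk : size k = n.+1 by apply: size_poly_eq.
have lk : lead_coef k = a by rewrite lead_coefE sk.
have Ak : coefs_in A k.
  by move=> j; rewrite coef_poly; case: ifP => // _; apply: subr_0.
have rkx : r k.[x].
  have -> : k = h - (h - k) by ring.
  rewrite hornerD hornerN; apply: (ideal_sub hD rI) => //.
  rewrite horner_coef; apply: (ideal_sum _ rI) => j _; rewrite mulrC.
  apply: rmul; first exact: subr_X.
  rewrite coefB coef_poly ltnS; case: leqP => [_|nj]; first by rewrite subrr.
  rewrite subr0; apply: contrapT => /asboolPn/nmax; lia.
have [w [N [Dw rw [_ Jw]]]] := rmin _ rkx.
(* The factors k(x) are removed one at a time, each at the cost of a power of [a]. Over the finitely
   many generators this makes some a^M w a conductor element, although neither [a] nor [w] is in
   [r]. *)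
have key M y : D y -> adjoin A x (y * k.[x] ^+ M) -> exists M', adjoin A x (a ^+ M' * y).
  elim: M y => [|M IH] y Dy; first by rewrite expr0 mulr1 => Gy; exists 0%N; rewrite mul1r.
  rewrite exprSr mulrA => -[g Ag gE].
  have k0 : k != 0 by rewrite -size_poly_gt0 sk.
  have Dk : D k.[x] by apply/GD; exists k.
  have Dyk : D (y * k.[x] ^+ M) by apply: subr_M => //; apply: subr_X.
  have [M1] := adjoin_of_relation hA hT AT TA Tx (DT _ Dyk) k0 Ak Ag gE (DI _ Dyk).
  rewrite lk mulrA => /IH[|M2 M2P]; first by apply: subr_M => //; apply: subr_X => //; apply: AD; apply: Ah.
  by exists (M2 + M1)%N; rewrite exprD -mulrA.
have [M MP] : exists M, forall m, m \in ns -> adjoin A x (a ^+ M * w * m).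
  elim: (ns) nsD => [|m ns' IH] ns'D; first by exists 0%N.
  have [|M1 M1P] := IH; first by move=> e ee; apply: ns'D; rewrite inE ee orbT.
  have Dm := ns'D m (mem_head _ _).
  have [||M2 M2P] := key N (w * m); first exact: subr_M.
    by rewrite mulrAC; apply: Jw.
  have Ga e : adjoin A x (a ^+ e) by apply: subr_X => //; apply: adjoin_sub.
  exists (M1 + M2)%N => e; rewrite inE => /predU1P[->|/M1P h1].
    by rewrite exprD -!mulrA; apply: subr_M.
  by rewrite addnC exprD -!mulrA; apply: subr_M => //; rewrite mulrA.
have Da : D a by apply: AD.
have : J (a ^+ M * w).
  split=> [|b /Dns[e [eP ->]]]; first by apply: subr_M => //; apply: subr_X.
  rewrite mulr_sumr; apply: subr_sum_seq => // d /eP[Gd1 /MP Gd2].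
  by rewrite mulrCA; apply: subr_M.
move/Jr/rM => -[]//; first exact: subr_X.
by move/(prime_exp hD rP Da).
Qed.

Definition adjoins A (xs : seq R) := foldr (fun x B => adjoin B x) A xs.

Lemma adjoins_subring A xs : is_subring A -> is_subring (adjoins A xs).
Proof. by move=> hA; elim: xs => //= x xs IH; apply: adjoin_subring. Qed.

Lemma adjoins_sub A xs : is_subring A -> A `<=` adjoins A xs.
Proof.
move=> hA; elim: xs => //= x xs IH a /IH; apply: adjoin_sub; exact: adjoins_subring.
Qed.

Lemma adjoins_gen A xs x : is_subring A -> x \in xs -> adjoins A xs x.
Proof.
move=> hA; elim: xs => //= z zs IH; have hz := adjoins_subring zs hA.
by rewrite inE => /predU1P[->|/IH]; [apply: adjoin_gen|apply: adjoin_sub].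
Qed.

(** By [intg_adjoin_scaled], a power of [u] makes [t] integral over A[ux], which is contained in
    [A]. *)
Lemma denominator_exp A T u x : is_subring A -> is_subring T -> A `<=` T ->
  (forall t, T t -> intg A t -> A t) -> (forall t, T t -> intg (adjoin A x) t) ->
  A u -> A (u * x) -> forall t, T t -> exists N, A (u ^+ N * t).
Proof.
move=> hA hT AT TA TI Au Aux t Tt.
have [K KP] := intg_adjoin_scaled hA Au (TI t Tt); exists K; apply: TA.
  by apply: subr_M => //; apply: subr_X => //; apply: AT.
apply: intg_mono KP; exact: adjoin_min.
Qed.

(** Let [A'] be the integral closure in [T] of the algebra generated by all generators but one. The
    one-variable case makes [A'] and [T] agree after inverting some [u] outside [q], and the
    induction hypothesis applies to [A'] and the restricted prime. *)
Theorem zariski_main A T q (xs : seq R) : is_subring A -> is_subring T ->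
  A `<=` T -> (forall x, x \in xs -> T x) ->
  (forall t, T t -> intg (adjoins A xs) t) -> prime_of T q ->
  (forall x, x \in xs -> quasi_finite_at A T q x) ->
  exists u, [/\ T u, ~ q u, intg A u & forall t, T t -> exists N, intg A (u ^+ N * t)].
Proof.
move=> hA; have hI := intg_subring hA.
elim: xs T q => [|x xs IH] T q hT AT xsT TI qP qf.
  have [_ q1 _] := qP; exists 1; split=> //; first exact: subr_1.
    by apply: intg_id => //; apply: subr_1.
  by move=> t /TI It; exists 0%N; rewrite mul1r.
have [qI q1 qM] := qP; have [_ _ _ qmul] := qI.
pose A1 := adjoins A xs; have hA1 : is_subring A1 by apply: adjoins_subring.
have Tx : T x by apply: xsT; rewrite mem_head.
have A1T : A1 `<=` T.
  have : forall y, y \in xs -> T y by move=> y ys; apply: xsT; rewrite inE ys orbT.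
  rewrite /A1; elim: (xs) => //= y ys IHy ysT; apply: adjoin_min => //.
    by apply: IHy => e eys; apply: ysT; rewrite inE eys orbT.
  by apply: ysT; rewrite mem_head.
pose A' := T `&` intg A1.
have hA' : is_subring A'.
  split; first by split; [apply: subr_1|apply: intg_id => //; apply: subr_1].
  - by move=> y z [Ty Iy] [Tz Iz]; split; [apply: subr_B|apply: intgB].
  - by move=> y z [Ty Iy] [Tz Iz]; split; [apply: subr_M|apply: intgM].
have A'T : A' `<=` T by move=> y [].
have A1A' : A1 `<=` A' by move=> y A1y; split; [apply: A1T|apply: intg_id].
have AA' : A `<=` A' by move=> y Ay; apply/A1A'/adjoins_sub.
have TA' t : T t -> intg A' t -> A' t.
  by move=> Tt It; split=> //; apply: intg_trans It => // b [].
have TI' t : T t -> intg (adjoin A' x) t.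
  move/TI; apply: intg_mono => _ [p Ap ->]; exists p => //; exact: coefs_in_sub Ap.
have [u [A'u qu A'ux]] : exists u, [/\ A' u, ~ q u & A' (u * x)].
  apply: (one_variable hA' hT A'T Tx TA' TI' qP).
  have [s [f [Ts qs Af nf sf]]] := qf x (mem_head _ _).
  exists s, f; split=> //; first exact: coefs_in_sub Af.
  by apply: extension_mono sf => // y [qy /AA' Ay].
have uT := denominator_exp hA' hT A'T TA' TI' A'u A'ux.
have Tu := A'T _ A'u.
have qu' n : ~ q (u ^+ n) by move/(prime_exp hT qP Tu).
have A'X N t : A' t -> A' (u ^+ N * t) by move=> A't; apply: subr_M => //; apply: subr_X.
have [||||v [A'v qv Iv vP]] := IH A' (q `&` A') hA' AA'.
- move=> y ys; split; first by apply: xsT; rewrite inE ys orbT.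
  by apply: intg_id => //; apply: adjoins_gen.
- by move=> t [].
- exact: prime_restrict qP.
- move=> y ys; have [|s [f [Ts qs Af [i fi] [c [cP cE]]]]] := qf y.
    by rewrite inE ys orbT.
  have [N1 N1P] := uT s Ts.
  have [N2 N2P] : exists N, forall d, d \in c -> A' (u ^+ N * d.2).
    elim: (c) cP => [|d c' IHc] c'P; first by exists 0%N.
    have [|N NP] := IHc; first by move=> e ec; apply: c'P; rewrite inE ec orbT.
    have [M MP] := uT d.2 (c'P d (mem_head _ _)).2.
    exists (N + M)%N => e; rewrite inE => /predU1P[->|/NP h].
      by rewrite exprD -mulrA; apply: A'X.
    by rewrite addnC exprD -mulrA; apply: A'X.
  (* A power of [u] moves [s] and all elements witnessing the relation into [A'], so
     quasi-finiteness at [q] passes to [A']. *)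
  exists (u ^+ (N1 + N2) * s), f; split=> //.
  + by rewrite addnC exprD -mulrA; apply: A'X.
  + by move=> [/qM qus _]; case: qus => //; [apply: subr_X|apply: qu'].
  + by exists i => -[/fi].
  exists [seq (d.1, u ^+ (N1 + N2) * d.2) | d <- c]; split.
    move=> _ /mapP[d dc ->] /=; have [[qd Ad] Td] := cP d dc; split.
      by split=> //; split=> //; apply: AA'.
    by rewrite exprD -mulrA; apply: A'X; apply: N2P.
  by rewrite mulrCA cE big_map mulr_sumr; apply: eq_bigr => d _ /=; rewrite mulrCA.
have [N1 N1P] := vP u A'u.
have Tv := A'T _ A'v.
have qv' : ~ q v by move=> qv''; apply: qv.
(* The factor v^N1 makes [u] integral over [A]; the additional [v] supplies the power of [v] that
   makes u^N2 t integral. *)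
pose w := v ^+ N1.+1 * u.
have Iw : intg A w by rewrite /w exprS -mulrA; apply: intgM.
exists w; split=> //.
- by apply: subr_M => //; apply: subr_X.
- by move=> /qM[||/(prime_exp hT qP Tv)|]//; apply: subr_X.
move=> t Tt; have [N2 N2P] := uT t Tt; have [N3 N3P] := vP _ N2P.
exists (N3 + N2)%N.
have -> : w ^+ (N3 + N2) * t =
    (v ^+ N1 * u) ^+ N3 * v ^+ (N1.+1 * N2) * (v ^+ N3 * (u ^+ N2 * t)).
  by rewrite exprD /w exprS !exprMn -!exprM mulSn exprD !exprM; ring.
by apply: intgM => //; apply: intgM => //; apply: subr_X.
Qed.

End ZariskiMainTheorem.

(** * Homogeneous components *)

Section Components.
Variable A : diracRing.
Implicit Types (x y : A) (d e : int).

Lemma zmod_set0 (I : set A) : zmod_closed [in I] -> I 0.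
Proof. by case=> /set_mem. Qed.
Lemma zmod_setB (I : set A) x y : zmod_closed [in I] -> I x -> I y -> I (x - y).
Proof. by case=> _ IB Ix Iy; apply/set_mem/IB; apply/mem_set. Qed.
Lemma zmod_setN (I : set A) x : zmod_closed [in I] -> I x -> I (- x).
Proof. by move=> IZ Ix; rewrite -sub0r; apply: zmod_setB => //; apply: zmod_set0. Qed.
Lemma zmod_setD (I : set A) x y : zmod_closed [in I] -> I x -> I y -> I (x + y).
Proof. by move=> IZ Ix Iy; rewrite -[y]opprK; apply: zmod_setB => //; apply: zmod_setN. Qed.
Lemma zmod_set_closed (I : set A) : I 0 -> (forall x y, I x -> I y -> I (x - y)) ->
  zmod_closed [in I].
Proof. by move=> I0 IB; split=> [|x y]; rewrite !inE //; apply: IB. Qed.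

Let gZ d := gr_zmod (dringP A) d.
Lemma dgr0 d : dgr d (0 : A). Proof. exact: zmod_set0 (gZ d). Qed.
Lemma dgrB d x y : dgr d x -> dgr d y -> dgr d (x - y). Proof. exact: zmod_setB. Qed.
Lemma dgrN d x : dgr d x -> dgr d (- x). Proof. exact: zmod_setN. Qed.
Lemma dgrD d x y : dgr d x -> dgr d y -> dgr d (x + y). Proof. exact: zmod_setD. Qed.
Lemma dgr1 : dgr 0 (1 : A). Proof. exact: gr_one (dringP A). Qed.
Lemma dgrM d e x y : dgr d x -> dgr e y -> dgr (d + e) (x * y).
Proof. by move=> dx ey; apply: (gr_mul (dringP A)). Qed.
Lemma dgr_sum d (I : Type) (r : seq I) (P : pred I) (F : I -> A) :
  (forall i, P i -> dgr d (F i)) -> dgr d (\sum_(i <- r | P i) F i).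
Proof. by move=> H; apply: (big_ind (fun x => dgr d x)) => //; [apply: dgr0|move=> *; apply: dgrD]. Qed.
Lemma dgrX d x n : dgr d x -> dgr (d *+ n) (x ^+ n).
Proof.
move=> dx; elim: n => [|n IH]; first by rewrite mulr0n expr0; apply: dgr1.
by rewrite mulrS exprS; apply: dgrM.
Qed.

Lemma hcomp_exists x : exists f : int -> A, (forall d, dgr d (f d)) /\
  exists s, [/\ uniq s, forall d, d \notin s -> f d = 0 & x = \sum_(d <- s) f d].
Proof.
have [s [c [us cP ->]]] := homog_components x.
exists (fun d => if d \in s then c d else 0); split.
  by move=> d; case: ifP => // _; apply: dgr0.
exists s; split=> //; first by move=> d /negPf ->.
by rewrite big_seq [RHS]big_seq; apply: eq_bigr => d ->.
Qed.

(** A decomposition is chosen for each [x]; by [gr_direct] it is the only one, which is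
    [hcomp_unique]. *)
Definition hcomp d x : A := sval (cid (hcomp_exists x)) d.

Lemma hcomp_gr d x : dgr d (hcomp d x).
Proof. by rewrite /hcomp; case: cid => f /= [fP _]. Qed.

Lemma hcomp_support x : exists s, [/\ uniq s, forall d, d \notin s -> hcomp d x = 0 &
  x = \sum_(d <- s) hcomp d x].
Proof. by rewrite /hcomp; case: cid => f /= [_]. Qed.

Lemma sum_support (s u : seq int) (F : int -> A) : uniq s -> uniq u ->
  {subset s <= u} -> (forall d, d \notin s -> F d = 0) ->
  \sum_(d <- u) F d = \sum_(d <- s) F d.
Proof.
move=> us uu su F0; rewrite (bigID (mem s)) /= [X in _ + X]big1 ?addr0 //.
rewrite -big_filter; apply: perm_big; apply: uniq_perm => //.
  by rewrite filter_uniq.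
move=> d; rewrite mem_filter.
by have [ds|//] := boolP (d \in s); rewrite su.
Qed.

Lemma hcomp_unique x (s : seq int) (c : int -> A) : uniq s ->
  (forall d, dgr d (c d)) -> (forall d, d \notin s -> c d = 0) ->
  x = \sum_(d <- s) c d -> forall d, hcomp d x = c d.
Proof.
move=> us cP c0 xE d; have [t [ut t0 xE']] := hcomp_support x.
pose w := undup (d :: s ++ t).
have E : \sum_(e <- w) (hcomp e x - c e) = 0.
  have tw : {subset t <= w} by move=> e et; rewrite mem_undup inE mem_cat et !orbT.
  have sw : {subset s <= w} by move=> e es; rewrite mem_undup inE mem_cat es !orbT.
  rewrite sumrB (sum_support ut (undup_uniq _) tw t0).
  by rewrite (sum_support us (undup_uniq _) sw c0) -xE -xE' subrr.
have dw : d \in w by rewrite mem_undup mem_head.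
have := gr_direct (dringP A) (undup_uniq _) (fun e => dgrB (hcomp_gr e x) (cP e)) E dw.
by move/eqP; rewrite subr_eq0 => /eqP.
Qed.

Lemma hcomp_homog d e x : dgr d x -> hcomp e x = if e == d then x else 0.
Proof.
move=> dx; apply: (@hcomp_unique x [:: d] (fun k => if k == d then x else 0)) => //.
- by move=> k; case: eqP => [->|_] //; apply: dgr0.
- by move=> k; rewrite inE => /negPf ->.
- by rewrite big_seq1 eqxx.
Qed.

Lemma hcomp_eq d x : dgr d x -> hcomp d x = x.
Proof. by move/hcomp_homog->; rewrite eqxx. Qed.

Lemma hcompD d x y : hcomp d (x + y) = hcomp d x + hcomp d y.
Proof.
have [s [us s0 xE]] := hcomp_support x; have [t [ut t0 yE]] := hcomp_support y.
apply: (@hcomp_unique _ (undup (s ++ t)) (fun e => hcomp e x + hcomp e y)).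
- exact: undup_uniq.
- by move=> e; apply: dgrD; apply: hcomp_gr.
- move=> e; rewrite mem_undup mem_cat negb_or => /andP[es et].
  by rewrite s0 // t0 // addr0.
have tw : {subset t <= undup (s ++ t)} by move=> e et; rewrite mem_undup mem_cat et orbT.
have sw : {subset s <= undup (s ++ t)} by move=> e es; rewrite mem_undup mem_cat es.
by rewrite big_split /= (sum_support us (undup_uniq _) sw s0) (sum_support ut (undup_uniq _) tw t0) -xE -yE.
Qed.

Lemma hcomp0 d : hcomp d (0 : A) = 0.
Proof. by rewrite (hcomp_homog d (dgr0 0)); case: ifP. Qed.

Lemma hcomp_sum d (I : Type) (r : seq I) (P : pred I) (F : I -> A) :
  hcomp d (\sum_(i <- r | P i) F i) = \sum_(i <- r | P i) hcomp d (F i).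
Proof. by apply: (big_morph (hcomp d)); [exact: hcompD|exact: hcomp0]. Qed.

Lemma hcompMl d e y x : dgr e y -> hcomp (e + d) (y * x) = y * hcomp d x.
Proof.
move=> ey; have [s [us s0 xE]] := hcomp_support x.
rewrite {1}xE mulr_sumr hcomp_sum.
under eq_bigr => k _ do rewrite (hcomp_homog _ (dgrM ey (hcomp_gr k x))).
have [ds|ds] := boolP (d \in s); last first.
  rewrite s0 // mulr0 big_seq big1 // => k ks; rewrite ifN //.
  by rewrite (inj_eq (addrI _)); apply: contraNneq ds => ->.
rewrite (bigD1_seq d) //= eqxx big1 ?addr0 // => k kd.
by rewrite ifN // (inj_eq (addrI _)) eq_sym.
Qed.

Lemma hcompMr d e y x : dgr e y -> hcomp (d + e) (x * y) = hcomp d x * y.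
Proof.
move=> ey; have [s [us s0 xE]] := hcomp_support x.
rewrite {1}xE mulr_suml hcomp_sum.
under eq_bigr => k _ do rewrite (hcomp_homog _ (dgrM (hcomp_gr k x) ey)).
have [ds|ds] := boolP (d \in s); last first.
  rewrite s0 // mul0r big_seq big1 // => k ks; rewrite ifN //.
  by rewrite (inj_eq (addIr _)); apply: contraNneq ds => ->.
rewrite (bigD1_seq d) //= eqxx big1 ?addr0 // => k kd.
by rewrite ifN // (inj_eq (addIr _)) eq_sym.
Qed.

Lemma hcomp_ext x y : (forall d, hcomp d x = hcomp d y) -> x = y.
Proof.
move=> xy; have [s [us s0 xE]] := hcomp_support x; have [t [ut t0 yE]] := hcomp_support y.
have tw : {subset t <= undup (s ++ t)} by move=> e et; rewrite mem_undup mem_cat et orbT.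
have sw : {subset s <= undup (s ++ t)} by move=> e es; rewrite mem_undup mem_cat es.
rewrite xE yE -(sum_support us (undup_uniq _) sw s0) -(sum_support ut (undup_uniq _) tw t0).
by apply: eq_bigr => d _.
Qed.

Section GradedIdeal.
Variable I : set A.
Hypothesis gI : graded_ideal I.

Lemma gideal_zmod : zmod_closed [in I]. Proof. by case: gI. Qed.
Lemma gideal0 : I 0. Proof. exact: zmod_set0 gideal_zmod. Qed.
Lemma gidealB x y : I x -> I y -> I (x - y). Proof. exact: zmod_setB gideal_zmod. Qed.
Lemma gidealD x y : I x -> I y -> I (x + y). Proof. exact: zmod_setD gideal_zmod. Qed.
Lemma gidealMl a x : I x -> I (a * x). Proof. by case: gI => _ + _; apply. Qed.
Lemma gideal_sum (K : Type) (r : seq K) (P : pred K) (F : K -> A) :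
  (forall i, P i -> I (F i)) -> I (\sum_(i <- r | P i) F i).
Proof. by move=> H; apply: (big_ind (fun x => I x)) => //; [apply: gideal0|exact: gidealD]. Qed.

Lemma gideal_hcomp d x : I x -> I (hcomp d x).
Proof.
move=> Ix; have [s [us s0 xE]] := hcomp_support x.
have [ds|/s0 ->] := boolP (d \in s); last exact: gideal0.
rewrite xE in Ix.
exact: (graded_ideal_component gI us (fun d => hcomp_gr d x) Ix ds).
Qed.

(** Graded left ideals are two-sided: homogeneous components commute up to sign. *)
Lemma gidealMr a x : I x -> I (x * a).
Proof.
move=> Ix; have [s [us s0 xE]] := hcomp_support x; have [t [ut t0 aE]] := hcomp_support a.
rewrite xE aE mulr_suml; apply: gideal_sum => d _; rewrite mulr_sumr.
apply: gideal_sum => e _.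
rewrite (gr_koszul (dringP A) (hcomp_gr d x) (hcomp_gr e a)).
by apply/gidealMl/gidealMl/gideal_hcomp.
Qed.
End GradedIdeal.

Lemma graded_ideal_intro (I : set A) : I 0 -> (forall x y, I x -> I y -> I (x - y)) ->
  (forall a x, I x -> I (a * x)) -> (forall d x, I x -> I (hcomp d x)) ->
  graded_ideal I.
Proof.
move=> I0 IB IM IC; split=> //; first exact: zmod_set_closed.
move=> x Ix; have [s [us s0 xE]] := hcomp_support x.
exists [seq hcomp d x | d <- s]; last by rewrite big_map.
by move=> _ /mapP[d _ ->]; split; [exists d; apply: hcomp_gr|apply: IC].
Qed.

Definition even_homog x := exists d, dgr d x /\ ~~ odd `|d|.

Lemma even_homogC x y : even_homog x -> x * y = y * x.
Proof.
move=> [d [dx dev]]; have [s [_ _ ->]] := hcomp_support y.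
rewrite mulr_sumr mulr_suml; apply: eq_bigr => e _.
rewrite (gr_koszul (dringP A) dx (hcomp_gr e y)).
by rewrite -signr_odd oddM (negPf dev) mul1r.
Qed.

Lemma even_homog1 : even_homog (1 : A).
Proof. by exists 0; split=> //; apply: dgr1. Qed.

Lemma odd_absD (d e : int) : odd `|d + e| = odd `|d| (+) odd `|e|.
Proof. lia. Qed.

Lemma even_homogM x y : even_homog x -> even_homog y -> even_homog (x * y).
Proof.
move=> [d [dx de]] [e [ey ee]]; exists (d + e); split; first exact: dgrM.
by rewrite odd_absD (negPf de) (negPf ee).
Qed.

Lemma even_homog_sqr x : homog x -> even_homog (x ^+ 2).
Proof.
move=> [d dx]; exists (d + d); split; first by rewrite expr2; apply: dgrM.
by rewrite odd_absD addbb.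
Qed.

(** The component of [y] of degree -d is already a right inverse of [x], hence equal to [y]. *)
Lemma homog_inverse d x y : dgr d x -> x * y = 1 -> y * x = 1 -> dgr (- d) y.
Proof.
move=> dx xy yx; have h : x * hcomp (- d) y = 1.
  by rewrite -(hcompMl _ _ dx) addrN xy (hcomp_eq dgr1).
suff -> : y = hcomp (- d) y by apply: hcomp_gr.
by rewrite -[LHS]mulr1 -h mulrA yx mul1r.
Qed.

End Components.

Lemma dhom_hcomp (A B : diracRing) (f : diracHom A B) d x : f (hcomp d x) = hcomp d (f x).
Proof.
have [s [us s0 xE]] := hcomp_support x; apply/esym.
apply: (@hcomp_unique _ _ s (fun d => f (hcomp d x))) => //.
- by move=> e; apply/dhomP/hcomp_gr.
- by move=> e /s0 ->; rewrite rmorph0.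
- by rewrite {1}xE rmorph_sum.
Qed.

(** * Localizations, residue fields and fibres *)

(** Even denominators are central, so the fraction calculus is the commutative one although [B]
    commutes only up to sign. *)
Definition denominators (B : diracRing) (S : set B) :=
  [/\ S 1, forall s t, S s -> S t -> S (s * t) & forall s, S s -> even_homog s].

(* [l] exhibits [L] as the localization of [B / I] at the even elements [S]. *)
Definition is_fractions (B L : diracRing) (S I : set B) (l : diracHom B L) :=
  [/\ forall s, S s -> dunit (l s),
      forall z, exists x s, S s /\ z * l s = l x,
      forall d z, dgr d z -> exists x s e,
        [/\ S s, dgr e s, dgr (d + e) x & z * l s = l x] &
      forall x, l x = 0 <-> exists s, S s /\ I (s * x)].

(** * Construction of the graded ring of fractions *)

Section FractionRing.
Local Open Scope quotient_scope.
Variables (B : diracRing) (S I : set B).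
Hypotheses (hS : denominators S) (gI : graded_ideal I).

Let S1 : S 1. Proof. by case: hS. Qed.
Let SM s t : S s -> S t -> S (s * t). Proof. by case: hS => _ + _; apply. Qed.
Let SC s x : S s -> s * x = x * s.
Proof. by case: hS => _ _ h /h/even_homogC. Qed.

Definition fpair : Type := (B * {s : B | s \in S})%type.
HB.instance Definition _ := Choice.on fpair.

Definition fden (a : fpair) : B := val a.2.
Lemma fdenP a : S (fden a). Proof. exact/set_mem/(valP a.2). Qed.
Definition mkf (x s : B) (Ss : S s) : fpair := (x, exist _ s (mem_set Ss)).

(** Fractions agree when they can be expanded to a common denominator with numerators congruent
    modulo [I]; the quotient by [I] and the localization are thus taken in one step. *)
Definition feqv (a b : fpair) := exists u v, [/\ S u, S v,
  u * fden a = v * fden b & I (u * a.1 - v * b.1)].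
Definition feq (a b : fpair) : bool := `[< feqv a b >].

Lemma feqv_refl a : feqv a a.
Proof. by exists 1, 1; split=> //; rewrite subrr; apply: gideal0. Qed.

Lemma feqv_sym a b : feqv a b -> feqv b a.
Proof.
move=> [u [v [Su Sv uv Iuv]]]; exists v, u; split=> //.
by rewrite -opprB; apply: zmod_setN (gideal_zmod gI) _.
Qed.

Lemma feqv_trans b a c : feqv a b -> feqv b c -> feqv a c.
Proof.
move=> [u [v [Su Sv uv Iuv]]] [u' [v' [Su' Sv' uv' Iuv']]].
exists (u' * u), (v * v'); split; [exact: SM|exact: SM| |].
  by rewrite -mulrA uv mulrA (SC v Su') -[RHS]mulrA -uv' mulrA.
have -> : u' * u * a.1 - v * v' * c.1 =
    u' * (u * a.1 - v * b.1) + v * (u' * b.1 - v' * c.1).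
  by rewrite !mulrBr !mulrA (SC v Su') addrA subrK.
by apply: gidealD => //; apply: gidealMl.
Qed.

Lemma feq_equiv : equiv_class_of feq.
Proof.
split=> [a|a b|b a c]; first exact/asboolP/feqv_refl.
  by apply/asboolP/asboolP => /feqv_sym.
by move=> /asboolP ab /asboolP bc; apply/asboolP/(feqv_trans ab bc).
Qed.
Canonical feq_equiv_rel := EquivRelPack feq_equiv.

Definition fracring := {eq_quot feq_equiv_rel}.
HB.instance Definition _ := Choice.on fracring.

Definition frac (a : fpair) : fracring := \pi_fracring a.

Lemma fracP a b : frac a = frac b <-> feqv a b.
Proof.
split=> [/eqmodP/asboolP//|ab].
by apply/eqmodP/asboolP.
Qed.

Lemma frac_repr (z : fracring) : frac (repr z) = z.
Proof. exact: reprK. Qed.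

Lemma feqv_repr a : feqv a (repr (frac a)).
Proof. by apply/fracP; rewrite frac_repr. Qed.

Lemma fracW (P : fracring -> Prop) : (forall x s (Ss : S s), P (frac (mkf x Ss))) ->
  forall z, P z.
Proof.
move=> H z; rewrite -(frac_repr z); case: (repr z) => x [s Ss].
by have := H x s (set_mem Ss); rewrite /mkf (bool_irrelevance (mem_set _) Ss).
Qed.

Definition addf (a b : fpair) := mkf (fden b * a.1 + fden a * b.1) (SM (fdenP a) (fdenP b)).
Definition mulf (a b : fpair) := mkf (a.1 * b.1) (SM (fdenP a) (fdenP b)).
Definition oppf (a : fpair) := mkf (- a.1) (fdenP a).

Definition fadd (z w : fracring) := frac (addf (repr z) (repr w)).
Definition fmul (z w : fracring) := frac (mulf (repr z) (repr w)).
Definition fopp (z : fracring) := frac (oppf (repr z)).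

Lemma feqv_addl b a a' : feqv a a' -> feqv (addf a b) (addf a' b).
Proof.
move=> [u [v [Su Sv uv Iuv]]]; exists u, v; split=> //.
  by rewrite /fden /= -!/(fden _) !mulrA uv.
rewrite /= !mulrDr !mulrA uv opprD addrACA subrr addr0.
rewrite -(SC u (fdenP b)) -(SC v (fdenP b)) -!mulrA -mulrBr; exact: gidealMl.
Qed.

Lemma addfC a b : feqv (addf a b) (addf b a).
Proof.
exists 1, 1; split=> //; first by rewrite /fden /= -!/(fden _) (SC _ (fdenP a)).
by rewrite /= !mul1r [X in X - _]addrC subrr; apply: gideal0.
Qed.

Lemma frac_add a b : fadd (frac a) (frac b) = frac (addf a b).
Proof.
apply/fracP/feqv_sym/(feqv_trans (feqv_addl b (feqv_repr a))).
apply: feqv_trans (addfC _ _) _; apply: feqv_trans (addfC _ _).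
exact/feqv_addl/feqv_repr.
Qed.

Lemma frac_mul a b : fmul (frac a) (frac b) = frac (mulf a b).
Proof.
have Ml a1 a2 c : feqv a1 a2 -> feqv (mulf a1 c) (mulf a2 c).
  move=> [u [v [Su Sv uv Iuv]]]; exists u, v; split=> //.
    by rewrite /fden /= -!/(fden _) !mulrA uv.
  by rewrite /= !mulrA -mulrBl; apply: gidealMr.
have Mr a1 a2 c : feqv a1 a2 -> feqv (mulf c a1) (mulf c a2).
  move=> [u [v [Su Sv uv Iuv]]]; exists u, v; split=> //.
    rewrite /fden /= -!/(fden _) !mulrA -(SC u (fdenP c)) -(SC v (fdenP c)).
    by rewrite -!mulrA uv.
  by rewrite /= !mulrA (SC c.1 Su) (SC c.1 Sv) -!mulrA -mulrBr; apply: gidealMl.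
apply/fracP/feqv_sym/(feqv_trans (Ml _ _ b (feqv_repr a))).
exact/Mr/feqv_repr.
Qed.

Lemma frac_opp a : fopp (frac a) = frac (oppf a).
Proof.
apply/fracP/feqv_sym; have [u [v [Su Sv uv Iuv]]] := feqv_repr a.
exists u, v; split=> //; rewrite /= !mulrN -opprD.
by apply: zmod_setN (gideal_zmod gI) _.
Qed.

Lemma fracE x s (Ss : S s) y t (St : S t) u v : S u -> S v ->
  u * s = v * t -> u * x = v * y -> frac (mkf x Ss) = frac (mkf y St).
Proof.
move=> Su Sv us ux; apply/fracP; exists u, v; split=> //=.
by rewrite ux subrr; apply: gideal0.
Qed.

Definition fzero := frac (mkf 0 S1).
Definition fone := frac (mkf 1 S1).

Lemma fadd_mkf x s (Ss : S s) y t (St : S t) : fadd (frac (mkf x Ss)) (frac (mkf y St)) =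
  frac (mkf (t * x + s * y) (SM Ss St)).
Proof. by rewrite frac_add; exact: (fracE _ _ S1 S1). Qed.

Lemma fmul_mkf x s (Ss : S s) y t (St : S t) : fmul (frac (mkf x Ss)) (frac (mkf y St)) =
  frac (mkf (x * y) (SM Ss St)).
Proof. by rewrite frac_mul; exact: (fracE _ _ S1 S1). Qed.

Lemma faddA : associative fadd.
Proof.
move=> z w r; elim/fracW: z => x s Ss; elim/fracW: w => y t St; elim/fracW: r => z r Sr.
rewrite !fadd_mkf; apply: (fracE _ _ S1 S1); rewrite !mul1r ?mulrA // !mulrDr !mulrA addrA.
by rewrite -(SC r St) -(SC r Ss).
Qed.

Lemma faddC : commutative fadd.
Proof. by move=> z w; rewrite -(frac_repr z) -(frac_repr w) !frac_add; apply/fracP/addfC. Qed.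

Lemma fadd0 : left_id fzero fadd.
Proof.
move=> z; elim/fracW: z => x s Ss; rewrite fadd_mkf; apply: (fracE _ _ S1 S1) => //.
  by rewrite !mul1r.
by rewrite mulr0 add0r !mul1r.
Qed.

Lemma faddN : left_inverse fzero fopp fadd.
Proof.
move=> z; elim/fracW: z => x s Ss; rewrite frac_opp frac_add.
by apply: (fracE _ _ S1 (SM Ss Ss)); rewrite ?mul1r ?mulr1 //= mulrN mulr0 addrC subrr.
Qed.

Lemma fmulA : associative fmul.
Proof.
move=> z w r; elim/fracW: z => x s Ss; elim/fracW: w => y t St; elim/fracW: r => z r Sr.
by rewrite !fmul_mkf; apply: (fracE _ _ S1 S1); rewrite !mul1r mulrA.
Qed.

Lemma fmul1l : left_id fone fmul.
Proof.
move=> z; elim/fracW: z => x s Ss; rewrite fmul_mkf.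
by apply: (fracE _ _ S1 S1); rewrite !mul1r.
Qed.

Lemma fmul1r : right_id fone fmul.
Proof.
move=> z; elim/fracW: z => x s Ss; rewrite fmul_mkf.
by apply: (fracE _ _ S1 S1); rewrite !mulr1.
Qed.

Lemma fmulDl : left_distributive fmul fadd.
Proof.
move=> z w r; elim/fracW: z => x s Ss; elim/fracW: w => y t St; elim/fracW: r => z r Sr.
rewrite !(fmul_mkf, fadd_mkf); apply: (fracE _ _ Sr S1).
  by rewrite mul1r !mulrA (SC s Sr).
by rewrite mul1r mulrDl !mulrDr !mulrA (SC t Sr) (SC s Sr).
Qed.

Lemma fmulDr : right_distributive fmul fadd.
Proof.
move=> z w r; elim/fracW: z => x s Ss; elim/fracW: w => y t St; elim/fracW: r => z r Sr.
rewrite !(fmul_mkf, fadd_mkf); apply: (fracE _ _ Ss S1).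
  by rewrite mul1r !mulrA -(mulrA s t s) -(SC t Ss) !mulrA.
rewrite mul1r !mulrDr !mulrA.
by rewrite -!(mulrA s x) -(SC x Sr) -(SC x St) !mulrA.
Qed.

HB.instance Definition _ := GRing.isZmodule.Build fracring faddA faddC fadd0 faddN.
HB.instance Definition _ := GRing.Zmodule_isPzRing.Build fracring
  fmulA fmul1l fmul1r fmulDl fmulDr.

Lemma fracD x s (Ss : S s) y t (St : S t) : frac (mkf x Ss) + frac (mkf y St) =
  frac (mkf (t * x + s * y) (SM Ss St)).
Proof. exact: fadd_mkf. Qed.
Lemma fracM x s (Ss : S s) y t (St : S t) : frac (mkf x Ss) * frac (mkf y St) =
  frac (mkf (x * y) (SM Ss St)).
Proof. exact: fmul_mkf. Qed.
Lemma fracN x s (Ss : S s) : - frac (mkf x Ss) = frac (mkf (- x) Ss).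
Proof.
transitivity (frac (oppf (mkf x Ss))); first exact: frac_opp.
exact: (fracE _ _ S1 S1).
Qed.
Lemma frac0 s (Ss : S s) : frac (mkf 0 Ss) = 0.
Proof. by apply: (fracE _ _ S1 Ss); rewrite ?mul1r ?mulr1 ?mulr0. Qed.
Lemma fracDs x y s (Ss : S s) : frac (mkf (x + y) Ss) = frac (mkf x Ss) + frac (mkf y Ss).
Proof.
by rewrite fracD; apply: (fracE _ _ Ss S1); rewrite !mul1r ?mulrDr.
Qed.
Lemma frac_sum s (Ss : S s) (K : Type) (r : seq K) (F : K -> B) :
  frac (mkf (\sum_(i <- r) F i) Ss) = \sum_(i <- r) frac (mkf (F i) Ss).
Proof.
elim: r => [|i r IH]; first by rewrite !big_nil frac0.
by rewrite !big_cons fracDs IH.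
Qed.

Lemma frac_eq0 x s (Ss : S s) : frac (mkf x Ss) = 0 <-> exists u, S u /\ I (u * x).
Proof.
split=> [/fracP[u [v [Su _ _]]]|[u [Su Iu]]]; first by rewrite mulr0 subr0; exists u.
apply/fracP; exists u, (u * s); split; rewrite ?mulr0 ?subr0 //; first exact: SM.
by rewrite /fden /= mulr1.
Qed.

(** The parity of [e] is recorded so that the Koszul sign of two fractions is that of their
    numerators. *)
Definition fgr (d : int) : set fracring := [set z | exists x s (Ss : S s) e,
  [/\ dgr e s, ~~ odd `|e|, dgr (d + e) x & z = frac (mkf x Ss)]].

Lemma common_homog_denominator (c : int -> fracring) (r : seq int) : (forall d, fgr d (c d)) ->
  exists t (St : S t) e (x : int -> B), [/\ dgr e t, forall d, dgr (d + e) (x d) &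
    forall d, d \in r -> c d = frac (mkf (x d) St)].
Proof.
move=> cP; elim: r => [|d r [t [St [e [x [et xP xE]]]]]].
  exists 1, S1, 0, (fun=> 0); split=> // *; [exact: dgr1|exact: dgr0].
have [y [t' [St' [e' [et' _ dy cE]]]]] := cP d.
exists (t * t'), (SM St St'), (e + e'), (fun k => if k == d then t * y else t' * x k).
split; first exact: dgrM.
- move=> k; case: eqP => [->|_].
    by rewrite addrCA; apply: dgrM.
  by rewrite [e + e']addrC addrCA; apply: dgrM.
move=> k; rewrite inE; case: eqVneq => [->|kd] /=.
  by rewrite cE => _; apply: (fracE _ _ St S1); rewrite !mul1r.
move/xE => ->; apply: (fracE _ _ St' S1); rewrite !mul1r //.
exact: SC.
Qed.

Lemma fracring_dirac : is_dirac fgr.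
Proof.
split.
- move=> d; split=> [|z w]; rewrite !inE.
    by exists 0, 1, S1, 0; split=> //; [apply: dgr1|apply: dgr0].
  move=> [x [s [Ss [e [es ee dx ->]]]]] [y [t [St [k [kt ek dy ->]]]]].
  exists (t * x - s * y), (s * t), (SM Ss St), (e + k); split.
  + exact: dgrM.
  + by rewrite odd_absD (negPf ee) (negPf ek).
  + apply: dgrB; first by rewrite [e + k]addrC addrCA; apply: dgrM.
    by rewrite addrCA; apply: dgrM.
  + by rewrite fracN fracD mulrN.
- by exists 1, 1, S1, 0; split=> //; [apply: dgr1|rewrite addr0; apply: dgr1].
- move=> d d' _ _ [x [s [Ss [e [es ee dx ->]]]]] [y [t [St [k [kt ek dy ->]]]]].
  exists (x * y), (s * t), (SM Ss St), (e + k); split.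
  + exact: dgrM.
  + by rewrite odd_absD (negPf ee) (negPf ek).
  + by rewrite addrACA; apply: dgrM.
  + exact: fracM.
- move=> z; elim/fracW: z => x s Ss; have [r [ur r0 xE]] := hcomp_support x.
  have [_ _ /(_ s Ss)[e [es ee]]] := hS.
  exists [seq frac (mkf (hcomp d x) Ss) | d <- r]; last first.
    by rewrite big_map {1}xE frac_sum.
  move=> _ /mapP[d dr ->]; exists (d - e), (hcomp d x), s, Ss, e; split=> //.
  by rewrite subrK; apply: hcomp_gr.
- move=> r c ur cP; have [t [St [e [x [et xP xE]]]]] := common_homog_denominator r cP.
  rewrite (eq_big_seq _ xE) -frac_sum => /frac_eq0[u [Su Iu]] d dr.
  rewrite xE //; apply/frac_eq0; exists u; split=> //.
  have [_ _ /(_ u Su)[f [fu _]]] := hS.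
  have := gideal_hcomp gI (f + (d + e)) Iu; rewrite (hcompMl _ _ fu) hcomp_sum.
  rewrite (bigD1_seq d) //= (hcomp_eq (xP d)) big1 ?addr0 // => k kd.
  by rewrite (hcomp_homog _ (xP k)) ifN // (inj_eq (addIr _)) eq_sym.
- move=> d d' _ _ [x [s [Ss [e [es ee dx ->]]]]] [y [t [St [k [kt ek dy ->]]]]].
  rewrite !fracM (gr_koszul (dringP B) dx dy) -signr_odd -[in RHS]signr_odd.
  rewrite !oddM !odd_absD (negPf ee) (negPf ek) !addbF !mulr_sign.
  case: ifP => _; rewrite ?fracN; apply: (fracE _ _ S1 S1); rewrite !mul1r //; exact: SC.
Qed.

Definition fractionDirac : diracRing := DiracRing fracring_dirac.

Definition frac_hom (x : B) : fracring := frac (mkf x S1).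

Lemma frac_hom_zmod : zmod_morphism frac_hom.
Proof. by move=> x y; rewrite /frac_hom fracDs -fracN. Qed.

Lemma frac_hom_monoid : monoid_morphism frac_hom.
Proof.
split=> // x y; rewrite /frac_hom fracM.
by apply: (fracE _ _ S1 S1); rewrite !mul1r.
Qed.

HB.instance Definition _ := GRing.isZmodMorphism.Build B fracring frac_hom frac_hom_zmod.
HB.instance Definition _ := GRing.isMonoidMorphism.Build B fracring frac_hom frac_hom_monoid.

Lemma frac_hom_dgr d x : dgr d x -> fgr d (frac_hom x).
Proof.
by move=> dx; exists x, 1, S1, 0; split; rewrite ?addr0 //; apply: dgr1.
Qed.

Definition fraction_hom : diracHom B fractionDirac :=
  @DiracHom B fractionDirac frac_hom frac_hom_dgr.

Lemma exists_fractions : exists (L : diracRing) (l : diracHom B L), is_fractions S I l.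
Proof.
have zs x s (Ss : S s) : frac (mkf x Ss) * frac_hom s = frac_hom x.
  rewrite /frac_hom fracM; apply: (fracE _ _ S1 Ss); first by rewrite mul1r.
  by rewrite mul1r (SC x Ss).
exists fractionDirac, fraction_hom; split.
- move=> s Ss; exists (frac (mkf 1 Ss)); split; last exact: zs.
  transitivity (frac (mkf (s * 1) (SM S1 Ss))); first exact: fracM.
  by apply: (fracE _ _ S1 Ss); rewrite !mulr1 ?mul1r.
- by move=> z; elim/fracW: z => x s Ss; exists x, s.
- by move=> d _ [x [s [Ss [e [es ee dx ->]]]]]; exists x, s, e.
- by move=> x; apply: frac_eq0.
Qed.

End FractionRing.

Lemma exists_diracHom (A B : diracRing) (g : A -> B) : zmod_morphism g ->
  monoid_morphism g -> (forall d x, dgr d x -> dgr d (g x)) ->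
  exists h : diracHom A B, h =1 g.
Proof.
move=> gB gM gd.
pose gz := GRing.isZmodMorphism.Build A B g gB.
pose gm := GRing.isMonoidMorphism.Build A B g gM.
pose gR : {rmorphism A -> B} := HB.pack g gz gm.
by exists (@DiracHom A B gR gd).
Qed.

Lemma dunitM (A : diracRing) (x y : A) : dunit x -> dunit y -> dunit (x * y).
Proof.
move=> [x' [xx' x'x]] [y' [yy' y'y]]; exists (y' * x'); split.
  by rewrite mulrA -(mulrA x) yy' mulr1.
by rewrite mulrA -(mulrA y') x'x mulr1.
Qed.

Lemma dunit_sqr (A : diracRing) (x : A) : dunit (x ^+ 2) -> dunit x.
Proof.
rewrite expr2 => -[y [xxy yxx]]; exists (x * y); split; first by rewrite mulrA.
have -> : x * y = y * x by rewrite -[LHS]mul1r -yxx -!mulrA (mulrA x x y) xxy mulr1.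
by rewrite -mulrA.
Qed.

Lemma dunit_hom (A B : diracRing) (f : diracHom A B) x : dunit x -> dunit (f x).
Proof.
by move=> [y [xy yx]]; exists (f y); rewrite -!rmorphM xy yx rmorph1.
Qed.

Lemma dunit_lreg (A : diracRing) (x y z : A) : dunit x -> x * y = x * z -> y = z.
Proof.
by move=> [x' [_ x'x]] xy; rewrite -[y]mul1r -[z]mul1r -x'x -!mulrA xy.
Qed.

Lemma dunit_rreg (A : diracRing) (x y z : A) : dunit x -> y * x = z * x -> y = z.
Proof.
by move=> [x' [xx' _]] yx; rewrite -[y]mulr1 -[z]mulr1 -xx' !mulrA yx.
Qed.

Section Universal.
Variables (B L : diracRing) (S I : set B) (l : diracHom B L).
Hypotheses (hS : denominators S) (hl : is_fractions S I l).

(** The value at [z] is determined by z l(s) = l(x), because f(s) is a unit; the map is chosen from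
    this relation, and each of its laws follows from uniqueness. *)
Lemma fractions_universal (C : diracRing) (f : diracHom B C) :
  (forall s, S s -> dunit (f s)) -> (forall x, I x -> f x = 0) ->
  exists g : diracHom L C, (forall x, g (l x) = f x) /\
    forall g' : diracHom L C, (forall x, g' (l x) = f x) -> g' =1 g.
Proof.
move=> fS fI; have [S1 SM SE] := hS; have [lS lsurj ldeg l0] := hl.
pose P z w := exists x s, [/\ S s, z * l s = l x & w * f s = f x].
have SC s x : S s -> s * x = x * s by move/SE/even_homogC.
have exP z : exists w, P z w.
  have [x [s [Ss zs]]] := lsurj z; have [t [st ts]] := fS _ Ss.
  by exists (f x * t), x, s; rewrite -mulrA ts mulr1.
have PP z w w' : P z w -> P z w' -> w = w'.
  move=> [x [s [Ss zs ws]]] [y [t [St zt wt]]].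
  have /eqP : l (x * t) = l (y * s).
    by rewrite !rmorphM -zs -zt -!mulrA -!rmorphM (SC s t Ss).
  rewrite -subr_eq0 -rmorphB => /eqP/l0[u [Su /fI]]; rewrite rmorphM.
  rewrite -[RHS](mulr0 (f u)) => /(dunit_lreg (fS _ Su))/eqP.
  rewrite rmorphB subr_eq0 !rmorphM -ws -wt -!mulrA -!rmorphM (SC s t Ss) => /eqP.
  by apply: dunit_rreg; apply: fS; apply: SM.
have [g gP] := choice exP.
have gl x : g (l x) = f x.
  by apply: (PP (l x)) => //; exists x, 1; rewrite !rmorph1 !mulr1.
have [||d z dz|h hg] := @exists_diracHom L C g.
- move=> z w; apply: (PP (z - w)) => //.
  have [[x [s [Ss zs gzs]]] [y [t [St wt gwt]]]] := (gP z, gP w).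
  exists (x * t - y * s), (s * t); split; first exact: SM.
    rewrite rmorphB !rmorphM mulrBl -zs -wt !mulrA; congr (_ - _).
    by rewrite -!mulrA -!rmorphM (SC s t Ss).
  rewrite rmorphB !rmorphM mulrBl -gzs -gwt !mulrA; congr (_ - _).
  by rewrite -!mulrA -!rmorphM (SC s t Ss).
- split; first by rewrite -(rmorph1 l) gl rmorph1.
  move=> z w; apply: (PP (z * w)) => //.
  have [[x [s [Ss zs gzs]]] [y [t [St wt gwt]]]] := (gP z, gP w).
  exists (x * y), (t * s); split; first exact: SM.
    by rewrite !rmorphM mulrA -(mulrA z) wt -zs -!mulrA -!rmorphM (SC s y Ss).
  by rewrite !rmorphM mulrA -(mulrA (g z)) gwt -gzs -!mulrA -!rmorphM (SC s y Ss).
- have [x [s [e [Ss es dx zs]]]] := ldeg _ _ dz; have [t [st ts]] := fS _ Ss.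
  have -> : g z = f x * t.
    apply: (PP z) => //; exists x, s; split=> //.
    by rewrite -mulrA ts mulr1.
  have := dgrM (dhomP f dx) (homog_inverse (dhomP f es) st ts).
  by rewrite addrK.
exists h; split=> [x|g' g'l z]; first by rewrite hg gl.
rewrite hg; apply: (PP z) => //; have [x [s [Ss zs]]] := lsurj z.
by exists x, s; split=> //; rewrite -!g'l -rmorphM zs.
Qed.

End Universal.

Lemma graded_ideal0 (B : diracRing) : graded_ideal [set 0 : B].
Proof.
apply: graded_ideal_intro => [|x y -> ->|a x ->|d x ->] //=.
- by rewrite subrr.
- by rewrite mulr0.
- exact: hcomp0.
Qed.

Section Localization.
Variables (B : diracRing) (S S0 : set B).
Hypotheses (hS : denominators S) (SS0 : S `<=` S0).
Hypothesis S0S : forall s, S0 s -> S (s ^+ 2).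

(** An element whose square is a unit is a unit. So it suffices to invert even elements, although
    the localizations of the statement allow odd ones. *)
Lemma fractions_localization (L : diracRing) (l : diracHom B L) :
  is_fractions S [set 0] l -> is_localization S0 l.
Proof.
move=> hl; have [lS _ _ _] := hl; split.
  by move=> s /S0S/lS; rewrite rmorphXn; apply: dunit_sqr.
move=> C f fS; apply: (fractions_universal hS hl) => [s /SS0/fS //|x ->].
exact: rmorph0.
Qed.

(** Structure sheaves are known only through the universal property; comparing with the constructed
    model shows that every localization consists of fractions. *)
Lemma localization_fractions (L : diracRing) (l : diracHom B L) :
  is_localization S0 l -> is_fractions S [set 0] l.
Proof.
move=> [lS0 luniv].
have [L' [l' hl']] := exists_fractions hS (graded_ideal0 B).
have [lS' lsurj' ldeg' l0'] := hl'.
have [lS0' luniv'] := fractions_localization hl'.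
have [g [gl _]] := luniv L' l' lS0'.
have [g' [g'l _]] := luniv' L l lS0.
have [h [_ hu]] := luniv L l lS0.
have gg z : g' (g z) = z.
  transitivity (h z); last by apply/esym/
      (hu (DiracHom (fun d (x : L) (dx : dgr d x) =>
         dx : dgr d ((idfun : {rmorphism L -> L}) x)))).
  by apply: (hu (dcomp g' g)) => x; rewrite /= gl g'l.
split.
- by move=> s /SS0/lS0.
- move=> z; have [x [s [Ss zs]]] := lsurj' (g z); exists x, s; split=> //.
  by rewrite -[z]gg -g'l -rmorphM zs g'l.
- move=> d z /(dhomP g)/ldeg'[x [s [e [Ss es dx zs]]]]; exists x, s, e; split=> //.
  by rewrite -[z]gg -g'l -rmorphM zs g'l.
- move=> x; rewrite -l0'; split=> [lx|l'x]; first by rewrite -gl lx rmorph0.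
  by rewrite -g'l l'x rmorph0.
Qed.

End Localization.

(** * Residue fields and fibres as rings of fractions *)

Section ExtendedIdeal.
Variables (A B : diracRing) (phi : diracHom A B) (p : set A).
Hypothesis gp : graded_ideal p.

(** The ideal of [B] generated by the image of [p]. Homogeneous summands make it visibly graded, and
    two-sided up to sign. *)
Definition extended_ideal : set B := [set b | exists s : seq B,
  (forall y, y \in s -> exists a c, [/\ p a, homog a, homog c & y = phi a * c]) /\
  b = \sum_(y <- s) y].

Lemma extended_ideal_gen a : p a -> extended_ideal (phi a).
Proof.
move=> pa; have [s [us s0 aE]] := hcomp_support a.
exists [seq phi (hcomp d a) | d <- s]; split; last by rewrite big_map {1}aE rmorph_sum.
move=> _ /mapP[d _ ->]; exists (hcomp d a), 1; split; rewrite ?mulr1 //.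
- exact: gideal_hcomp.
- by exists d; apply: hcomp_gr.
- exact: homog1.
Qed.

Lemma extended_idealD x y : extended_ideal x -> extended_ideal y ->
  extended_ideal (x + y).
Proof.
move=> [s [sP ->]] [t [tP ->]]; exists (s ++ t); split; last by rewrite big_cat.
by move=> y' ; rewrite mem_cat => /orP[/sP|/tP].
Qed.

Lemma extended_ideal_graded : graded_ideal extended_ideal.
Proof.
have E0 : extended_ideal 0 by exists [::]; rewrite big_nil.
have ED := extended_idealD.
have Esum (K : Type) (r : seq K) (F : K -> B) (P : pred K) :
  (forall i, P i -> extended_ideal (F i)) -> extended_ideal (\sum_(i <- r | P i) F i).
  by move=> H; apply: (big_ind (fun x => extended_ideal x)).
have E1 a c : p a -> homog a -> homog c -> extended_ideal (phi a * c).
  move=> pa ha hc; exists [:: phi a * c]; rewrite big_seq1; split=> // y.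
  by rewrite inE => /eqP->; exists a, c.
have EN x : extended_ideal x -> extended_ideal (- x).
  move=> [s [sP ->]]; rewrite -sumrN big_seq; apply: (Esum) => y /sP[a [c [pa ha [d dc] ->]]].
  by rewrite -mulrN; apply: (E1) => //; exists d; apply: dgrN.
apply: graded_ideal_intro => // [x y Ex Ey|b x [s [sP ->]]|d x [s [sP ->]]].
- by apply: ED => //; apply: (EN).
- rewrite mulr_sumr big_seq; apply: (Esum) => y /sP[a [c [pa [d da] [e ec] ->]]].
  have [t [ut t0 bE]] := hcomp_support b; rewrite bE mulr_suml; apply: (Esum) => k _.
  rewrite mulrA (gr_koszul (dringP B) (hcomp_gr k b) (dhomP phi da)) -mulrA.
  rewrite -signr_odd mulr_sign -mulrA; case: ifP => _; first apply: (EN).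
    by apply: (E1) => //; [exists d|exists (k + e); apply: dgrM => //; apply: hcomp_gr].
  by apply: (E1) => //; [exists d|exists (k + e); apply: dgrM => //; apply: hcomp_gr].
- rewrite hcomp_sum big_seq; apply: (Esum) => y /sP[a [c [pa [k ka] [e ec] ->]]].
  rewrite (hcomp_homog _ (dgrM (dhomP phi ka) ec)); case: ifP => // _.
  by apply: (E1) => //; [exists k|exists e].
Qed.

Lemma extended_ideal_min (I : set B) : graded_ideal I -> (forall a, p a -> I (phi a)) ->
  extended_ideal `<=` I.
Proof.
move=> gI pI _ [s [sP ->]]; rewrite big_seq; apply: gideal_sum => // y /sP[a [c [pa _ _ ->]]].
by apply: gidealMr => //; apply: pI.
Qed.
End ExtendedIdeal.

Lemma kernel_graded (A B : diracRing) (f : diracHom A B) :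
  graded_ideal [set x | f x = 0].
Proof.
apply: graded_ideal_intro => [|x y fx fy|a x fx|d x fx] /=.
- exact: rmorph0.
- by rewrite rmorphB fx fy subrr.
- by rewrite rmorphM fx mulr0.
- by rewrite dhom_hcomp fx hcomp0.
Qed.

Lemma ideal_gen_graded (A : diracRing) (G : set A) : graded_ideal (ideal_gen G).
Proof.
apply: graded_ideal_intro => [I gI _|x y Gx Gy I gI GI|a x Gx I gI GI|d x Gx I gI GI].
- exact: gideal0.
- by apply: gidealB => //; [apply: Gx|apply: Gy].
- by apply: gidealMl => //; apply: Gx.
- by apply: gideal_hcomp => //; apply: Gx.
Qed.

Section Fibre.
Variables (A B : diracRing) (phi : diracHom A B) (p : set A).
Hypothesis pP : graded_prime p.

Let gp : graded_ideal p. Proof. by case: pP. Qed.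
Definition even_complement : set A := [set s | even_homog s /\ ~ p s].

Lemma even_homog_homog (R : diracRing) (x : R) : even_homog x -> homog x.
Proof. by move=> [d [dx _]]; exists d. Qed.

Lemma even_complement_denominators : denominators even_complement.
Proof.
have [_ p1 pM] := pP; split.
- by split=> //; apply: even_homog1.
- move=> s t [es ps] [et pt]; split; first exact: even_homogM.
  by case/(pM _ _ (even_homog_homog es) (even_homog_homog et)).
- by move=> s [].
Qed.

Lemma complement_sqr s : homog s /\ ~ p s -> even_complement (s ^+ 2).
Proof.
move=> [hs ps]; split; first exact: even_homog_sqr.
by have [_ _ pM] := pP; rewrite expr2 => /(pM _ _ hs hs)[].
Qed.

Lemma image_denominators (S : set A) : denominators S -> denominators (phi @` S).
Proof.
move=> [S1 SM SE]; split.
- by exists 1; rewrite ?rmorph1.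
- by move=> _ _ [s Ss <-] [t St <-]; exists (s * t); rewrite ?rmorphM //; apply: SM.
- move=> _ [s Ss <-]; have [e [es ee]] := SE _ Ss; exists e; split=> //; exact: dhomP.
Qed.

(** Quasi-finiteness speaks of every model of the residue field and of the fibre; this lemma and the
    next provide models in which vanishing can be read off. *)
Lemma fractions_residue_field (K : diracRing) (k : diracHom A K) :
  is_fractions even_complement p k -> is_residue_field p k.
Proof.
move=> hk; have hS := even_complement_denominators.
have [kS ksurj kdeg k0] := hk.
have [L [l hl]] := exists_fractions hS (graded_ideal0 A).
have [lS lsurj ldeg l0] := hl.
have [||q [qk _]] := fractions_universal hS hl (f := k).
- exact: kS.
- by move=> x ->; rewrite rmorph0.
exists L, l, q; split=> [||a]; last by rewrite qk.
  apply: (fractions_localization hS _ _ hl) => s; last exact: complement_sqr.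
  by move=> [es ps]; split=> //; apply: even_homog_homog.
split=> [z|z].
  have [x [s [Ss zs]]] := ksurj z; have [t [st ts]] := lS _ Ss.
  exists (l x * t); apply: (dunit_rreg (kS _ Ss)).
  by rewrite zs -!qk -rmorphM -mulrA ts mulr1.
have gG := ideal_gen_graded (l @` p); split=> [qz|].
  have [x [s [Ss zs]]] := lsurj z; have [t [st ts]] := lS _ Ss.
  have /k0[u [Su pux]] : k x = 0 by rewrite -qk -zs rmorphM qz mul0r.
  have [w [uw wu]] := lS _ Su.
  have -> : z = w * l (u * x) * t.
    by rewrite rmorphM mulrA wu mul1r -zs -mulrA st mulr1.
  apply: (gidealMr gG); apply: (gidealMl gG) => I gI; apply; by exists (u * x).
move=> /(_ [set z | q z = 0]); apply; first exact: kernel_graded.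
move=> _ [x px <-] /=; rewrite qk; apply/k0; exists 1; split; last by rewrite mul1r.
by have [] := hS.
Qed.

Lemma fractions_pushout (K T : diracRing) (k : diracHom A K) (u : diracHom B T) :
  is_fractions even_complement p k ->
  is_fractions (phi @` even_complement) (extended_ideal phi p) u ->
  exists v : diracHom K T, is_pushout phi k u v.
Proof.
move=> hk hu; have hS := even_complement_denominators.
have hS' := image_denominators hS.
have [kS ksurj kdeg k0] := hk; have [uS usurj udeg u0] := hu.
have kp x : p x -> k x = 0.
  by move=> px; apply/k0; exists 1; rewrite mul1r; split=> //; have [] := hS.
have [||v [vk vu]] := fractions_universal hS hk (f := dcomp u phi).
- by move=> s Ss; apply: uS; exists s.
- move=> x px; apply/u0; exists 1; rewrite mul1r; split; first by have [] := hS'.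
  exact: extended_ideal_gen.
exists v; split=> [a|D b c bc]; first by rewrite vk.
have [||h [hb hU]] := fractions_universal hS' hu (f := b).
- by move=> _ [s Ss <-]; rewrite bc; exact: (dunit_hom c (kS _ Ss)).
- move=> x; apply: (extended_ideal_min (kernel_graded b)) => a pa /=.
  by rewrite bc kp // rmorph0.
exists h; split; last by move=> h' h'b _; apply: hU.
split=> // z; have [||w [_ wU]] := fractions_universal hS hk (f := dcomp c k).
- by move=> s Ss; exact: (dunit_hom c (kS _ Ss)).
- by move=> x px /=; rewrite kp // rmorph0.
rewrite (wU c) // -(wU (dcomp h v)) // => a.
by rewrite /= vk /= hb bc.
Qed.

End Fibre.

(** * Linear dependence over a Dirac field and relations in the fibre *)

Section Dependence.
Variables (K T : diracRing) (v : diracHom K T).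
Hypothesis K1 : (1 : K) <> 0.
Hypothesis KV : forall d (x : K), dgr d x -> x <> 0 ->
  exists y, dgr (- d) y /\ y * x = 1.

(* Steinitz exchange. *)
Lemma homogeneous_dependence n (e : 'I_n -> T) (de : 'I_n -> int)
    (w : 'I_n.+1 -> T) (dw : 'I_n.+1 -> int) :
  (forall i, dgr (de i) (e i)) -> (forall j, dgr (dw j) (w j)) ->
  (forall j, exists c : 'I_n -> K, w j = \sum_i v (c i) * e i) ->
  exists (D : int) (k : 'I_n.+1 -> K), [/\ forall j, dgr (D - dw j) (k j),
    exists j, k j <> 0 & \sum_j v (k j) * w j = 0].
Proof.
elim: n e de w dw => [|n IH] e de w dw eP wP wE.
  exists (dw ord0), (fun=> 1); split=> [j||].
  - by rewrite (ord1 j) subrr; apply: dgr1.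
  - by exists ord0.
  - by rewrite big_ord1; have [c ->] := wE ord0; rewrite big_ord0 mulr0.
have /choice[c cP] j : exists c : 'I_n.+1 -> K,
    (forall i, dgr (dw j - de i) (c i)) /\ w j = \sum_i v (c i) * e i.
  have [c cE] := wE j; exists (fun i => hcomp (dw j - de i) (c i)).
  split=> [i|]; first exact: hcomp_gr.
  rewrite -{1}(hcomp_eq (wP j)) {1}cE hcomp_sum; apply: eq_bigr => i _.
  by rewrite dhom_hcomp -(hcompMr _ _ (eP i)) subrK.
(* A pivot for the last column. If the column is zero, b = 0 satisfies the same identity, and both
   cases continue together. *)
have [l [b [bP bE]]] : exists l b, dgr (- (dw l - de ord_max)) b /\
    forall j, c j ord_max = c j ord_max * b * c l ord_max.
  have [[l cl]|/forallNP h] := pselect (exists l, c l ord_max <> 0).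
    have [b [db bc]] := KV ((cP l).1 ord_max) cl.
    by exists l, b; split=> // j; rewrite -mulrA bc mulr1.
  exists ord0, 0; split=> [|j]; first exact: dgr0.
  by rewrite mulr0 mul0r; apply: contrapT (h j).
pose m j := c (lift l j) ord_max * b.
have mP j : dgr (dw (lift l j) - dw l) (m j).
  have := dgrM ((cP (lift l j)).1 ord_max) bP.
  by rewrite (_ : _ + _ = dw (lift l j) - dw l) //; lia.
have [|||D [k [kP [j0 kj0] kE]]] := IH (fun i => e (widen_ord (leqnSn n) i))
  (fun i => de (widen_ord (leqnSn n) i)) (fun j => w (lift l j) - v (m j) * w l)
  (fun j => dw (lift l j)).
- by move=> i; apply: eP.
- move=> j; apply: dgrB; first exact: wP.
  by have := dgrM (dhomP v (mP j)) (wP l); rewrite subrK.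
- move=> j; exists (fun i => c (lift l j) (widen_ord (leqnSn n) i) -
    m j * c l (widen_ord (leqnSn n) i)).
  rewrite (cP (lift l j)).2 (cP l).2 !big_ord_recr /= mulrDr opprD addrACA.
  rewrite mulrA -rmorphM {1}[c (lift l j) ord_max]bE subrr addr0.
  rewrite mulr_sumr -sumrB; apply: eq_bigr => i _.
  by rewrite rmorphB mulrBl rmorphM !mulrA.
(* The coefficient at the pivot collects the multiples of [w l] that were subtracted from the other
   vectors. *)
exists D, (fun j => if unlift l j is Some i then k i else - \sum_i k i * m i).
split.
- move=> j; case: unliftP => [i ->|->]; first exact: kP.
  apply: dgrN; apply: dgr_sum => i _.
  have := dgrM (kP i) (mP i); rewrite (_ : _ + _ = D - dw l) //; lia.
- by exists (lift l j0); rewrite liftK.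
rewrite (bigD1_ord l) //= unlift_none; 
rewrite [X in _ + X](eq_bigr (fun i => v (k i) * w (lift l i))); last first.
  by move=> i _; rewrite liftK.
rewrite rmorphN mulNr rmorph_sum mulr_suml -[RHS]kE.
under [RHS]eq_bigr do rewrite mulrBr.
rewrite sumrB addrC; congr (_ - _); apply: eq_bigr => i _.
by rewrite rmorphM mulrA.
Qed.

End Dependence.

Section FibreRelation.
Variables (A B : diracRing) (phi : diracHom A B) (p : set A).
Hypothesis pP : graded_prime p.
Let gp : graded_ideal p. Proof. by case: pP. Qed.
Local Notation S := (even_complement p).

(** The numerator of a nonzero homogeneous fraction is outside [p], so its square is an admissible
    denominator. *)
Lemma residue_inverse (K : diracRing) (k : diracHom A K) : is_fractions S p k ->
  forall d (x : K), dgr d x -> x <> 0 -> exists y, dgr (- d) y /\ y * x = 1.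
Proof.
move=> [kS ksurj kdeg k0] d x dx x0.
have [a [s [e [Ss es da xs]]]] := kdeg _ _ dx; have [t [st ts]] := kS _ Ss.
have xE : x = k a * t by rewrite -xs -mulrA st mulr1.
have pa : ~ p a.
  move=> pa; apply: x0; rewrite xE (_ : k a = 0) ?mul0r //; apply/k0.
  by exists 1; rewrite mul1r; split=> //; have [] := even_complement_denominators pP.
have ka : dunit (k a).
  apply: dunit_sqr; rewrite -rmorphXn; apply: kS; apply: complement_sqr => //.
  by split=> //; exists (d + e).
have [y [xy yx]] : dunit x by rewrite xE; apply: dunitM => //; exists (k s).
by exists y; split=> //; apply: homog_inverse xy yx.
Qed.

Lemma clear_denominators (K : diracRing) (k : diracHom A K) n (x : nat -> K) (dx : nat -> int) :
  is_fractions S p k -> (forall j, (j < n)%N -> dgr (dx j) (x j)) ->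
  exists s e (a : nat -> A), [/\ S s, dgr e s,
    forall j, (j < n)%N -> dgr (dx j + e) (a j) &
    forall j, (j < n)%N -> x j * k s = k (a j)].
Proof.
move=> [kS ksurj kdeg k0]; have [S1 SM SE] := even_complement_denominators pP.
elim: n => [|n IH] xP.
  by exists 1, 0, (fun=> 0); split=> //; apply: dgr1.
have [|s [e [a [Ss es da xs]]]] := IH; first by move=> j jn; apply/xP/ltnW.
have [b [t [f [St ft db xt]]]] := kdeg _ _ (xP n (ltnSn n)).
exists (s * t), (e + f), (fun j => if j == n then b * s else a j * t).
split; [exact: SM|exact: dgrM|move=> j jn|move=> j jn].
- case: eqVneq jn => [->|nj]; first by move=> _; rewrite [e + f]addrC addrA; apply: dgrM.
  rewrite ltnS leq_eqVlt (negPf nj) => /da h; rewrite addrA; exact: dgrM.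
- case: eqVneq jn => [->|nj].
    by move=> _; rewrite (even_homogC t (SE _ Ss)) !rmorphM mulrA xt.
  by rewrite ltnS leq_eqVlt (negPf nj) => /xs h; rewrite !rmorphM mulrA h.
Qed.

(* The powers of [y] are dependent over the residue field of [p] in the fibre
   of [phi] at [p]; clear the denominators. *)
Lemma fibre_relation e y : quasi_finite phi -> dgr e y ->
  exists n (a : nat -> A) (D : int), [/\ forall j, (j < n)%N -> dgr (D - e *+ j) (a j),
    exists2 j, (j < n)%N & ~ p (a j) &
    extended_ideal phi p (\sum_(j < n) phi (a j) * y ^+ j)].
Proof.
move=> [_ qf] ey; have hS := even_complement_denominators pP.
have [S1 SM SE] := hS; have hS' := image_denominators phi hS.
have [K [k hk]] := exists_fractions hS gp.
have [T [u hu]] := exists_fractions hS' (extended_ideal_graded phi p).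
have [v hv] := fractions_pushout pP hk hu.
have [ts tsP tsE] := qf p pP K k (fractions_residue_field pP hk) T u v hv.
have [kS ksurj kdeg k0] := hk; have [uS usurj udeg u0] := hu.
have [vu _] := hv.
have K1 : (1 : K) <> 0.
  rewrite -(rmorph1 k) => /k0[s [[es ps] psm]]; apply: ps.
  by rewrite mulr1 in psm.
have /choice[de deP] (i : 'I_(size ts)) : exists d, dgr d ts`_i.
  by apply: tsP; apply: mem_nth.
have [] := @homogeneous_dependence K T v K1 (residue_inverse hk) (size ts)
  (fun i => ts`_i) de (fun j => u y ^+ j) (fun j => e *+ j) deP.
- by move=> j; apply: dgrX; apply: dhomP.
- by move=> j; have [c cE] := tsE (u y ^+ j); exists (fun i : 'I_(size ts) => c i).
move=> D [x [xP [j0 xj0] xE]].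
pose x' j := if insub j is Some i then x i else 0.
have x'E (j : 'I_(size ts).+1) : x' j = x j by rewrite /x' valK.
have [|s [f [a [Ss fs da xs]]]] := @clear_denominators K k (size ts).+1 x' (fun j => D - e *+ j) hk.
  by move=> j jn; have := xP (Ordinal jn); rewrite -x'E.
have uz : u (\sum_(j < (size ts).+1) phi (a j) * y ^+ j) = 0.
  transitivity (v (k s) * \sum_j v (x j) * u y ^+ j); last by rewrite xE mulr0.
  rewrite rmorph_sum mulr_sumr; apply: eq_bigr => j _.
  rewrite rmorphM rmorphXn vu -xs // x'E rmorphM mulrA; congr (_ * _).
  have kE : even_homog (k s).
    by have [g [gs ge]] := SE _ Ss; exists g; split=> //; apply: dhomP.
  by rewrite -!rmorphM (even_homogC (x j) kE).
have /u0[_ [[t St <-] pt]] := uz; have [et pt'] := St.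
have [g [gt ge]] := et.
(* A sum that vanishes in the fibre lies in the extension of [p] after multiplication by some [t]
   outside [p]; this [t] is absorbed into the coefficients. *)
exists (size ts).+1, (fun j => t * a j), (g + (D + f)); split.
- move=> j jn; rewrite -addrA; apply: dgrM => //.
  by rewrite addrAC; apply: da.
- exists j0 => //; have [_ _ pM] := pP => /pM[||//|pa].
  + exact: even_homog_homog.
  + by exists (D - e *+ j0 + f); apply: da.
  have ka : k (a j0) = 0.
    by apply/k0; exists 1; rewrite mul1r; split=> //.
  have [w [sw ws]] := kS _ Ss.
  by apply: xj0; rewrite -x'E -[x' j0]mulr1 -sw mulrA xs // ka mul0r.
- move: pt; rewrite mulr_sumr; congr (extended_ideal _ _ _).
  by apply: eq_bigr => j _; rewrite rmorphM mulrA.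
Qed.

End FibreRelation.

(** * The even part as a commutative ring *)

Section EvenPart.
Variable B : diracRing.
Hypothesis B1 : (1 : B) <> 0.

Definition even_part (x : B) := forall d : int, odd `|d| -> hcomp d x = 0.

Lemma even_part_homog d x : dgr d x -> ~~ odd `|d| -> even_part x.
Proof.
move=> dx de k ko; rewrite (hcomp_homog _ dx) ifN //.
by apply: contraNneq de => <-.
Qed.

Lemma even_part_hcomp d x : even_part x -> even_part (hcomp d x).
Proof.
move=> xe; have [/xe ->|de] := boolP (odd `|d|); first by move=> k _; rewrite hcomp0.
exact: even_part_homog (hcomp_gr d x) de.
Qed.

Lemma hcompN (A : diracRing) d (x : A) : hcomp d (- x) = - hcomp d x.
Proof. by apply/eqP; rewrite -addr_eq0 -hcompD addNr hcomp0. Qed.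

Lemma hcompB (A : diracRing) d (x y : A) : hcomp d (x - y) = hcomp d x - hcomp d y.
Proof. by rewrite hcompD hcompN. Qed.

Lemma even_partC x y : even_part x -> x * y = y * x.
Proof.
move=> xe; have [s [us s0 xE]] := hcomp_support x.
rewrite xE mulr_suml mulr_sumr; apply: eq_bigr => d _.
have [/xe ->|de] := boolP (odd `|d|); first by rewrite mul0r mulr0.
by apply: even_homogC; exists d; split=> //; apply: hcomp_gr.
Qed.

Lemma even_partM x y : even_part x -> even_part y -> even_part (x * y).
Proof.
move=> xe ye d dodd; have [s [us s0 {1}->]] := hcomp_support x.
rewrite mulr_suml hcomp_sum big1 // => e _.
rewrite -[d](subrK e) addrC (hcompMl _ _ (hcomp_gr e x)).
have [/xe ->|ee] := boolP (odd `|e|); first by rewrite mul0r.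
by rewrite ye ?mulr0 // odd_absD abszN dodd (negPf ee).
Qed.

Definition in_even_part : {pred B} := fun x => `[< even_part x >].
Lemma even_part_closed : subring_closed in_even_part.
Proof.
split=> [|x y|x y]; rewrite !unfold_in.
- by apply/asboolP/(even_part_homog (dgr1 B)).
- move=> /asboolP xe /asboolP ye; apply/asboolP => d dodd.
  by rewrite hcompB xe // ye // subrr.
- by move=> /asboolP xe /asboolP ye; apply/asboolP/even_partM.
Qed.

(** The hypothesis is an argument of the type so that the nonzero ring structure can be attached to
    it. *)
Definition even_ring of (1 : B) <> 0 : Type := {x : B | in_even_part x}.
Local Notation R := (even_ring B1).
HB.instance Definition _ := SubType.on R.
HB.instance Definition _ := Choice.on R.
HB.instance Definition _ := GRing.SubChoice_isSubPzRing.Build B in_even_part R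
  even_part_closed.

Lemma even_ring_mulC : commutative (@GRing.mul R).
Proof.
move=> x y; apply: val_inj; rewrite !rmorphM /=; apply: even_partC.
exact/asboolP/(valP x).
Qed.
HB.instance Definition _ := GRing.PzRing_hasCommutativeMul.Build R even_ring_mulC.

Lemma even_ring_neq0 : (1 : R) != 0.
Proof. by apply/eqP => /(congr1 val). Qed.
HB.instance Definition _ := GRing.PzSemiRing_isNonZero.Build R even_ring_neq0.

Lemma exists_even_ring : exists (S : comNzRingType) (v : {rmorphism S -> B}),
  [/\ injective v, forall r, even_part (v r) & forall x, even_part x -> exists r, v r = x].
Proof.
exists (even_ring B1 : comNzRingType), (val : {rmorphism R -> B}); split.
- exact: val_inj.
- by move=> r; apply/asboolP/(valP r).
- by move=> x /asboolP xe; exists (exist (fun x => in_even_part x) x xe).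
Qed.

End EvenPart.

(** * Zariski's main theorem for Dirac rings *)

Section HomogeneousPolynomials.
Variables (B : diracRing) (R : comNzRingType) (v : {rmorphism R -> B}).
Hypotheses (vI : injective v) (vE : forall r, even_part (v r)).
Hypothesis vlift : forall x, even_part x -> exists r, v r = x.
Implicit Types (f g : {poly R}) (k l : int) (r : R).

(* Polynomials homogeneous of degree [- k] when [X] has degree [- 1]; they
   evaluate at [1] to elements of [R], whose homogeneous components are their
   coefficients. *)
Definition hpoly k f := forall j, dgr (j%:Z - k) (v f`_j).

Lemma hpolyM k l f g : hpoly k f -> hpoly l g -> hpoly (k + l) (f * g).
Proof.
move=> kf lg j; rewrite coefM rmorph_sum; apply: dgr_sum => i _; rewrite rmorphM.
have -> : j%:Z - (k + l) = (i : nat)%:Z - k + ((j - i)%N%:Z - l).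
  by have := ltn_ord i; lia.
exact: dgrM.
Qed.

Lemma hpoly1 : hpoly 0 1.
Proof.
move=> j; rewrite coef1; case: eqVneq => [->|_]; first by rewrite rmorph1; apply: dgr1.
by rewrite rmorph0; apply: dgr0.
Qed.

Lemma hpolyX k f n : hpoly k f -> hpoly (k *+ n) (f ^+ n).
Proof.
move=> kf; elim: n => [|n IH]; first by rewrite mulr0n expr0; apply: hpoly1.
by rewrite mulrS exprS; apply: hpolyM.
Qed.

Lemma hpolyD k f g : hpoly k f -> hpoly k g -> hpoly k (f + g).
Proof. by move=> kf kg j; rewrite coefD rmorphD; apply: dgrD. Qed.

Lemma hpoly_sum k (I : Type) (s : seq I) (P : pred I) (F : I -> {poly R}) :
  (forall i, P i -> hpoly k (F i)) -> hpoly k (\sum_(i <- s | P i) F i).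
Proof.
move=> H; apply: (big_ind (hpoly k)) => //; last exact: hpolyD.
by move=> j; rewrite coef0 rmorph0; apply: dgr0.
Qed.

Lemma horner1 f : f.[1] = \sum_(j < size f) f`_j.
Proof. by rewrite horner_coef; apply: eq_bigr => j _; rewrite expr1n mulr1. Qed.

Lemma hpoly_coef k f j : hpoly k f -> v f`_j = hcomp (j%:Z - k) (v f.[1]).
Proof.
move=> kf; rewrite horner1 rmorph_sum hcomp_sum.
under eq_bigr => i _ do rewrite (hcomp_homog _ (kf i)).
have [jf|fj] := ltnP j (size f).
  rewrite (bigD1 (Ordinal jf)) //= eqxx big1 ?addr0 // => i ij.
  rewrite ifN // (inj_eq (addIr _)); apply: contraNneq ij => -[ji].
  by apply/eqP/val_inj.
rewrite nth_default // rmorph0 big1 // => i _; rewrite ifN //.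
rewrite (inj_eq (addIr _)); apply: contraTneq fj => -[->].
by rewrite -ltnNge.
Qed.

Lemma hpoly_eq0 k f : hpoly k f -> f.[1] = 0 -> f = 0.
Proof.
move=> kf f0; apply/polyP => j; apply: vI.
by rewrite (hpoly_coef _ kf) f0 coef0 rmorph0 hcomp0.
Qed.

(** Once [k] bounds the absolute degrees of all components of [r], shifting by [k] makes the
    exponents nonnegative. *)
Lemma exists_hpoly r : exists k0 : nat, forall k : nat, (k0 <= k)%N ->
  exists f, hpoly k f /\ f.[1] = r.
Proof.
have [s [us s0 rE]] := hcomp_support (v r).
exists (\max_(d <- s) `|d|%N) => k sk.
have /choice[c cP] (j : nat) : exists c, v c = hcomp (j%:Z - k%:Z) (v r).
  by apply/vlift/even_part_hcomp.
(* Degrees from -k to k correspond to the 2k + 1 exponents from 0 to 2k. *)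
have cl : hpoly k (\poly_(j < k.*2.+1) c j).
  move=> j; rewrite coef_poly; case: ifP => _; last by rewrite rmorph0; apply: dgr0.
  by rewrite cP; apply: hcomp_gr.
exists (\poly_(j < k.*2.+1) c j); split=> //.
apply: vI; rewrite horner_poly rmorph_sum [RHS]rE.
pose u := [seq j%:Z - k%:Z | j <- index_iota 0 k.*2.+1].
have uu : uniq u.
  by rewrite map_inj_uniq ?iota_uniq // => i j /addIr[].
have su : {subset s <= u}.
  move=> d ds; have dk : (`|d| <= k)%N by apply: leq_trans (leq_bigmax_seq _ ds isT) sk.
  by apply/mapP; exists (absz (d + k%:Z)); [rewrite mem_iota|]; lia.
rewrite -(sum_support us uu su s0) big_map big_mkord.
by apply: eq_bigr => j _; rewrite expr1n mulr1 cP.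
Qed.

End HomogeneousPolynomials.

Lemma odd_abs_mulrn (e : int) n : odd `|e *+ n| = odd `|e| && odd n.
Proof. by rewrite -mulr_natr natz abszM oddM. Qed.

(** * Transfer of the hypotheses to the even part *)

Section CommutativeReduction.
Variables (A B : diracRing) (phi : diracHom A B) (q : spec B).
Variables (R : comNzRingType) (v : {rmorphism R -> B}).
Hypotheses (vI : injective v) (vE : forall r, even_part (v r)).
Hypothesis vlift : forall x, even_part x -> exists r, v r = x.

Let qP : graded_prime (spec_ideal q) := specP q.
Let gq : graded_ideal (spec_ideal q). Proof. by case: qP. Qed.
Let p : set A := phi @^-1` spec_ideal q.
Let pP : graded_prime p := preimage_graded_prime phi q.
Let gp : graded_ideal p. Proof. by case: pP. Qed.

Lemma even_part1 (C : diracRing) : even_part (1 : C).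
Proof. exact: even_part_homog (dgr1 C) _. Qed.

Lemma even_partB (C : diracRing) (x y : C) : even_part x -> even_part y -> even_part (x - y).
Proof. by move=> xe ye d dodd; rewrite hcompB xe // ye // subrr. Qed.

Definition even_base : set R := [set r | exists a, even_part a /\ phi a = v r].
Local Notation A0 := even_base.

Lemma even_base_subring : is_subring A0.
Proof.
split.
- by exists 1; rewrite !rmorph1; split=> //; apply: even_part1.
- move=> r s [a [ae aE]] [b [be bE]]; exists (a - b).
  by rewrite !rmorphB aE bE; split=> //; apply: even_partB.
- move=> r s [a [ae aE]] [b [be bE]]; exists (a * b).
  by rewrite !rmorphM aE bE; split=> //; apply: even_partM.
Qed.
Let hA0 := even_base_subring.

Lemma even_part_hom (C D : diracRing) (f : diracHom C D) x : even_part x -> even_part (f x).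
Proof. by move=> xe d /xe; rewrite -dhom_hcomp => ->; rewrite rmorph0. Qed.

Lemma lift_even_base a : even_part a -> exists2 r, A0 r & v r = phi a.
Proof.
move=> ae; have [r rE] := vlift (even_part_hom phi ae).
by exists r => //; exists a.
Qed.

Lemma even_base_hcomp r s d : A0 r -> v s = hcomp d (v r) -> A0 s.
Proof.
move=> [a [ae aE]] sE; exists (hcomp d a).
by rewrite sE -aE dhom_hcomp; split=> //; apply: even_part_hcomp.
Qed.

Definition even_prime : set R := [set r | spec_ideal q (v r)].
Local Notation q0 := even_prime.

(** Primality of [q] is known for homogeneous elements only. Homogenising both factors gives
    polynomials with homogeneous coefficients, to which Gauss's lemma applies. *)
Lemma even_prime_prime : prime_of setT q0.
Proof.
have [_ q1 qM] := qP.
have qI : ideal_of setT q0.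
  split=> //.
  - by rewrite /q0 /= rmorph0; apply: gideal0.
  - by move=> x y; rewrite /q0 /= rmorphD; apply: gidealD.
  - by move=> a x _; rewrite /q0 /= rmorphM; apply: gidealMl.
split=> //; first by rewrite /q0 /= rmorph1.
move=> r s _ _ rs.
have [k1 H1] := exists_hpoly vI vE vlift r; have [k2 H2] := exists_hpoly vI vE vlift s.
have [f [kf f1]] := H1 (maxn k1 k2) (leq_maxl _ _).
have [g [kg g1]] := H2 (maxn k1 k2) (leq_maxr _ _).
have hT : is_subring [set: R] by split.
have ev1 (h : {poly R}) : (forall i, q0 h`_i) -> q0 h.[1].
  by move=> qh; rewrite horner1; apply: (ideal_sum _ qI) => i _.
have [||qf|qg] := @poly_prime _ setT q0 f g hT qI (fun _ => I) (fun _ => I).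
- move=> i j; rewrite /q0 /= rmorphM; apply: qM.
    by eexists; apply: kf.
  by eexists; apply: kg.
- move=> j; rewrite /q0 /= (hpoly_coef _ (hpolyM kf kg)) hornerM f1 g1.
  exact: gideal_hcomp.
- by left; rewrite -f1; apply: ev1.
- by right; rewrite -g1; apply: ev1.
Qed.

(* Apply [intg_poly_coefs] to a homogeneous polynomial which evaluates to [b]. *)
Lemma intg_hpoly b : intg A0 b -> exists k0 : nat, forall (k : nat) f,
  (k0 <= k)%N -> hpoly v k f -> f.[1] = b -> coefs_in (intg A0) f.
Proof.
move=> [P [mP AP Pb]]; pose n := (size P).-1.
have sP : size P = n.+1 by rewrite prednK // size_poly_gt0 monic_neq0.
have /choice[K KP] i := exists_hpoly vI vE vlift P`_i.
exists (\max_(i < n) K i)%N => k f kk kf fb.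
have kE m : k%:Z *+ m = (k * m)%N%:Z by rewrite -mulr_natr natz PoszM.
(* The coefficient P_i is homogenised in degree k(n-i), so that the whole equation is homogeneous
   and vanishes because its value at 1 does. *)
have /choice[h hP] i : exists h : {poly R}, (i < n)%N ->
    hpoly v (k%:Z *+ (n - i)) h /\ h.[1] = P`_i.
  have [iltn|_] := boolP (i < n)%N; last by exists 0.
  have [|h hh] := KP i (k * (n - i))%N; last by exists h; rewrite kE.
  apply: leq_trans (leq_trans (leq_bigmax (Ordinal iltn)) kk) _.
  by rewrite leq_pmulr // subn_gt0.
have hA i : (i < n)%N -> coefs_in A0 (h i).
  move=> iltn j; have [hi h1] := hP i iltn.
  apply: (even_base_hcomp (AP i)); rewrite (hpoly_coef _ hi) h1 //.
have G0 : f ^+ n + \sum_(i < n) h i * f ^+ i = 0.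
  apply: (hpoly_eq0 vI (k := k%:Z *+ n)).
    apply: hpolyD; first exact: hpolyX.
    apply: hpoly_sum => i _.
    have -> : k%:Z *+ n = k%:Z *+ (n - i) + k%:Z *+ i.
      by rewrite -mulrnDr subnK // ltnW.
    by apply: hpolyM; [case: (hP i (ltn_ord i))|apply: hpolyX].
  transitivity P.[b]; last exact/rootP.
  rewrite hornerD horner_exp fb horner_sum [P.[b]]horner_coef sP big_ord_recr /=.
  rewrite -lead_coefE (monicP mP) mul1r addrC; congr (_ + _); apply: eq_bigr => i _.
  by rewrite hornerM horner_exp fb (hP i (ltn_ord i)).2.
apply: intg_poly_coefs => //.
have hAX := coefs_in_subring hA0.
pose e := \poly_(i < n) h i.
have se : (size e < size ('X^n : {poly {poly R}})%R)%N by rewrite size_polyXn ltnS size_poly.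
exists ('X^n + e); split.
- by rewrite monicE lead_coefDl // lead_coefXn.
- apply: (coefs_inD hAX); first exact: (coefs_inXn hAX).
  move=> i; rewrite coef_poly; case: ifP => [/hA //|_]; exact: (subr_0 hAX).
- by rewrite rootE hornerD hornerXn horner_poly G0.
Qed.

(** Odd summands contribute nothing to the components of an even element, so only the even ones need
    to be in [C]. *)
Lemma additive_even_part (C : set R) (s : seq B) r :
  C 0 -> (forall x y, C x -> C y -> C (x + y)) ->
  (forall y, y \in s -> homog y /\ (even_part y -> exists2 t, v t = y & C t)) ->
  v r = \sum_(y <- s) y -> C r.
Proof.
move=> C0 CD sP rE.
have v0 t : v t = 0 -> C t by move=> t0; rewrite (_ : t = 0) //; apply: vI; rewrite t0 rmorph0.
have comps d t : v t = hcomp d (v r) -> C t.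
  have [dodd|de] := boolP (odd `|d|); first by rewrite vE // => /v0.
  rewrite rE; elim: s sP {rE} t => [|y s IH] sP t.
    by rewrite big_nil hcomp0 => /v0.
  have [u uE Cu] : exists2 u, v u = hcomp d y & C u.
    have [[e ey] yC] := sP y (mem_head _ _); rewrite (hcomp_homog _ ey).
    case: eqVneq => [de'|_]; last by exists 0; rewrite ?rmorph0.
    by apply/yC/(even_part_homog ey); rewrite -de'.
  rewrite big_cons hcompD -uE => tE; rewrite -[t](subrK u); apply: (CD) => //.
  apply: IH => [z zs|]; first by apply: sP; rewrite inE zs orbT.
  by rewrite rmorphB tE addrC addKr.
have [t [ut t0 rE']] := hcomp_support (v r).
have /choice[c cP] d : exists c, v c = hcomp d (v r) by apply/vlift/even_part_hcomp.
have -> : r = \sum_(d <- t) c d.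
  by apply: vI; rewrite rmorph_sum {1}rE'; apply: eq_bigr => d _.
by apply: (big_ind C) => // d _; apply: (comps d).
Qed.

(** Odd generators can only be compared with the even part through squares. Homogeneous elements
    whose square is integral are closed under products, by the Koszul sign, and their sums exhaust
    [B]; an even one is itself integral. *)
Lemma even_ring_integral (ys : seq B) (xs : seq R) :
  (forall y, y \in ys -> homog y) ->
  (forall b, subring_gen (range phi `|` [set y | y \in ys]) b) ->
  (forall y, y \in ys -> exists2 x, x \in xs & v x = y \/ v x = y ^+ 2) ->
  forall r, intg (adjoins A0 xs) r.
Proof.
move=> ysH ysG ysx r; set G := adjoins A0 xs.
have hG : is_subring G by apply: adjoins_subring.
pose good (b : B) := homog b /\ exists2 t, v t = b ^+ 2 & intg G t.
pose P := [set b : B | exists s : seq B, (forall y, y \in s -> good y) /\ b = \sum_(y <- s) y].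
have goodN b : good b -> good (- b).
  move=> [[d db] [t tE It]]; split; first by exists d; apply: dgrN.
  by exists t; rewrite ?sqrrN.
have goodM b c : good b -> good c -> good (b * c).
  move=> [[d db] [t tE It]] [[e ec] [u uE Iu]]; split.
    by exists (d + e); apply: dgrM.
  have bc : (b * c) ^+ 2 = (-1) ^+ (`|e| * `|d|)%N * (b ^+ 2 * c ^+ 2).
    rewrite !expr2 mulrA -(mulrA b c b) (gr_koszul (dringP B) ec db).
    rewrite -signr_odd mulr_sign [RHS]mulr_sign; case: ifP => _;
    by rewrite ?mulrN ?mulNr !mulrA.
  exists ((-1) ^+ (`|e| * `|d|)%N * (t * u)).
    by rewrite bc -tE -uE !rmorphM rmorphXn rmorphN1.
  apply: intgM => //; last exact: intgM.
  by apply: subr_X; [apply: intg_subring|apply: intg_id => //; apply: subr_N => //; apply: subr_1].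
have Pall b : P b.
  apply: (ysG b).
    split=> [|x y|x y]; rewrite !inE.
    - exists [:: 1]; rewrite big_seq1; split=> // y; rewrite inE => /eqP->.
      split; first exact: homog1.
      by exists 1; rewrite ?rmorph1 ?expr1n //; apply: intg_id => //; apply: subr_1.
    - move=> [s [sP ->]] [t [tP ->]]; exists (s ++ map -%R t); split.
        by move=> z; rewrite mem_cat => /orP[/sP //|/mapP[w /tP wt ->]]; apply: goodN.
      by rewrite big_cat big_map sumrN.
    - move=> [s [sP ->]] [t [tP ->]]; exists [seq z * w | z <- s, w <- t]; split.
        by move=> _ /allpairsP[[z w] /= [/sP gz /tP gw ->]]; apply: goodM.
      rewrite big_allpairs_dep mulr_suml; apply: eq_bigr => z _.
      by rewrite mulr_sumr.
  move=> y [[a _ <-]|yy].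
    have [s [us s0 aE]] := hcomp_support a.
    exists [seq phi (hcomp d a) | d <- s]; split; last by rewrite big_map {1}aE rmorph_sum.
    move=> _ /mapP[d _ ->]; split; first by exists d; apply/dhomP/hcomp_gr.
    have [e [de ee]] := even_homog_sqr (ex_intro _ d (hcomp_gr d a)).
    have [t At tE] := lift_even_base (even_part_homog de ee).
    exists t; first by rewrite tE rmorphXn.
    by apply: intg_id => //; apply: adjoins_sub.
  exists [:: y]; rewrite big_seq1; split=> // z; rewrite inE => /eqP->.
  split; first exact: ysH.
  have [x xx xE] := ysx y yy; have Gx : G x by apply: adjoins_gen.
  case: xE => xE; last by exists x => //; apply: intg_id.
  by exists (x ^+ 2); [rewrite rmorphXn xE|apply: intg_id => //; apply: subr_X].
have hI := intg_subring hG.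
have [s [sP rE]] := Pall (v r); apply: (additive_even_part (subr_0 hI) _ _ rE).
  by move=> x y; apply: subr_D.
move=> y /sP[hy [t tE It]]; split=> // /vlift[u uE]; exists u => //.
apply: (@intg_of_exp _ _ _ 2) => //.
by rewrite (_ : u ^+ 2 = t) //; apply: vI; rewrite rmorphXn uE.
Qed.

Let hT : is_subring [set: R]. Proof. by split. Qed.

(** A summand phi(a)c may have odd factors, but up to sign its square is phi(a^2)c^2, a multiple of
    an even element; hence a power is needed. *)
Lemma even_radical r : extended_ideal phi p (v r) ->
  exists N, extension (q0 `&` A0) setT (r ^+ N).
Proof.
have pI := ideal_restrict hA0 (@subsetT _ _) (let: And3 h _ _ := even_prime_prime in h).
have EI : ideal_of setT (extension (q0 `&` A0) setT) by apply: extension_ideal.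
move=> [s [sP rE]]; pose C := [set r | exists N, extension (q0 `&` A0) setT (r ^+ N)].
apply: (@additive_even_part C s r) => //.
- by exists 1%N; rewrite expr1; have [] := EI.
- by move=> x y [N xN] [M yM]; exists (N + M)%N; apply: (radical_add hT EI).
move=> _ /sP[a [c [pa [d da] [e ec] ->]]]; split.
  by exists (d + e); apply: dgrM => //; apply: dhomP.
move/vlift=> [t tE]; exists t => //; exists 2%N.
have [d2 [da2 ed2]] := even_homog_sqr (ex_intro _ d da).
have [al Aal alE] := lift_even_base (even_part_homog da2 ed2).
have [e2 [ec2 ee2]] := even_homog_sqr (ex_intro _ e ec).
have [ga gaE] := vlift (even_part_homog ec2 ee2).
have -> : t ^+ 2 = al * ((-1) ^+ (`|e| * `|d|)%N * ga).
  apply: vI; rewrite !(rmorphXn, rmorphM, rmorphN1) tE alE gaE !expr2.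
  rewrite mulrA -(mulrA (phi a) c) (gr_koszul (dringP B) ec (dhomP phi da)).
  rewrite rmorphM -signr_odd; case: (odd _); rewrite ?expr1 ?expr0;
  by rewrite ?(mulN1r, mul1r, mulrN, mulNr) !mulrA.
exists [:: (al, (-1) ^+ (`|e| * `|d|)%N * ga)]; rewrite big_seq1; split=> // z.
rewrite inE => /eqP-> /=; split=> //; split=> //.
by rewrite /q0 /= alE rmorphXn expr2; apply: gidealMl.
Qed.

Lemma quasi_finite_at_of_relation (f : {poly R}) x : coefs_in A0 f ->
  (exists i, ~ q0 f`_i) -> extended_ideal phi p (v f.[x]) ->
  quasi_finite_at A0 setT q0 x.
Proof.
move=> Af [i fi] /even_radical[N fN]; exists 1, (f ^+ N); split=> //.
- by have [] := even_prime_prime.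
- exact: coefs_in_exp.
- have pP0 := prime_restrict hA0 (@subsetT _ _) even_prime_prime.
  apply: contrapT => /forallNP nf.
  have AfN := coefs_in_exp hA0 N Af.
  have /(prime_exp (coefs_in_subring hA0) (coefs_in_prime hA0 pP0) Af) pf :
      coefs_in (q0 `&` A0) (f ^+ N).
    by move=> j; split; [apply: contrapT; apply: nf|apply: AfN].
  by apply: fi; case: (pf i).
- by rewrite mulr1 horner_exp.
Qed.

(** As [y] is even, all coefficients of the fibre relation have the parity of [D]; multiplying by
    one of them outside [p] makes them even. *)
Lemma even_quasi_finite_at_even y x : quasi_finite phi -> even_homog y -> v x = y ->
  quasi_finite_at A0 setT q0 x.
Proof.
move=> qf [e [ey ee]] xy.
have [n [a [D [da [l ln pal] rel]]]] := fibre_relation pP qf ey.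
have /choice[c cP] j : exists c, A0 c /\ ((j < n)%N -> v c = phi (a l * a j)).
  have [jn|_] := boolP (j < n)%N; last by exists 0; split=> //; apply: subr_0.
  have [|c Ac cE] := @lift_even_base (a l * a j); last by exists c.
  apply: (even_part_homog (dgrM (da l ln) (da j jn))).
  by rewrite !odd_absD !abszN !odd_abs_mulrn (negPf ee) /= !addbF addbb.
apply: (@quasi_finite_at_of_relation (\poly_(j < n) c j)).
- by move=> j; rewrite coef_poly; case: ifP => _; [case: (cP j)|apply: subr_0].
- exists l; rewrite coef_poly ln /q0 /= (cP l).2 // rmorphM.
  have [_ _ qM] := qP => /qM[]; [| |exact: pal|exact: pal];
  by exists (D - e *+ l); apply/dhomP/da.
- rewrite horner_poly rmorph_sum.
  have -> : \sum_(i < n) v (c i * x ^+ i) = phi (a l) * \sum_(j < n) phi (a j) * y ^+ j.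
    rewrite mulr_sumr; apply: eq_bigr => j _.
    by rewrite rmorphM rmorphXn xy (cP j).2 // rmorphM mulrA.
  by apply: gidealMl => //; apply: extended_ideal_graded.
Qed.

(** In odd total degree the terms of the relation anticommute, so its square is the sum of their
    squares: up to signs, a relation in x = y^2 with coefficients phi(a_j)^2. *)
Lemma even_quasi_finite_at_odd e y x : quasi_finite phi -> dgr e y -> odd `|e| ->
  v x = y ^+ 2 -> quasi_finite_at A0 setT q0 x.
Proof.
move=> qf ey eodd xy.
have gE := extended_ideal_graded phi p.
have [n [a [D [da [l ln pal] rel Dodd]]]] : exists n (a : nat -> A) (D : int),
  [/\ forall j, (j < n)%N -> dgr (D - e *+ j) (a j),
    exists2 j, (j < n)%N & ~ p (a j),
    extended_ideal phi p (\sum_(j < n) phi (a j) * y ^+ j) & odd `|D|].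
  have [n [a [D [da [l ln pal] rel]]]] := fibre_relation pP qf ey.
  have [Dodd|De] := boolP (odd `|D|); first by exists n, a, D; split=> //; exists l.
  (* Multiplying the relation by the odd element [y] makes an even total degree odd. *)
  exists n.+1, (fun j => if j is i.+1 then a i else 0), (D + e); split.
  - move=> [_|j jn]; first exact: dgr0.
    by rewrite mulrS opprD addrA addrK; apply: da.
  - by exists l.+1.
  - rewrite big_ord_recl /= rmorph0 mul0r add0r.
    have -> : \sum_(i < n) phi (a i) * y ^+ lift ord0 i =
        (\sum_(j < n) phi (a j) * y ^+ j) * y.
      by rewrite mulr_suml; apply: eq_bigr => i _; rewrite -mulrA -exprSr.
    exact: gidealMr.
  - by rewrite odd_absD (negPf De) eodd.
have aux j : (j < n)%N -> even_part (a j ^+ 2).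
  move=> jn; have [d [dd ed]] := even_homog_sqr (ex_intro (fun d => dgr d (a j)) _ (da j jn)).
  exact: even_part_homog dd ed.
have /choice[c cP] j : exists c, A0 c /\ ((j < n)%N -> v c = phi (a j ^+ 2)).
  have [jn|_] := boolP (j < n)%N; last by exists 0; split=> //; apply: subr_0.
  by have [c Ac cE] := lift_even_base (aux j jn); exists c.
pose b j := odd (`|e *+ j| * `|D - e *+ j|)%N.
have Ab j : A0 ((-1) ^+ b j * c j).
  apply: subr_M => //; last by case: (cP j).
  by apply: subr_X => //; apply: subr_N => //; apply: subr_1.
apply: (@quasi_finite_at_of_relation (\poly_(j < n) ((-1) ^+ b j * c j))).
- by move=> j; rewrite coef_poly; case: ifP => _; [apply: Ab|apply: subr_0].
- exists l; rewrite coef_poly ln /q0 /= mulr_sign => h.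
  have : spec_ideal q (v (c l)).
    move: h; case: (b l) => //; rewrite rmorphN => h.
    by rewrite -[v _]opprK; apply: zmod_setN (gideal_zmod gq) h.
  rewrite (cP l).2 // rmorphXn expr2; have [_ _ qM] := qP.
  by move=> /qM[]; [| |exact: pal|exact: pal];
    exists (D - e *+ l); apply/dhomP/da.
- have sqr (s : seq B) : (forall z, z \in s -> dgr D z) ->
      (\sum_(z <- s) z) ^+ 2 = \sum_(z <- s) z ^+ 2.
    elim: s => [|z s IH] sD; first by rewrite !big_nil expr0n.
    have Dz := sD z (mem_head _ _).
    have Ds : dgr D (\sum_(z <- s) z).
      by rewrite big_seq; apply: dgr_sum => w ws; apply: sD; rewrite inE ws orbT.
    rewrite !big_cons -IH; last by move=> w ws; apply: sD; rewrite inE ws orbT.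
    rewrite !expr2 mulrDl !mulrDr (gr_koszul (dringP B) Ds Dz).
    by rewrite -signr_odd oddM Dodd expr1 mulN1r addrA addrK.
  rewrite horner_poly.
  have -> : v (\sum_(i < n) (-1) ^+ b i * c i * x ^+ i) =
      (\sum_(j < n) phi (a j) * y ^+ j) ^+ 2.
    rewrite -[\sum_(j < n) phi (a j) * _](big_map (fun j : 'I_n => phi (a j) * y ^+ j) xpredT id).
    rewrite sqr; last first.
      move=> _ /mapP[j _ ->]; rewrite -[D](subrK (e *+ j)).
      by apply: dgrM; [apply/dhomP/da|apply: dgrX].
    rewrite big_map rmorph_sum; apply: eq_bigr => j _.
    rewrite !rmorphM !rmorphXn rmorphN1 xy (cP j).2 // rmorphXn !expr2.
    rewrite [RHS]mulrA -[in RHS](mulrA (phi (a j)) (y ^+ j)).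
    rewrite (gr_koszul (dringP B) (dgrX j ey) (dhomP phi (da j (ltn_ord j)))).
    rewrite -[X in phi (a j) * (X * _)]signr_odd -/(b j).
    rewrite exprMn_comm //.
    by case: (b j); rewrite ?expr1 ?expr0 ?(mulN1r, mul1r, mulrN, mulNr) !mulrA.
  by rewrite expr2; apply: gidealMl.
Qed.

(** Take the component of degree nd of an inhomogeneous integral equation. *)
Lemma integral_of_intg w d : dgr d (v w) -> intg A0 w -> integral phi (v w).
Proof.
move=> dw [P [mP AP Pw]]; set y := v w in dw *; pose n := (size P).-1.
have sP : size P = n.+1 by rewrite prednK // size_poly_gt0 monic_neq0.
have /choice[a aP] i : exists a, phi a = v P`_i by have [a [_ aE]] := AP i; exists a.
exists d; split=> //; exists n, (fun i => hcomp (d *+ (n - i)) (a i)).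
split=> [i|]; first exact: hcomp_gr.
transitivity (hcomp (d *+ n) (v P.[w])); last by rewrite (rootP Pw) rmorph0 hcomp0.
rewrite horner_coef sP big_ord_recr /= -/n -lead_coefE (monicP mP) mul1r rmorphD rmorphXn.
rewrite hcompD (hcomp_eq (dgrX n dw)) addrC rmorph_sum hcomp_sum; congr (_ + _).
apply: eq_bigr => i _; rewrite rmorphM rmorphXn -aP -/y.
have -> : d *+ n = d *+ (n - i) + d *+ i by rewrite -mulrnDr subnK // ltnW.
by rewrite (hcompMr _ _ (dgrX i dw)) dhom_hcomp.
Qed.

End CommutativeReduction.

Lemma big_ord_double (V : zmodType) n (F : nat -> V) :
  \sum_(i < n.*2) F i = \sum_(i < n) (F i.*2 + F i.*2.+1).
Proof.
elim: n => [|n IH]; first by rewrite !big_ord0.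
by rewrite doubleS !big_ord_recr /= IH addrA.
Qed.

Lemma integral_of_sqr (A B : diracRing) (phi : diracHom A B) e b : dgr e b ->
  integral phi (b ^+ 2) -> integral phi b.
Proof.
move=> eb [e' [eb' [n [a [aP aE]]]]].
(* Zero is homogeneous of every degree, so only a nonzero square fixes the degree [e'] as 2e. *)
have [b0|b0] := eqVneq (b ^+ 2) 0.
  exists e; split=> //; exists 2%N, (fun=> 0); split=> [i|]; first exact: dgr0.
  by rewrite b0 add0r big1 // => i _; rewrite rmorph0 mul0r.
have ee : e' = e + e.
  apply/eqP; apply: contraNT b0 => ne; rewrite -(hcomp_eq eb').
  by rewrite (hcomp_homog e' (_ : dgr (e + e) _)) ?ifN // expr2; apply: dgrM.
exists e; split=> //; exists n.*2.
pose a' (i : nat) := if odd i then 0 else if insub i./2 is Some j then a j else 0.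
exists (fun i => a' i); split=> [i|].
  rewrite /a'; case: ifP => io; first exact: dgr0.
  case: insubP => [j _ ji|_]; last exact: dgr0.
  have := aP j; rewrite ee mulrnDl -mulrnDr addnn doubleB ji.
  by have := odd_double_half i; rewrite io add0n => ->.
rewrite (big_ord_double _ (fun i => phi (a' i) * b ^+ i)) -[RHS]aE.
rewrite -mul2n exprM; congr (_ + _); apply: eq_bigr => i _.
rewrite /a' /= odd_double /= doubleK valK rmorph0 mul0r addr0.
by rewrite -mul2n exprM.
Qed.

Section SubringGen.
Variables (B : diracRing) (G : set B).

Lemma subring_gen1 : subring_gen G 1.
Proof. by apply/set_mem; have [] := subring_gen_closed G. Qed.
Lemma subring_genB x y : subring_gen G x -> subring_gen G y -> subring_gen G (x - y).
Proof.
by move=> Gx Gy; apply/set_mem; have [_ h _] := subring_gen_closed G; apply: h; apply/mem_set.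
Qed.
Lemma subring_genM x y : subring_gen G x -> subring_gen G y -> subring_gen G (x * y).
Proof.
by move=> Gx Gy; apply/set_mem; have [_ _ h] := subring_gen_closed G; apply: h; apply/mem_set.
Qed.
Lemma subring_genX x n : subring_gen G x -> subring_gen G (x ^+ n).
Proof.
move=> Gx; elim: n => [|n IH]; first by rewrite expr0; apply: subring_gen1.
by rewrite exprS; apply: subring_genM.
Qed.
Lemma subring_gen_gen x : G x -> subring_gen G x.
Proof. by move=> Gx P _; apply. Qed.
Lemma subring_gen0 : subring_gen G 0.
Proof. by rewrite -(subrr 1); apply: subring_genB; apply: subring_gen1. Qed.
Lemma subring_genD x y : subring_gen G x -> subring_gen G y -> subring_gen G (x + y).
Proof.
move=> Gx Gy; rewrite -[y]opprK; apply: subring_genB => //; rewrite -sub0r.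
by apply: subring_genB => //; apply: subring_gen0.
Qed.

End SubringGen.

Lemma integral_base (A B : diracRing) (phi : diracHom A B) a :
  subring_gen (integral phi) (phi a).
Proof.
have [s [us s0 ->]] := hcomp_support a; rewrite rmorph_sum.
apply: (big_ind (subring_gen (integral phi))) => [|x y|d _].
- exact: subring_gen0.
- exact: subring_genD.
apply: subring_gen_gen; exists d; split; first exact/dhomP/hcomp_gr.
exists 1%N, (fun=> - hcomp d a); split=> [i|].
  by rewrite (ord1 i) subn0 mulr1n; apply/dgrN/hcomp_gr.
by rewrite big_ord1 expr0 expr1 mulr1 rmorphN subrr.
Qed.

(** The commutative theorem yields an inhomogeneous [u]. The required [f] is a coefficient outside
    [q] of a homogenisation of a power of [u], and denominators need to be checked on the generators
    only. *)
Theorem zariski_main_dirac (A B : diracRing) (phi : diracHom A B) (q : spec B) :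
  quasi_finite phi -> exists f, [/\ even_homog f, ~ spec_ideal q f,
    subring_gen (integral phi) f &
    forall b, exists N, subring_gen (integral phi) (f ^+ N * b)].
Proof.
move=> qf; have [[ys ysH ysG] _] := qf.
have [gq q1 qM] := specP q.
have B1 : (1 : B) <> 0 by move=> B10; apply: q1; rewrite B10; apply: gideal0.
have [R [v [vI vE vlift]]] := exists_even_ring B1.
pose A0 := even_base phi v; have hA0 : is_subring A0 := even_base_subring phi v.
pose q0 := even_prime q v.
have q0P : prime_of setT q0 := even_prime_prime q vI vE vlift.
have hT : is_subring [set: R] by split.
have /choice[g gP] y : exists x, y \in ys -> (even_homog y /\ v x = y) \/
    exists e, [/\ dgr e y, odd `|e| & v x = y ^+ 2].
  have [/ysH[e ey]|_] := boolP (y \in ys); last by exists 0.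
  have [eo|ee] := boolP (odd `|e|).
    have [d [dd ed]] := even_homog_sqr (ex_intro (fun e => dgr e y) _ ey).
    by have [x xE] := vlift _ (even_part_homog dd ed); exists x; right; exists e.
  by have [x xE] := vlift _ (even_part_homog ey ee); exists x; left; split=> //; exists e.
pose xs := map g ys.
have xI : forall t, setT t -> intg (adjoins A0 xs) t.
  move=> t _; apply: (even_ring_integral vI vE vlift ysH ysG) => y yy.
  exists (g y); first exact: map_f.
  by have [[_ ->]|[e [_ _ ->]]] := gP y yy; [left|right].
have [|u [_ qu Iu uT]] := zariski_main hA0 hT (@subsetT _ _) (fun _ _ => I) xI q0P.
  move=> _ /mapP[y yy ->]; have [[ey vy]|[e [ey eo vy]]] := gP y yy.
    exact: (even_quasi_finite_at_even q vI vE vlift qf ey vy).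
  exact: (even_quasi_finite_at_odd q vI vE vlift qf ey eo vy).
have hI := intg_subring hA0.
(* One exponent for all generators; this is where finite generation is used. *)
have [M MP] : exists M, forall x, x \in xs -> intg A0 (u ^+ M * x).
  elim: (xs) => [|x xs' [M MP]]; first by exists 0%N.
  have [N NP] := uT x I; exists (M + N)%N => z; rewrite inE => /predU1P[->|/MP h].
    by rewrite exprD -mulrA; apply: intgM => //; apply: subr_X.
  by rewrite addnC exprD -mulrA; apply: intgM => //; apply: subr_X.
pose w := u ^+ M.
have Iw : intg A0 w by apply: subr_X.
have qw : ~ q0 w by move/(prime_exp hT q0P I).
have hx x : x \in xs -> exists d, dgr d (v x).
  case/mapP=> y yy ->; have [[[e [ey _]] ->]|[e [ey _ ->]]] := gP y yy; first by exists e.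
  by exists (e *+ 2); apply: dgrX.
(* For [x] of degree d, the product of [f] with the constant [x] is homogeneous of degree k - d and
   has value [w * x] at 1, so [intg_hpoly] makes its coefficients integral. *)
have [K KP] : exists K : nat, forall (k : nat) f, (K <= k)%N -> hpoly v k f -> f.[1] = w ->
    forall x, x \in xs -> coefs_in (intg A0) (f * x%:P).
  elim: (xs) MP hx => [|x xs' IH] MP hx; first by exists 0%N.
  have [||K KP] := IH.
  - by move=> z zx; apply: MP; rewrite inE zx orbT.
  - by move=> z zx; apply: hx; rewrite inE zx orbT.
  have [d dx] := hx x (mem_head _ _).
  have [k0 k0P] := intg_hpoly vI vE vlift (MP x (mem_head _ _)).
  exists (K + k0 + `|d|)%N => k f kK kf fw z; rewrite inE => /predU1P[->|zx]; last first.
    by apply: (KP k) => //; lia.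
  apply: (k0P (absz (k%:Z - d))); first lia.
    move=> j; rewrite coefMC rmorphM.
    have -> : j%:Z - (absz (k%:Z - d))%:Z = j%:Z - k%:Z + d by lia.
    exact: dgrM.
  by rewrite hornerM hornerC fw.
have [k1 k1P] := intg_hpoly vI vE vlift Iw.
have [k2 k2P] := exists_hpoly vI vE vlift w.
have [|f [kf fw]] := k2P (K + k1 + k2)%N; first lia.
have {k1P} If : coefs_in (intg A0) f by apply: (k1P _ _ _ kf) => //; lia.
have {KP} Ifx : forall x, x \in xs -> coefs_in (intg A0) (f * x%:P).
  by apply: (KP _ _ _ kf) => //; lia.
(* Otherwise w = f(1), the sum of the coefficients, would lie in [q]. The degree of this coefficient
   is even because odd components of even elements vanish. *)
have [j qj] : exists j, ~ q0 f`_j.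
  apply: contrapT => /forallNP nq; apply: qw; rewrite -fw horner1.
  by have [qI _ _] := q0P; apply: (ideal_sum _ qI) => i _; apply: contrapT; apply: nq.
have jE := kf j; set d := (_ - _) in jE.
have de : ~~ odd `|d|.
  apply/negP => dodd; apply: qj; rewrite /q0 /even_prime /= -(hcomp_eq jE) vE //.
  exact: gideal0.
have fe : even_homog (v f`_j) by exists d.
have fG : subring_gen (integral phi) (v f`_j).
  by apply: subring_gen_gen; apply: (integral_of_intg jE); apply: If.
have fC x n : v f`_j ^+ n * x = x * v f`_j ^+ n.
  elim: n => [|n IH]; first by rewrite expr0 mul1r mulr1.
  by rewrite exprS -mulrA IH mulrA (even_homogC x fe) -mulrA.
exists (v f`_j); split=> // b.
apply: (ysG b [set b | exists N, subring_gen (integral phi) (v f`_j ^+ N * b)]).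
  split=> [|x y|x y]; rewrite !inE.
  - by exists 0%N; rewrite mulr1; apply: subring_gen1.
  - move=> [N NP] [N' NP']; exists (N + N')%N; rewrite mulrBr; apply: subring_genB.
      by rewrite addnC exprD -mulrA; apply: subring_genM => //; apply: subring_genX.
    by rewrite exprD -mulrA; apply: subring_genM => //; apply: subring_genX.
  - move=> [N NP] [N' NP']; exists (N + N')%N.
    rewrite exprD -mulrA [_ * (x * y)]mulrA [_ ^+ N' * x]fC -[x * _ * y]mulrA mulrA.
    exact: subring_genM.
move=> y [[a _ <-]|yy].
  by exists 0%N; rewrite mul1r; apply: integral_base.
exists 1%N; rewrite expr1; apply: subring_gen_gen.
have [[[e [ey _]] vy]|[e [ey eo vy]]] := gP y yy.
  rewrite -vy -rmorphM; apply: integral_of_intg.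
    by rewrite rmorphM vy; apply: dgrM jE ey.
  by have := Ifx _ (map_f g yy) j; rewrite coefMC.
(* For an odd generator only y^2 has been treated; the square of f_j y is f_j times the integral
   element f_j y^2. *)
apply: (integral_of_sqr (dgrM jE ey)).
have -> : (v f`_j * y) ^+ 2 = v (f`_j * (f`_j * g y)).
  rewrite !rmorphM vy !expr2 !mulrA; congr (_ * _).
  by rewrite -mulrA -(even_homogC y fe) mulrA.
apply: integral_of_intg.
  rewrite !rmorphM vy; apply: dgrM jE (dgrM jE (dgrX 2 ey)).
apply: intgM => //.
by have := Ifx _ (map_f g yy) j; rewrite coefMC.
Qed.

(** * Open immersions of Dirac spectra *)

Lemma spec_eq (A : diracRing) (p q : spec A) : spec_ideal p = spec_ideal q -> p = q.
Proof.
by case: p q => I pI [J pJ] /= IJ; rewrite -IJ in pJ *; congr Spec; apply: Prop_irrelevance.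
Qed.

Lemma opens_eq (X : topologicalType) (U V : opens X) : U = V :> set X -> U = V.
Proof.
by case: U V => U oU [V oV] /= UV; rewrite -UV in oV *; congr Opens; apply: Prop_irrelevance.
Qed.

Lemma sheaf_ext (X : topologicalType) (F : presheaf X) (K : Type) (U : opens X)
    (V : K -> opens X) (VU : forall k, V k `<=` U) d (s t : F U) :
  is_sheaf F -> U `<=` \bigcup_k V k -> dgr d s -> dgr d t ->
  (forall k, res F (VU k) s = res F (VU k) t) -> s = t.
Proof.
move=> FP cov ds dt st.
have [||r [_ rU]] := FP _ _ _ VU cov d (fun k => res F (VU k) s).
- by move=> k; apply: dhomP.
- move=> k l W Wk Wl; have WU : W `<=` U by move=> p /Wk/VU.
  transitivity (res F WU s); first exact: res_comp.
  exact/esym/res_comp.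
by rewrite -(rU s) // -(rU t) //; split=> // k; rewrite st.
Qed.

Lemma even_homog_is_homog (A : diracRing) (f : A) : even_homog f -> homog f.
Proof. by move=> [d [dd _]]; exists d. Qed.

Lemma even_homogX (A : diracRing) (f : A) n : even_homog f -> even_homog (f ^+ n).
Proof.
move=> ef; elim: n => [|n IH]; first by rewrite expr0; apply: even_homog1.
by rewrite exprS; apply: even_homogM.
Qed.

Lemma spec_hcomp (A : diracRing) (p : spec A) x :
  (forall d, spec_ideal p (hcomp d x)) -> spec_ideal p x.
Proof.
have [gp _ _] := specP p.
by have [s [_ _ {2}->]] := hcomp_support x => h; apply: (gideal_sum gp).
Qed.

(** Primality is applied to each component of [x], which need not be homogeneous. *)
Lemma spec_cancel (A : diracRing) (p : spec A) f x : homog f -> ~ spec_ideal p f ->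
  spec_ideal p (f * x) -> spec_ideal p x.
Proof.
move=> [e ef] pf pfx; have [gp _ pM] := specP p; apply: spec_hcomp => d.
have : spec_ideal p (f * hcomp d x) by rewrite -(hcompMl _ _ ef); apply: gideal_hcomp.
by case/pM => //; [exists e|exists d; apply: hcomp_gr].
Qed.

Lemma spec_exp (A : diracRing) (p : spec A) f n : homog f -> ~ spec_ideal p f ->
  ~ spec_ideal p (f ^+ n).
Proof.
move=> hf pf; elim: n => [|n IH]; first by rewrite expr0; case: (specP p).
by rewrite exprS => /(spec_cancel hf pf).
Qed.

Lemma diracHom_inj_dgr (A B : diracRing) (f : diracHom A B) d x : injective f ->
  dgr d (f x) -> dgr d x.
Proof.
move=> fI dx; rewrite (_ : x = hcomp d x); first exact: hcomp_gr.
by apply: fI; rewrite dhom_hcomp hcomp_eq.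
Qed.

(** For injective [i], this makes the map from C[1/h] to B[1/h] an isomorphism. *)
Definition isolating (C B : diracRing) (i : diracHom C B) (h : C) :=
  even_homog h /\ forall b, exists N c, i c = i h ^+ N * b.

(** * The map of spectra is an open embedding *)

Section LocalIso.
Variables (C B : diracRing) (i : diracHom C B).
Hypothesis iI : injective i.
Hypothesis iloc : forall q : spec B, exists2 h, isolating i h & ~ spec_ideal q (i h).

Lemma isolatingM h c : isolating i h -> even_homog c -> isolating i (h * c).
Proof.
move=> [eh hP] ec; split; first exact: even_homogM.
move=> b; have [N [c' c'E]] := hP b; exists N, (c ^+ N * c').
rewrite (even_homogC c eh) -rmorphXn exprMn_comm; last exact: (even_homogC _ ec).
by rewrite !rmorphM c'E mulrA !rmorphXn.
Qed.

Lemma spec_map_sub q1 q2 : spec_map i q1 = spec_map i q2 ->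
  spec_ideal q1 `<=` spec_ideal q2.
Proof.
move=> q12 b qb; have [h [eh hP] qh] := iloc q2.
have E c : spec_ideal q1 (i c) = spec_ideal q2 (i c).
  by have := congr1 (fun p => spec_ideal p c) q12.
have [N [c cE]] := hP b.
have hih : homog (i h) by have [d dh] := even_homog_is_homog eh; exists d; apply: dhomP.
have hihN : homog (i h ^+ N) by have [d dh] := hih; exists (d *+ N); apply: dgrX.
apply: (spec_cancel hihN (spec_exp hih qh)).
rewrite -cE -E cE; have [gq _ _] := specP q1.
exact: gidealMl.
Qed.

Lemma spec_map_inj : injective (spec_map i).
Proof.
move=> q1 q2 q12; apply/spec_eq/seteqP; split; first exact: spec_map_sub.
by apply: spec_map_sub.
Qed.

(** The prime of [B] over [p] consists of those [b] that some power of [h] moves into [p], as it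
    would in B[1/h]. *)
Lemma spec_map_lift h (p : spec C) : isolating i h -> ~ spec_ideal p h ->
  exists q : spec B, spec_map i q = p.
Proof.
move=> [eh hP] ph; have [gp p1 pM] := specP p.
have hh := even_homog_is_homog eh.
have hhX n : homog (h ^+ n) by apply/even_homog_is_homog/even_homogX.
have phX n := @spec_exp _ p h n hh ph.
have iC n x : i h ^+ n * x = x * i h ^+ n.
  rewrite -rmorphXn; apply: even_homogC.
  by have [d [dd de]] := even_homogX n eh; exists d; split=> //; apply: dhomP.
pose Q : set B := [set b | exists N c, i c = i h ^+ N * b /\ spec_ideal p c].
have gQ : graded_ideal Q.
  apply: graded_ideal_intro.
  - by exists 0%N, 0; rewrite rmorph0 mulr0; split=> //; apply: gideal0.
  - move=> x y [N [c [cE pc]]] [M [c' [cE' pc']]].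
    exists (N + M)%N, (h ^+ M * c - h ^+ N * c'); split.
      by rewrite mulrBr rmorphB !rmorphM !rmorphXn cE cE' !mulrA -!exprD (addnC M).
    by apply: gidealB => //; apply: gidealMl.
  - move=> a x [N [c [cE pc]]]; have [M [a' aE]] := hP a.
    exists (M + N)%N, (a' * c); split; last exact: gidealMl.
    by rewrite rmorphM aE cE exprD -!mulrA; congr (_ * _); rewrite !mulrA iC.
  - move=> d x [N [c [cE pc]]]; have [e eh'] := hhX N.
    exists N, (hcomp (e + d) c); split; last exact: gideal_hcomp.
    by rewrite dhom_hcomp cE -rmorphXn (hcompMl _ _ (dhomP i eh')).
have pQ : graded_prime Q.
  split=> //.
    move=> [N [c [cE pc]]]; apply: (phX N).
    by rewrite mulr1 -rmorphXn in cE; rewrite -(iI cE).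
  move=> x y [d dx] [e ey] [N [c [cE pc]]].
  have [M [a aE]] := hP x; have [K [b bE]] := hP y.
  have [l lh] := hh.
  have hg z n k w : dgr k z -> i w = i h ^+ n * z -> homog w.
    move=> kz wE; exists (l *+ n + k); apply: (diracHom_inj_dgr iI).
    by rewrite wE; apply: dgrM => //; apply/dgrX/dhomP.
  have : spec_ideal p (h ^+ N * (a * b)).
    have -> : h ^+ N * (a * b) = h ^+ (M + K) * c.
      apply: iI; rewrite !rmorphM !rmorphXn cE aE bE.
      by rewrite !mulrA -[i h ^+ N * _ * _ * _]mulrA -(iC K) mulrA -!exprD addnC addnA (addnC M K) addnAC.
    exact: gidealMl.
  move/(spec_cancel (hhX N) (phX N))/pM => [||pa|pb].
  - exact: hg dx aE.
  - exact: hg ey bE.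
  - by left; exists M, a.
  - by right; exists K, b.
exists (Spec pQ); apply/spec_eq/seteqP; split=> c /=.
  move=> [N [c' [cE pc']]]; apply: (spec_cancel (hhX N) (phX N)).
  by rewrite -rmorphXn -rmorphM in cE; rewrite -(iI cE).
by move=> pc; exists 0%N, c; rewrite mul1r.
Qed.

Lemma isolating_basis (V : set (spec B)) q : open V -> V q ->
  exists h, [/\ isolating i h, ~ spec_ideal q (i h) & spec_map i @^-1` nonvanishing h `<=` V].
Proof.
rewrite open_specE => oV /oV[g [hg qg gV]].
have [f hf qf] := iloc q; have [ef fP] := hf.
have [N [c cE]] := fP (g ^+ 2).
have [d [dg de]] := even_homog_sqr hg.
have [e [fe ee]] := even_homogX N ef.
have cg : dgr (e + d) c.
  by apply: (diracHom_inj_dgr iI); rewrite cE; apply: dgrM => //; rewrite -rmorphXn; apply: dhomP.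
have ec : even_homog c by exists (e + d); split=> //; rewrite odd_absD (negPf de) addbF.
(* The image of fc is f^(N+1) g^2: outside [q], and in every prime that contains [g]. The square of
   [g] is taken because [c] must be even. *)
exists (f * c); split; first exact: isolatingM.
  have hif : homog (i f) by have [k kf] := even_homog_is_homog ef; exists k; apply: dhomP.
  have hifN : homog (i f ^+ N).
    by have [k kf] := hif; exists (k *+ N); apply: dgrX.
  rewrite rmorphM cE => /(spec_cancel hif qf)/(spec_cancel hifN (spec_exp hif qf)).
  exact: spec_exp.
move=> q' /= q'fc; apply: gV => q'g; apply: q'fc => /=.
rewrite rmorphM cE; have [gq' _ _] := specP q'; do 2 apply: gidealMl => //.
by rewrite expr2; apply: gidealMl.
Qed.

Lemma spec_map_open V : open V -> open (spec_map i @` V).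
Proof.
move=> oV; rewrite open_specE => _ [q Vq <-].
have [h [hh qh hV]] := isolating_basis oV Vq; exists h; split=> //.
  by case: hh => /even_homog_is_homog.
move=> p ph; have [q' q'p] := spec_map_lift hh ph.
by exists q' => //; apply: hV; rewrite /preimage /= q'p.
Qed.

(** * Comparison of the structure sheaves *)

Section Sheaves.
Variables (OX : structureSheaf C) (OY : structureSheaf B) (j : specMorphism i OX OY).

Local Notation pre := (opens_preimage (@spec_map_continuous C B i)).

Let preS (U V : opens (spec C)) (VU : V `<=` U) : pre V `<=` pre U :=
  fun q Vq => VU (spec_map i q) Vq.

Lemma smap_sglobal (U : opens (spec C)) (c : C) :
  smap j U (res OX (@opensT_sub _ U) (sglobal OX c)) =
  res OY (@opensT_sub _ (pre U)) (sglobal OY (i c)).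
Proof.
rewrite (smap_natural j _ (preS (@opensT_sub _ U))) smap_global.
exact: res_comp.
Qed.

(** Both rings of sections consist of fractions with powers of [h] as denominators, and b/h^n equals
    c/h^(N+n) as soon as i(c) = h^N b. *)
Lemma smap_isolating h (hh : homog h) : isolating i h ->
  bijective (smap j (basic_open hh)).
Proof.
move=> hi; have [eh hP] := hi.
have ih : even_homog (i h) by have [d [dd de]] := eh; exists d; split=> //; apply: dhomP.
have hih := even_homog_is_homog ih.
have frac (D : diracRing) (f : D) : even_homog f -> denominators (powers f).
  move=> ef; split; first by exists 0%N.
    by move=> _ _ [n ->] [m ->]; exists (n + m)%N; rewrite exprD.
  by move=> _ [n ->]; apply: even_homogX.
have powS (D : diracRing) (f : D) s : powers f s -> powers f (s ^+ 2).
  by move=> [n ->]; exists (n * 2)%N; rewrite exprM.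
have := localization_fractions (frac _ _ eh) (@subset_refl _ _) (@powS _ h) (sglobal_loc OX hh).
have preE : pre (basic_open hh) = basic_open hih by apply: opens_eq.
have : is_localization (powers (i h))
    (dcomp (res OY (@opensT_sub _ (pre (basic_open hh)))) (sglobal OY)).
  by rewrite preE; apply: sglobal_loc.
move/(localization_fractions (frac _ _ ih) (@subset_refl _ _) (@powS _ (i h))).
set l := dcomp _ _; set l' := dcomp _ _.
move=> [lu lf _ l0] [lu' lf' _ l0'].
have sl c : smap j (basic_open hh) (l' c) = l (i c) by apply: smap_sglobal.
have inj0 s : smap j (basic_open hh) s = 0 -> s = 0.
  move=> s0; have [c [_ [[n ->] sc]]] := lf' s.
  have /l0[_ [[m ->] /= hc]] : l (i c) = 0 by rewrite -sl -sc rmorphM s0 mul0r.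
  have /l0' c0 : exists t, powers h t /\ [set 0] (t * c).
    exists (h ^+ m); split; first by exists m.
    by apply: iI; rewrite rmorphM rmorphXn hc rmorph0.
  apply: (dunit_rreg (lu' (h ^+ n) _)); first by exists n.
  by rewrite sc c0 mul0r.
have injs : injective (smap j (basic_open hh)).
  by move=> s t st; apply/eqP; rewrite -subr_eq0; apply/eqP/inj0; rewrite rmorphB st subrr.
have surj t : exists s, smap j (basic_open hh) s = t.
  have [b [_ [[n ->] tb]]] := lf t; have [N [c cE]] := hP b.
  have [y [hy yh]] := lu' (h ^+ (N + n)) (ex_intro _ _ erefl).
  exists (y * l' c); apply: (dunit_lreg (lu (i h ^+ (N + n)) _)); first by exists (N + n)%N.
  have -> : l (i h ^+ (N + n)) = smap j (basic_open hh) (l' (h ^+ (N + n))).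
    by rewrite sl (rmorphXn i).
  rewrite -[LHS]rmorphM mulrA hy mul1r sl cE sl (rmorphXn i) exprD !rmorphM -mulrA -tb.
  congr (_ * _); apply/esym/even_homogC.
  by have [d [dd de]] := even_homogX n ih; exists d; split=> //; apply: dhomP.
by have [g gP] := choice surj; exists g => // s; apply: injs; rewrite gP.
Qed.

Lemma isolating_cover (U : opens (spec C)) : U `<=` range (spec_map i) ->
  exists (K : Type) (h : K -> C) (hh : forall k, homog (h k)),
  [/\ forall k, isolating i (h k), forall k, basic_open (hh k) `<=` U &
      U `<=` \bigcup_k basic_open (hh k)].
Proof.
move=> Ui; pose K := {h : C | isolating i h /\ nonvanishing h `<=` U}.
have hh (k : K) : homog (sval k) by have [[/even_homog_is_homog]] := svalP k.
exists K, sval, hh; split=> [k|k|p Up]; [by have [] := svalP k|by have [] := svalP k|].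
have [q _ qp] := Ui p Up.
have [|h [hi qh hU]] := isolating_basis (osetP (pre U)) (q := q); first by rewrite /= qp.
have hU' : nonvanishing h `<=` U.
  move=> p' p'h; have [q' q'p] := spec_map_lift hi p'h.
  by rewrite -q'p; apply: hU; rewrite /= q'p.
by exists (exist _ h (conj hi hU')) => //=; rewrite -qp.
Qed.

(** The sheaf condition concerns homogeneous sections, so components are compared one degree at a
    time. *)
Lemma smap_inj (U : opens (spec C)) : U `<=` range (spec_map i) -> injective (smap j U).
Proof.
move=> Ui s t st; apply: hcomp_ext => d.
have [K [h [hh [hi VU cov]]]] := isolating_cover Ui.
apply: (sheaf_ext (VU := VU) (@ssheafP _ OX) cov (hcomp_gr d s) (hcomp_gr d t)) => k.
apply: (bij_inj (smap_isolating (hh k) (hi k))).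
by rewrite !(smap_natural j (VU k) (preS (VU k))) !dhom_hcomp st.
Qed.

Lemma smap_surj (U : opens (spec C)) : U `<=` range (spec_map i) ->
  forall t, exists s, smap j U s = t.
Proof.
move=> Ui t; have [K [h [hh [hi VU cov]]]] := isolating_cover Ui.
have hom d : exists s, smap j U s = hcomp d t.
  have dt := hcomp_gr d t; move: (hcomp d t) dt => {}t dt.
  have exs k : exists s, smap j (basic_open (hh k)) s = res OY (preS (VU k)) t.
    by have [g _ gK] := smap_isolating (hh k) (hi k); exists (g (res OY (preS (VU k)) t)).
  pose s k := sval (cid (exs k)); have sE k : smap j _ (s k) = _ := svalP (cid (exs k)).
  have Vi k : basic_open (hh k) `<=` range (spec_map i) by move=> p /VU/Ui.
  have sd k : dgr d (s k).
    by apply: (diracHom_inj_dgr (smap_inj (Vi k))); rewrite sE; apply: dhomP.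
  have [|s0 [[s0d s0E] _]] := ssheafP VU cov sd.
    (* Local preimages agree on overlaps by injectivity over every open subset of the image, so
       overlaps need not be basic. *)
    move=> k l W Wk Wl; apply: smap_inj; first by move=> p /Wk/Vi.
    rewrite (smap_natural j _ (preS Wk)) (smap_natural j _ (preS Wl)) !sE.
    have WU : W `<=` U by move=> p /Wk/VU.
    transitivity (res OY (preS WU) t); first exact: res_comp.
    exact/esym/res_comp.
  exists s0; apply: (sheaf_ext (VU := fun k => preS (VU k)) (@ssheafP _ OY) _ (dhomP _ s0d) dt).
    by move=> q /cov[k _ kq]; exists k.
  by move=> k; rewrite -sE -(smap_natural j (VU k)) s0E.
have /choice[s sE] := hom; have [u [_ _ tE]] := hcomp_support t.
by exists (\sum_(e <- u) s e); rewrite rmorph_sum [RHS]tE; apply: eq_bigr => e _.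
Qed.

Theorem local_iso_open_immersion : open_immersion j.
Proof.
split.
  split; [exact: spec_map_continuous|exact: spec_map_inj|exact: spec_map_open].
move=> V qV qVE VqV.
(* Injectivity on points makes the restriction to [V] in the definition an identity. *)
have VE : V = pre qV.
  apply/opens_eq/seteqP; split=> // q /=; rewrite qVE => -[q' Vq' /spec_map_inj<-//].
have Ui : qV `<=` range (spec_map i) by rewrite qVE => _ [q _ <-]; exists q.
rewrite VE in VqV *; have [g gP] := choice (smap_surj Ui).
exists g => s; last by rewrite gP; apply: res_id.
by apply: (smap_inj Ui); rewrite gP; apply: res_id.
Qed.

End Sheaves.
End LocalIso.

Theorem theorem3p43 (A B : diracRing) (phi : diracHom A B)
  (phi_qf : quasi_finite phi)
  (OX : structureSheaf (integral_closure phi)) (OY : structureSheaf B)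
  (j : specMorphism (integral_closure_incl phi) OX OY) :
  open_immersion j.
Proof.
apply: local_iso_open_immersion => [|q]; first exact: val_inj.
have [f [ef qf fG fP]] := zariski_main_dirac q phi_qf.
have lift b : subring_gen (integral phi) b -> exists c : integral_closure phi,
    integral_closure_incl phi c = b.
  by move=> /mem_set Gb; exists (Sub b Gb); apply: SubK.
have [h hE] := lift f fG; exists h; rewrite ?hE //; split.
  by have [d [df de]] := ef; exists d; split=> //; rewrite -hE in df.
by move=> b; have [N /lift[c cE]] := fP b; exists N, c; rewrite hE.
Qed.
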